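(* Let $d\ge1$ and $0<s<d$, and let $C_{s,d}$ be the constant, independent of the lattice, such that for every lattice $\Lambda\subset\mathbb{R}^d$, as $N\to\infty$, $$\mathcal{E}_{s,\Lambda}(N)=\frac{2\pi^{d/2}|\Lambda|^{-1}}{\Gamma\left(\frac s2\right)(d-s)}N^2+C_{s,d}\,|\Lambda|^{-s/d}N^{1+\frac sd}+o\big(N^{1+\frac sd}\big).$$ Then for every lattice $\Lambda\subset\mathbb{R}^d$ and every open bounded set $\mathcal{D}\subset\mathbb{R}^d$ whose boundary has Lebesgue measure zero and with $|\mathcal{D}||\Lambda|=1$, $$C_{s,d}\le-\frac{\pi^{s-\frac d2}\,\Gamma\left(\frac{d-s}2\right)}{\Gamma\left(\frac s2\right)|\Lambda|^{1-\frac sd}}\,I_\nu^{\mathcal{D}}(d-s).$$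
   Context: A lattice is $\Lambda=A\mathbb{Z}^d$ with $A$ a nonsingular real $d\times d$ matrix, with co-volume $|\Lambda|=|\det A|$ and dual lattice $\Lambda^*=(A^t)^{-1}\mathbb{Z}^d$. For a measurable set $\mathcal{D}\subset\mathbb{R}^d$, $|\mathcal{D}|$ is its Lebesgue measure. For $0<s<d$ and $x\in\mathbb{R}^d\setminus\Lambda$ define $$F_{s,\Lambda}(x)=\sum_{v\in\Lambda}\int_1^{+\infty}e^{-|x+v|^2t}\frac{t^{\frac s2-1}}{\Gamma(\frac s2)}\,dt+\frac1{|\Lambda|}\sum_{w\in\Lambda^*\setminus\{0\}}e^{2\pi i\langle x,w\rangle}\int_0^1\frac{\pi^{d/2}}{t^{d/2}}e^{-\frac{\pi^2|w|^2}{t}}\frac{t^{\frac s2-1}}{\Gamma(\frac s2)}\,dt$$ (the formula gives $+\infty$ for $x\in\Lambda$). The periodic Riesz $s$-energy of $\omega=(x_1,\dots,x_N)$ is $E_{s,\Lambda}(\omega)=\sum_{k\ne j}F_{s,\Lambda}(x_k-x_j)$ (sum over ordered pairs), and the minimal periodic Riesz $s$-energy is $\mathcal{E}_{s,\Lambda}(N)=\inf_{\omega\in(\mathbb{R}^d)^N}E_{s,\Lambda}(\omega)$. The existence of the constant $C_{s,d}$ with the stated asymptotics for all lattices is a known theorem (Hardin, Saff, Simanek, Su) and may be assumed. For $0<t<d$, $$I_\nu^{\mathcal{D}}(t)=\int_{\mathcal{D}\times\mathcal{D}}\frac{1}{|x-y|^t}\,d\nu(x)\,d\nu(y),$$ where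 $\nu$ is the multiple of Lebesgue measure on $\mathbb{R}^d$ such that a fundamental domain of $\Lambda^*$ has $\nu$-measure $1$ (i.e. $\nu=|\Lambda|$ times Lebesgue measure). *)

(* Defs.v *)
From HB Require Import structures.
From mathcomp Require Import all_boot all_order all_algebra.
From mathcomp Require Import complex.
From mathcomp Require Import all_classical all_reals all_analysis.

Set Implicit Arguments.
Unset Strict Implicit.
Unset Printing Implicit Defensive.

Import Order.TTheory GRing.Theory Num.Theory.
Import numFieldNormedType.Exports.

Local Open Scope classical_set_scope.
Local Open Scope ring_scope.

(* Column vectors carry the product sigma-algebra, generated by the
   coordinates. For T = R this is the Borel sigma-algebra of R^n. *)
Section measurable_cV.
Context d (T : measurableType d) (n : nat).

Definition cV_coord (i : 'I_n) (x : 'cV[T]_n) : T := x i 0.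

Let cV_set0 : g_sigma_preimage cV_coord set0.
Proof. exact: sigma_algebra0. Qed.

Let cV_setC A : g_sigma_preimage cV_coord A -> g_sigma_preimage cV_coord (~` A).
Proof. exact: sigma_algebraC. Qed.

Let cV_bigcup (F : _^nat) : (forall i, g_sigma_preimage cV_coord (F i)) ->
  g_sigma_preimage cV_coord (\bigcup_i (F i)).
Proof. exact: sigma_algebra_bigcup. Qed.

HB.instance Definition _ := @isMeasurable.Build (measure_tuple_display d)
  'cV[T]_n (g_sigma_preimage cV_coord) cV_set0 cV_setC cV_bigcup.

Lemma measurable_cV_coord (i : 'I_n) :
  measurable_fun [set: 'cV[T]_n] (cV_coord i).
Proof.
move=> _ Y mY; rewrite setTI; apply: sub_sigma_algebra => /=.
rewrite -bigcup_seq/=; exists i => /=; first by rewrite mem_index_enum.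
by exists Y => //; rewrite setTI.
Qed.

End measurable_cV.

Lemma measurable_fun_cV d1 d2 (T1 : measurableType d1) (T2 : measurableType d2)
    n (f : T1 -> 'cV[T2]_n) :
  (forall i, measurable_fun [set: T1] (fun x => f x i 0)) ->
  measurable_fun [set: T1] f.
Proof.
move=> mf _ A mA; rewrite setTI.
suff : g_sigma_preimage (fun i => @cV_coord _ T2 n i \o f) `<=` measurable.
  rewrite g_sigma_preimage_comp => h.
  by apply: h; exists A => //; rewrite setTI.
apply: smallest_sub; first exact: sigma_algebra_measurable.
case: n => [|n] in f mf A mA *; first by rewrite big_ord0.
rewrite -bigcup_mkord_ord; apply: bigcup_sub => i Ii.
by move=> B [C mC <-]; exact: mf.
Qed.

Section lebesgue_cV.
Variable R : realType.

Definition consV n (p : measurableTypeR R * 'cV[R]_n) : 'cV[R]_n.+1 :=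
  col_mx (const_mx p.1 : 'cV[R]_1) p.2.

Lemma consV0 n (p : measurableTypeR R * 'cV[R]_n) : consV p 0 0 = p.1.
Proof.
have := col_mxEu (const_mx p.1 : 'cV[R]_1) p.2 0 0.
rewrite [X in _ = X]mxE => <-.
by rewrite /consV; congr (_ _ _); exact/val_inj.
Qed.

Lemma consVS n (p : measurableTypeR R * 'cV[R]_n) (i : 'I_n) :
  consV p (lift ord0 i) 0 = p.2 i 0.
Proof.
rewrite -(col_mxEd (const_mx p.1 : 'cV[R]_1) p.2 i 0) /consV.
by congr (_ _ _); exact/val_inj.
Qed.

Lemma measurable_consV n : measurable_fun setT (@consV n).
Proof.
apply: measurable_fun_cV => i; have [j ->|->] := unliftP ord0 i.
- rewrite (_ : (fun _ => _) = @cV_coord _ R n j \o snd); last first.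
    by apply/funext => p; rewrite consVS.
  exact: (measurableT_comp (@measurable_cV_coord _ R n j)).
- rewrite (_ : (fun _ => _) = fst); first exact: measurable_fst.
  by apply/funext => p; rewrite consV0.
Qed.


HB.instance Definition _ n := isMeasurableFun.Build _ _ _ _ (@consV n)
  (@measurable_consV n).

Definition tailV n (x : 'cV[R]_n.+1) : 'cV[R]_n := \col_i x (lift ord0 i) 0.

Lemma measurable_tailV n : measurable_fun setT (@tailV n).
Proof.
apply: measurable_fun_cV => i.
rewrite (_ : (fun _ => _) = cV_coord (lift ord0 i)); last first.
  by apply/funext => x; rewrite mxE.
exact: measurable_cV_coord.
Qed.

Section step.
Variables (n : nat) (mu : {sigma_finite_measure set 'cV[R]_n -> \bar R}).

Definition lebesgue_cV_step : set 'cV[R]_n.+1 -> \bar R :=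
  pushforward (lebesgue_measure \x mu)%E (@consV n).

Let step0 : lebesgue_cV_step set0 = 0%E.
Proof. exact: measure0. Qed.

Let step_ge0 A : (0 <= lebesgue_cV_step A)%E.
Proof. exact: measure_ge0. Qed.

Let step_sigma_additive : semi_sigma_additive lebesgue_cV_step.
Proof. exact: measure_semi_sigma_additive. Qed.

HB.instance Definition _ := isMeasure.Build _ _ _ lebesgue_cV_step
  step0 step_ge0 step_sigma_additive.

Let step_sigma_finite : sigma_finite setT lebesgue_cV_step.
Proof.
have /sigma_finiteP[F [TF ndF Foo]] :=
  sigma_finiteT (@lebesgue_measure R : {sigma_finite_measure set _ -> \bar R}).
have /sigma_finiteP[G [TG ndG Goo]] := sigma_finiteT mu.
pose H k := @cV_coord _ R n.+1 0 @^-1` F k `&` @tailV n @^-1` G k.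
have mH k : measurable (H k).
  have [mF _] := Foo k; have [mG _] := Goo k.
  apply: measurableI; rewrite -[X in measurable X]setTI.
  - exact: (@measurable_cV_coord _ R n.+1 0).
  - exact: measurable_tailV.
exists H; last first.
  move=> k; split => //; have [mF Fk] := Foo k; have [mG Gk] := Goo k.
  rewrite /lebesgue_cV_step /pushforward.
  rewrite (_ : _ @^-1` _ = F k `*` G k).
    by rewrite product_measure1E// lte_mul_pinfty// ge0_fin_numE.
  have tail p : tailV (@consV n p) = p.2.
    by apply/colP => i; rewrite mxE consVS.
  by apply/seteqP; split=> p; rewrite /H/= /cV_coord consV0 tail.
apply/seteqP; split => // x _.
have [i _ Fi] : (\bigcup_i F i) (x 0 0) by rewrite -TF.
have [j _ Gj] : (\bigcup_i G i) (tailV x) by rewrite -TG.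
exists (maxn i j) => //; split.
- by have /subsetPset := ndF _ _ (leq_maxl i j); exact.
- by have /subsetPset := ndG _ _ (leq_maxr i j); exact.
Qed.

HB.instance Definition _ := Measure_isSigmaFinite.Build _ _ _ lebesgue_cV_step
  step_sigma_finite.

End step.

Fixpoint lebesgue_cV n : {sigma_finite_measure set 'cV[R]_n -> \bar R} :=
  if n is n'.+1 then lebesgue_cV_step (lebesgue_cV n') else dirac (0 : 'cV[R]_0).

Lemma measurable_box n (a b : 'cV[R]_n) :
  measurable [set x : 'cV[R]_n | forall i, a i 0 <= x i 0 <= b i 0].
Proof.
rewrite (_ : mkset _ =
    \bigcap_(i in [set: 'I_n]) (@cV_coord _ R n i @^-1` `[a i 0, b i 0])).
  apply: fin_bigcap_measurable => // i _.
  rewrite -[X in measurable X]setTI.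
  exact: (@measurable_cV_coord _ R n i).
apply/seteqP; split=> x /= xab i; have := xab i; rewrite ?in_itv//=.
by apply.
Qed.

(* The values on boxes determine lebesgue_cV among measures on R^n. *)
Lemma lebesgue_cV_box n (a b : 'cV[R]_n) : (forall i, a i 0 <= b i 0) ->
  lebesgue_cV n [set x : 'cV[R]_n | forall i, a i 0 <= x i 0 <= b i 0] =
    (\prod_(i < n) (b i 0 - a i 0))%:E.
Proof.
elim: n a b => [|n IHn] a b ab.
  by rewrite big_ord0 /= diracE mem_set//= => -[].
rewrite /= /lebesgue_cV_step /pushforward big_ord_recl.
have -> : @consV n @^-1` [set x : 'cV[R]_n.+1 | forall i, a i 0 <= x i 0 <= b i 0]
  = `[a 0 0, b 0 0] `*`
    [set x : 'cV[R]_n | forall i, tailV a i 0 <= x i 0 <= tailV b i 0].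
  apply/seteqP; split => [p Bp|p [/= p1 p2] i].
    split; first by have := Bp 0; rewrite consV0 /= in_itv.
    by move=> i; have := Bp (lift ord0 i); rewrite consVS !mxE.
  have [j ->|->] := unliftP ord0 i.
    by have := p2 j; rewrite consVS !mxE.
  by rewrite consV0; move: p1; rewrite in_itv.
rewrite product_measure1E//; last exact: measurable_box.
rewrite IHn; last by move=> i; rewrite !mxE.
rewrite EFinM; congr (_ * _%:E)%E.
  apply: etrans (lebesgue_measure_itv `[a 0 0, b 0 0]) _.
  rewrite /= lte_fin.
  by case: (ltgtP (a 0 0) (b 0 0)) (ab 0) => // -> _; rewrite subrr.
by apply: eq_bigr => i _; rewrite !mxE.
Qed.

End lebesgue_cV.

Section lattice.
Variable R : realType.

(* Euclidean structure; the norm `|x| of 'cV[R]_d is the sup norm. *)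
Definition dotp d (x y : 'cV[R]_d) : R := \sum_i x i 0 * y i 0.
Definition enorm d (x : 'cV[R]_d) : R := Num.sqrt (dotp x x).

(* A lattice is represented by a generating matrix A \in unitmx. *)
Definition lattice d (A : 'M[R]_d) : set 'cV[R]_d :=
  range (fun z : 'cV[int]_d => A *m map_mx intr z).

Definition dual_lattice d (A : 'M[R]_d) : set 'cV[R]_d :=
  lattice (invmx A^T).

Definition covolume d (A : 'M[R]_d) : R := `|\det A|.

(* The multiple of Lebesgue measure giving mass 1 to a fundamental domain of
   the dual lattice. *)
Definition dual_measure d (A : 'M[R]_d) : set 'cV[R]_d -> \bar R :=
  mscale `|\det A|%:nng (lebesgue_cV R d).

HB.instance Definition _ d (A : 'M[R]_d) := Measure.on (dual_measure A).

Let dual_measure_sigma_finite d (A : 'M[R]_d) :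
  sigma_finite setT (dual_measure A).
Proof.
have [F TF Foo] := sigma_finiteT (lebesgue_cV R d).
exists F => // k; have [mF Fk] := Foo k; split => //.
by rewrite /dual_measure /mscale/= lte_mul_pinfty.
Qed.

Let dual_measure_sfinite d (A : 'M[R]_d) : sfinite_measure (dual_measure A).
Proof. exact/sfinite_measure_sigma_finite/dual_measure_sigma_finite. Qed.

HB.instance Definition _ d (A : 'M[R]_d) :=
  @isSFinite.Build _ _ _ (dual_measure A) (dual_measure_sfinite A).

HB.instance Definition _ d (A : 'M[R]_d) :=
  @isSigmaFinite.Build _ _ _ (dual_measure A) (dual_measure_sigma_finite A).

(* The integrand is 0, rather than +oo, on the diagonal x = y, which is a null
   set when d > 0. *)
Definition riesz_integral d (A : 'M[R]_d) (D : set 'cV[R]_d) (t : R) : \bar R :=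
  (\int[dual_measure A \x dual_measure A]_(p in D `*` D)
     (enorm (p.1 - p.2) `^ t)^-1%:E)%E.

End lattice.

Section riesz_energy.
Variable R : realType.
Local Notation mu := (@lebesgue_measure R).

Definition Gamma (z : R) : R :=
  \int[mu]_(t in `]0, +oo[) (t `^ (z - 1) * expR (- t)).

(* Unconditional sum of a family of signed extended reals. *)
Definition sumset (T : choiceType) (S : set T) (f : T -> \bar R) : \bar R :=
  (\esum_(x in S) f^\+ x - \esum_(x in S) f^\- x)%E.

Definition expi (x : R) : R[i] := (cos x +i* sin x)%C.

(* The terms of the sum over the dual lattice at w and -w are complex
   conjugates, so that this sum is real and equal to the sum of the real
   parts of its terms. *)
Definition periodic_riesz d (A : 'M[R]_d) (s : R) (x : 'cV[R]_d) : \bar R :=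
  (\esum_(v in lattice A)
     \int[mu]_(t in `[1%R, +oo[)
       (expR (- (enorm (x + v) ^+ 2 * t)) *
        (t `^ (s / 2 - 1) / Gamma (s / 2)))%:E
   + (covolume A)^-1%:E *
     sumset (dual_lattice A `\ 0%R) (fun w =>
       (complex.Re (expi (2 * pi * dotp x w)))%:E *
       \int[mu]_(t in `[0%R, 1%R])
         (pi `^ (d%:R / 2) / t `^ (d%:R / 2) *
          expR (- (pi ^+ 2 * enorm w ^+ 2 / t)) *
          (t `^ (s / 2 - 1) / Gamma (s / 2)))%:E))%E.

Definition riesz_energy d (A : 'M[R]_d) (s : R) N (x : 'I_N -> 'cV[R]_d)
    : \bar R :=
  (\sum_(k < N) \sum_(j < N | j != k) periodic_riesz A s (x k - x j)%R)%E.

(* This infimum is finite: periodic_riesz is bounded below, and real-valued off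
   the lattice. *)
Definition min_riesz_energy d (A : 'M[R]_d) (s : R) N : \bar R :=
  ereal_inf (range (@riesz_energy d A s N)).

End riesz_energy.

(* Main.v *)
Require Import Defs.
From HB Require Import structures.
From mathcomp Require Import all_boot all_order all_algebra all_fingroup finmap.
From mathcomp Require Import complex.
From mathcomp Require Import all_classical all_reals all_analysis.
From mathcomp Require Import measurable_realfun ring lra zify.

Set Implicit Arguments.
Unset Strict Implicit.
Unset Printing Implicit Defensive.

Import Order.TTheory GRing.Theory Num.Theory.
Import numFieldNormedType.Exports.

Local Open Scope classical_set_scope.
Local Open Scope ring_scope.

(** Both sides of the claim depend on the lattice only through its covolume, so
    the asymptotic expansion is only needed for Z^d. For N distinct integer
    frequencies w_1, ..., w_N, the determinantal process with kernel
    sum_i exp(2 i pi <x - y, w_i>) on the grid ((1/M) Z / Z)^d has mean energy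
    sum_(i != j) of the grid average of F(x) (1 - cos(2 pi <x, w_i - w_j>)). As
    M tends to infinity the limsup of this average is at most the mean V of F
    minus its Fourier coefficient kappa |w_i - w_j|^(s-d), hence
      E(N) <= V N^2 - kappa sum_(i != j) |w_i - w_j|^(s-d).
    Take for the w_i the corners of the cells of side 1/n, scaled by n, that are
    contained in D: the last sum is then a Riemann sum of the Riesz integral of
    D, which Fatou's lemma bounds from below. Comparison with the expansion of
    E(N), where N <= n^d / |Lambda|, gives the inequality. *)

(** * Determinantal processes on a finite set *)

(** Cutting F at t = 1 makes its grid averages computable. The Gaussian sums (t >= 1), averaged over
    the grid, become Riemann sums over (1/M) Z^d; the dual sum (t <= 1) is an absolutely convergent
    cosine series, on which the grid characters are orthogonal up to aliasing. The two halves of the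
    Fourier coefficient are incomplete Gamma integrals that add up to kappa |w|^(s-d), whatever the
    cut. The obstacle is the pole of F at 0, a grid point: the average of F alone is +oo. The factor
    1 - cos produced by the determinant vanishes there, with 0 * +oo = 0. Losing that point also
    makes the Riemann sums O(t^(-d/2)) uniformly in M, hence dominated for t >= 1 because s < d.
    Aliasing only lowers the average, so an upper bound needs no estimate of it. The power of
    |Lambda| in the claim appears at the end: if u is the nu-mass of a cell of side 1/n, then
    n^(d-s) u^2 = |Lambda|^(1-s/d) u^(1+s/d), while N u <= 1. *)

Section determinantal.
Variables (C : numClosedFieldType) (X : finType) (N : nat).
Variables (phi : 'I_N -> X -> C) (c : C).
Hypothesis c_gt0 : 0 < c.
Hypothesis orth : forall i j, \sum_x phi i x * (phi j x)^* = c *+ (i == j).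

Let psi i j a := phi i a * (phi j a)^*.
Let Phi (x : {ffun 'I_N -> X}) := \matrix_(k < N, i < N) phi i (x k).
Let weight x := \det (Phi x) * (\det (Phi x))^*.

(** Leibniz expansion of both determinants: each term is a product of functions of the single points
    [x k], so it can be summed over configurations one coordinate at a time. *)
Let weightE x : weight x = \sum_(s : 'S_N) \sum_(t : 'S_N)
  (-1) ^+ s * (-1) ^+ t * \prod_k psi (s k) (t k) (x k).
Proof.
rewrite /weight /determinant rmorph_sum mulr_suml; apply: eq_bigr => s _.
rewrite mulr_sumr; apply: eq_bigr => t _.
rewrite rmorphM rmorphXn rmorphN rmorph1 rmorph_prod mulrACA; congr (_ * _).
by rewrite -big_split; apply: eq_bigr => k _; rewrite !mxE.
Qed.

Let weight_ge0 x : 0 <= weight x.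
Proof. by rewrite /weight -normCK exprn_ge0. Qed.

Let weight_inj x : weight x != 0 -> injective x.
Proof.
move=> wx k l xkl; apply/eqP/negPn/negP => kl; move/negP: wx; apply.
rewrite /weight (determinant_alternate kl) ?mul0r// => i.
by rewrite !mxE xkl.
Qed.

Let sum_prod (h : 'I_N -> X -> C) :
  \sum_(x : {ffun 'I_N -> X}) \prod_k h k (x k) = \prod_k \sum_a h k a.
Proof. by rewrite bigA_distr_bigA. Qed.

(** By orthogonality only [t = s] survives, and each of the N! permutations contributes [c ^+ N]. *)
Let weight_sum : \sum_x weight x = c ^+ N *+ N`!.
Proof.
under eq_bigr do rewrite weightE.
rewrite exchange_big -card_Sn -sumr_const; apply: eq_bigr => s _.
rewrite exchange_big (bigD1 s)//= [X in _ + X]big1 ?addr0.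
  rewrite -mulr_sumr (sum_prod (fun k => psi (s k) (s k))) -signr_addb addbb mul1r.
  rewrite -[in RHS](card_ord N) -prodr_const.
  by apply: eq_bigr => k _; rewrite orth eqxx.
move=> t ts; rewrite -mulr_sumr (sum_prod (fun k => psi (s k) (t k))).
have [k /negPf kst] : exists k, s k != t k.
  apply/existsP; rewrite -negb_forall; apply: contra ts => /forallP st.
  by apply/eqP/permP => k; rewrite (eqP (st k)).
by rewrite (bigD1 k)//= orth kst mul0r mulr0.
Qed.

Let sum_pair (h : 'I_N -> X -> C) (g : X -> X -> C) k l : k != l ->
  \sum_(x : {ffun 'I_N -> X}) g (x k) (x l) * \prod_j h j (x j) =
  \sum_a \sum_b g a b * (h k a * h l b *
    \prod_(j | (j != k) && (j != l)) \sum_a h j a).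
Proof.
move=> kl.
transitivity (\sum_a \sum_b g a b *
    \sum_(x : {ffun 'I_N -> X} | (x k == a) && (x l == b)) \prod_j h j (x j)).
  rewrite (partition_big (fun x : {ffun _} => x k) xpredT)//=.
  apply: eq_bigr => a _.
  rewrite (partition_big (fun x : {ffun _} => x l) xpredT)//=.
  apply: eq_bigr => b _; rewrite mulr_sumr.
  by apply: eq_bigr => x /andP[/eqP-> /eqP->].
apply: eq_bigr => a _; apply: eq_bigr => b _; congr (_ * _).
(* [h'] carries the constraints [x k = a] and [x l = b] as 0/1 factors at the coordinates [k] and
   [l], so that the constrained sum becomes a free one and still factors. *)
pose h' j z := h j z *+ ((j == k) ==> (z == a)) *+ ((j == l) ==> (z == b)).
rewrite big_mkcond/=.
transitivity (\sum_(x : {ffun 'I_N -> X}) \prod_j h' j (x j)).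
  apply: eq_bigr => x _; case: ifPn => [/andP[/eqP xk /eqP xl]|].
    apply: eq_bigr => j _; rewrite /h'.
    have [->|_] := eqVneq j k; first by rewrite (negPf kl) xk eqxx.
    by have [->|_] := eqVneq j l; rewrite ?xl ?eqxx.
  rewrite negb_and => /orP[xk|xl].
    by rewrite (bigD1 k)//= /h' eqxx (negPf xk)/= mulr0n mul0rn mul0r.
  by rewrite (bigD1 l)//= /h' eqxx (negPf xl)/= mulr0n mul0r.
rewrite sum_prod (bigD1 k)//= (bigD1 l)//=; last by rewrite eq_sym.
rewrite mulrA; congr (_ * _ * _).
- rewrite (bigD1 a)//= /h' !eqxx (negPf kl)/= big1 ?addr0// => z /negPf ->.
  by rewrite mulr0n.
- rewrite (bigD1 b)//= /h' !eqxx eq_sym (negPf kl)/= big1 ?addr0// => z /negPf ->.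
  by rewrite mulr0n.
- apply: eq_bigr => j /andP[/negPf jk /negPf jl]; apply: eq_bigr => z _.
  by rewrite /h' jk jl.
Qed.

(** Summed over [i] and [j] this is K(a,a) K(b,b) - K(a,b) K(b,a) for the kernel K(a,b) = sum_i
    [phi i a * (phi i b)^*], that is, up to normalisation, the two-point correlation of the
    process. *)
Let minor i j a b := psi i i a * psi j j b - psi i j a * psi j i b.

(** [t * s^-1] fixes every index other than [k] and [l], so it is the identity or their
    transposition. These are the only [t] left in [weight_pair], where orthogonality sums out all
    other coordinates. *)
Let tperm_case (s t : 'S_N) k l : k != l ->
  (forall j, j != k -> j != l -> s j = t j) ->
  t = s \/ t = (tperm k l * s)%g.
Proof.
move=> kl st.
pose u := (t * s^-1)%g.
have tE : t = (u * s)%g by rewrite /u mulgKV.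
have uj j : j != k -> j != l -> u j = j.
  by move=> jk jl; rewrite /u permM -st// permK.
have ukl i : i \in [:: k; l] -> u i \in [:: k; l].
  move=> ikl; apply/negPn/negP; rewrite !inE negb_or => /andP[uk ul].
  have := uj _ uk ul => /perm_inj ui; move: ikl; rewrite !inE.
  by rewrite ui in uk ul; rewrite (negPf uk) (negPf ul).
have : u k \in [:: k; l] by apply: ukl; rewrite !inE eqxx.
have : u l \in [:: k; l] by apply: ukl; rewrite !inE eqxx orbT.
rewrite !inE => /orP[] /eqP ul /orP[] /eqP uk.
- by move: kl; rewrite -(inj_eq (@perm_inj _ u)) uk ul eqxx.
- right; rewrite tE; congr (_ * _)%g; apply/permP => j.
  by case: tpermP => [->|->|/eqP jk /eqP jl]; rewrite ?uk ?ul// uj.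
- left; rewrite tE -[RHS]mul1g; congr (_ * _)%g; apply/permP => j; rewrite perm1.
  have [->//|jk] := eqVneq j k; have [->//|jl] := eqVneq j l.
  exact: uj.
- by move: kl; rewrite -(inj_eq (@perm_inj _ u)) uk ul eqxx.
Qed.

(** The term [t = s] gives the product of densities, the term [t = tperm k l * s] the exchange term
    with sign -1; together they form [minor]. Each of the other [N - 2] coordinates contributes
    [c]. *)
Let weight_pair (g : X -> X -> C) k l : k != l ->
  \sum_x weight x * g (x k) (x l) =
  c ^+ (N - 2) * \sum_(s : 'S_N) \sum_a \sum_b g a b * minor (s k) (s l) a b.
Proof.
move=> kl.
have cardkl : #|[pred j : 'I_N | (j != k) && (j != l)]| = (N - 2)%N.
  rewrite -[in RHS](card_ord N) -(cardC [pred j | (j == k) || (j == l)]).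
  have -> : #|[pred j | (j == k) || (j == l)]| = 2%N.
    have kl2 : uniq [:: k; l] by rewrite /= inE kl.
    rewrite -[2%N]/(size [:: k; l]) -(card_uniqP kl2).
    by apply: eq_card => j; rewrite !inE.
  by rewrite addKn; apply: eq_card => j; rewrite !inE negb_or.
transitivity (\sum_(s : 'S_N) \sum_(t : 'S_N) (-1) ^+ s * (-1) ^+ t *
    \sum_(x : {ffun 'I_N -> X}) g (x k) (x l) * \prod_j psi (s j) (t j) (x j)).
  under eq_bigr do rewrite weightE mulr_suml.
  rewrite exchange_big; apply: eq_bigr => s _.
  under eq_bigr do rewrite mulr_suml.
  rewrite exchange_big; apply: eq_bigr => t _; rewrite mulr_sumr.
  by apply: eq_bigr => x _; rewrite -!mulrA; do 2![congr (_ * _)]; exact: mulrC.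
rewrite mulr_sumr; apply: eq_bigr => s _.
have stt : (tperm k l * s)%g != s.
  apply/eqP => /permP /(_ k); rewrite permM tpermL => /perm_inj lk.
  by rewrite lk eqxx in kl.
rewrite (bigD1 s)//= (bigD1 (tperm k l * s)%g)//= [X in _ + (_ + X)]big1 ?addr0.
  rewrite (sum_pair (fun j => psi (s j) (s j)) g kl).
  rewrite (sum_pair (fun j => psi (s j) ((tperm k l * s)%g j)) g kl).
  have prodc (t : 'S_N) : (forall j, j != k -> j != l -> s j = t j) ->
      \prod_(j | (j != k) && (j != l)) \sum_x psi (s j) (t j) x = c ^+ (N - 2).
    move=> st; rewrite -cardkl -prodr_const; apply: eq_bigr => j /andP[jk jl].
    by rewrite orth st// eqxx.
  rewrite !prodc//; last first.
    by move=> j jk jl; rewrite permM tpermD// eq_sym.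
  rewrite -!signr_addb addbb mul1r odd_mul_tperm kl addTb addbN addbb mulN1r.
  rewrite -sumrB mulr_sumr; apply: eq_bigr => a _.
  rewrite -sumrB mulr_sumr; apply: eq_bigr => b _.
  rewrite !permM tpermL tpermR /minor; ring.
move=> t /andP[ts tts]; rewrite (sum_pair (fun j => psi (s j) (t j)) g kl).
have [j /and3P[jk jl /negPf jst]] :
    exists j, [&& j != k, j != l & s j != t j].
  apply: contrapT => /forallNP st.
  have [] := @tperm_case s t k l kl; first 1 last.
  - by move/eqP; rewrite (negPf ts).
  - by move/eqP; rewrite (negPf tts).
  by move=> j jk jl; apply/eqP/negPn/negP => jst; apply: (st j); apply/and3P.
rewrite big1 ?mulr0// => a _; rewrite big1// => b _.
by rewrite (bigD1 j) ?jk ?jl//= orth jst mul0r !mulr0.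
Qed.

(* The weights |det (phi_i (x_k))|^2 / (c^N N!) sum to 1 and vanish unless x is
   injective. The right-hand side is the mean energy for these weights, so some
   configuration of nonzero weight has at most this energy. *)
Lemma determinantal_energy (g : X -> X -> C) :
  (forall a b, g a b \is Num.real) ->
  exists2 x : {ffun 'I_N -> X}, injective x &
    \sum_k \sum_(l | l != k) g (x k) (x l) <=
    c ^- 2 * \sum_i \sum_(j | j != i) \sum_a \sum_b g a b *
      (phi i a * (phi i a)^* * (phi j b * (phi j b)^*)
       - phi i a * (phi j a)^* * (phi j b * (phi i b)^*)).
Proof.
move=> gR; set B := c ^- 2 * _.
pose E (x : {ffun 'I_N -> X}) := \sum_k \sum_(l | l != k) g (x k) (x l).
have ER x : E x \is Num.real by apply: rpred_sum => k _; apply: rpred_sum.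
have wE : \sum_x weight x * E x = B * (c ^+ N *+ N`!).
  pose T i j := \sum_a \sum_b g a b * minor i j a b.
  transitivity (\sum_k \sum_(l | l != k) \sum_x weight x * g (x k) (x l)).
    under eq_bigr do rewrite mulr_sumr.
    rewrite exchange_big; apply: eq_bigr => k _.
    by under eq_bigr do rewrite mulr_sumr; rewrite exchange_big.
  transitivity (c ^+ (N - 2) * \sum_k \sum_(l | l != k)
      \sum_(s : 'S_N) T (s k) (s l)).
    rewrite mulr_sumr; apply: eq_bigr => k _; rewrite mulr_sumr.
    by apply: eq_bigr => l lk; rewrite weight_pair// eq_sym.
  have -> : \sum_k \sum_(l | l != k) \sum_(s : 'S_N) T (s k) (s l) =
      (\sum_i \sum_(j | j != i) T i j) *+ N`!.
    under eq_bigr do rewrite exchange_big/=.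
    rewrite exchange_big -card_Sn -sumr_const; apply: eq_bigr => s _.
    rewrite [RHS](reindex_inj (@perm_inj _ s)); apply: eq_bigr => k _.
    rewrite [RHS](reindex_inj (@perm_inj _ s)); apply: eq_bigl => l.
    by rewrite (inj_eq perm_inj).
  rewrite -[B]/(c ^- 2 * \sum_i \sum_(j | j != i) T i j).
  (* For [N < 2] the truncated [N - 2] breaks [c ^+ N = c ^+ (N - 2) * c ^+ 2], but then there is no
     pair [i != j] and both sides vanish. *)
  have [N2|N2] := leqP 2 N.
    have -> : c ^+ N = c ^+ (N - 2) * c ^+ 2 by rewrite -exprD subnK.
    have c2 : c ^+ 2 != 0 by rewrite expf_neq0 ?gt_eqF.
    rewrite !mulrnAr; congr (_ *+ _); rewrite [RHS]mulrC -mulrA; congr (_ * _).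
    by rewrite mulVKf.
  suff -> : \sum_i \sum_(j | j != i) T i j = 0 by rewrite !(mul0rn, mulr0, mul0r).
  apply: big1 => i _; apply: big_pred0 => j; apply/negbTE; rewrite negbK.
  apply/eqP/val_inj; have := ltn_ord i; have := ltn_ord j => /=.
  by case: N N2 (i : nat) (j : nat) => [|[]]// _ [|?] [|?].
have cN : c ^+ N *+ N`! != 0.
  by rewrite mulrn_eq0 negb_or -lt0n fact_gt0 expf_neq0// gt_eqF.
(* The order of [C] is partial: realness of [B], read off from [wE], is what turns the failure of
   [E x <= B] into [B < E x]. *)
have BR : B \is Num.real.
  rewrite -[B](mulfK cN) -wE rpredM//.
    by apply: rpred_sum => x _; rewrite rpredM// ger0_real ?weight_ge0.
  by rewrite rpredV rpredMn// rpredX// gtr0_real.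
apply: contrapT => H.
have lt x : weight x != 0 -> B < E x.
  move=> /weight_inj xinj; rewrite real_ltNge//.
  by apply/negP => ?; apply: H; exists x.
have /eqP : \sum_x weight x * (E x - B) = 0.
  under eq_bigr do rewrite mulrBr.
  by rewrite sumrB wE -mulr_suml weight_sum mulrC subrr.
rewrite psumr_eq0 => [/allP w0|x _]; last first.
  have [->|wx] := eqVneq (weight x) 0; first by rewrite mul0r.
  by rewrite mulr_ge0 ?weight_ge0// subr_ge0 ltW// lt.
have /eqP := weight_sum; rewrite big1 ?(negPf cN) 1?eq_sym ?(negPf cN)// => x _.
apply/eqP/negPn/negP => wx; have := w0 x (mem_index_enum _).
by rewrite mulf_eq0 (negPf wx) subr_eq0 gt_eqF// lt.
Qed.

End determinantal.

(** * Characters of the grid ((1/M) Z / Z)^d *)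

Section dotp_theory.
Variables (R : realType) (d : nat).
Implicit Types x y z : 'cV[R]_d.

Lemma dotpDl x y z : dotp (x + y) z = dotp x z + dotp y z.
Proof. by rewrite -big_split; apply: eq_bigr => i _; rewrite mxE mulrDl. Qed.

Lemma dotpNl x z : dotp (- x) z = - dotp x z.
Proof. by rewrite -sumrN; apply: eq_bigr => i _; rewrite mxE mulNr. Qed.

Lemma dotpC x y : dotp x y = dotp y x.
Proof. by apply: eq_bigr => i _; rewrite mulrC. Qed.

Lemma dotpBl x y z : dotp (x - y) z = dotp x z - dotp y z.
Proof. by rewrite dotpDl dotpNl. Qed.

Lemma dotpDr x y z : dotp z (x + y) = dotp z x + dotp z y.
Proof. by rewrite !(dotpC z) dotpDl. Qed.

Lemma dotpBr x y z : dotp z (x - y) = dotp z x - dotp z y.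
Proof. by rewrite !(dotpC z) dotpBl. Qed.

Lemma dotp_ge0 x : 0 <= dotp x x.
Proof. by apply: sumr_ge0 => i _; rewrite -expr2 sqr_ge0. Qed.

Lemma enorm_sqr x : enorm x ^+ 2 = dotp x x.
Proof. by rewrite sqr_sqrtr// dotp_ge0. Qed.

Lemma enorm_eq0 x : (enorm x == 0) = (x == 0).
Proof.
apply/eqP/eqP => [x0|->]; last first.
  by rewrite /enorm /dotp big1 ?sqrtr0// => i _; rewrite mxE mul0r.
have /eqP : dotp x x = 0 by rewrite -enorm_sqr x0 expr0n.
rewrite psumr_eq0 => [/allP x00|i _]; last by rewrite -expr2 sqr_ge0.
apply/colP => i; have := x00 i (mem_index_enum _).
by rewrite mulf_eq0 orbb mxE => /eqP.
Qed.

Lemma enorm_gt0 x : (0 < enorm x) = (x != 0).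
Proof. by rewrite lt_def enorm_eq0 sqrtr_ge0 andbT. Qed.

Lemma enormZ (a : R) x :
  enorm (a *: x) = `|a| * enorm x.
Proof.
rewrite /enorm (_ : dotp (a *: x) (a *: x) = a ^+ 2 * dotp x x).
  by rewrite sqrtrM ?sqr_ge0// sqrtr_sqr.
by rewrite /dotp mulr_sumr; apply: eq_bigr => i _; rewrite !mxE; ring.
Qed.

End dotp_theory.

Section expi_theory.
Variable R : realType.
Implicit Types x y : R.

Lemma expiD x y : expi (x + y) = expi x * expi y.
Proof. by rewrite /expi cosD sinD; congr (_ +i* _)%C; rewrite addrC; congr (_ + _); rewrite mulrC. Qed.

Lemma expi0 : expi 0 = 1 :> R[i].
Proof. by rewrite /expi cos0 sin0. Qed.

Lemma expiN x : expi (- x) = (expi x)^*.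
Proof. by rewrite /expi cosN sinN. Qed.

Lemma expi_sum (I : finType) (f : I -> R) :
  expi (\sum_i f i) = \prod_i expi (f i).
Proof. exact: (big_morph _ expiD expi0). Qed.

Lemma expiMn x n : expi (x *+ n) = expi x ^+ n.
Proof. by elim: n => [|n IH]; rewrite ?expi0// mulrS exprS expiD IH. Qed.

Lemma expi2pi : expi (2 * pi) = 1 :> R[i].
Proof. by rewrite mulrC mulr_natr /expi cos2pi sin2pi. Qed.

Lemma expi_int (n : int) : expi (2 * pi * n%:~R) = 1 :> R[i].
Proof.
case: n => n; last rewrite NegzE mulrNz mulrN expiN.
  by rewrite -pmulrn mulr_natr expiMn expi2pi expr1n.
by rewrite -pmulrn mulr_natr expiMn expi2pi expr1n rmorph1.
Qed.

Lemma cosDint x (n : int) : cos (x + 2 * pi * n%:~R) = cos x.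
Proof. by have /(congr1 (@complex.Re R)) := expiD x (2 * pi * n%:~R); rewrite expi_int mulr1. Qed.

Lemma cos_ratio_lt1 (r M : nat) : (0 < r < M)%N ->
  cos (2 * pi * (r%:R / M%:R)) < 1 :> R.
Proof.
move=> /andP[r0 rM].
have Mn0 := leq_ltn_trans (leq0n r) rM.
have M0 : 0 < M%:R :> R by rewrite ltr0n.
have -> : 2 * pi * (r%:R / M%:R) = (pi * (r%:R / M%:R)) *+ 2 :> R.
  by rewrite -[RHS]mulr_natl mulrA.
rewrite cos_mulr2n cos2sin2.
have : 0 < sin (pi * (r%:R / M%:R)) :> R.
  apply: sin_gt0_pi; rewrite mulr_gt0 ?pi_gt0 ?divr_gt0 ?ltr0n ?r0 ?Mn0//=.
  by rewrite gtr_pMr ?pi_gt0// ltr_pdivrMr// mul1r ltr_nat.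
by move=> s0; have := mulr_gt0 s0 s0; rewrite -expr2 mulr2n; lra.
Qed.

Lemma expi_ratio_neq1 (k : int) (M : nat) : (0 < M)%N -> ~~ (M %| k)%Z ->
  expi (2 * pi * (k%:~R / M%:R)) != 1 :> R[i].
Proof.
move=> M0 Mk.
have MR : (M%:R : R) != 0 by rewrite pnatr_eq0 -lt0n.
have kE := divz_eq k M.
have r0 : 0 <= (k %% M)%Z by rewrite modz_ge0// -lt0n.
have rM : (k %% M)%Z < M by rewrite ltz_pmod// -lt0n.
have rn0 : (k %% M)%Z != 0 by apply: contra Mk => /eqP r; apply/dvdz_mod0P.
case: (k %% M)%Z kE r0 rM rn0 => // r kE _ rM rn0.
apply/eqP => /(congr1 (@complex.Re R)) /=.
have -> : (k%:~R : R) = (k %/ M)%Z%:~R * M%:R + r%:R by rewrite {1}kE intrD intrM.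
rewrite [(_ + _) / _]mulrDl mulfK// mulrDr addrC cosDint.
by apply/eqP; rewrite lt_eqF// cos_ratio_lt1// lt0n rn0.
Qed.

Lemma sum_expi_ratio (k : int) (M : nat) : (0 < M)%N ->
  \sum_(a < M) expi (2 * pi * (k%:~R * (a%:R / M%:R))) =
  (M%:R : R[i]) *+ (M %| k)%Z.
Proof.
move=> M0; have MR : (M%:R : R) != 0 by rewrite pnatr_eq0 -lt0n.
pose z : R[i] := expi (2 * pi * (k%:~R / M%:R)).
have zE (a : nat) : expi (2 * pi * (k%:~R * (a%:R / M%:R))) = z ^+ a.
  rewrite -expiMn; congr expi; rewrite -mulr_natr; ring.
under eq_bigr do rewrite zE.
have [/dvdzP[q kq]|Mk] := boolP (M %| k)%Z.
  have -> : z = 1 by rewrite /z kq intrM -pmulrn mulfK// expi_int.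
  by under eq_bigr do rewrite expr1n; rewrite sumr_const card_ord.
have z1 : z - 1 != 0 by rewrite subr_eq0 expi_ratio_neq1.
apply: (mulfI z1); rewrite mulr0n mulr0 -subrX1 -zE divff// mulr1.
by rewrite expi_int subrr.
Qed.

End expi_theory.

Section grid.
Variables (R : realType) (d M : nat).
Hypothesis M0 : (0 < M)%N.
Local Notation X := {ffun 'I_d -> 'I_M}.

Definition intv (w : 'cV[int]_d) : 'cV[R]_d := map_mx intr w.

Definition gridpt (a : X) : 'cV[R]_d := \col_i ((a i)%:R / M%:R).

Definition dvdv (w : 'cV[int]_d) := [forall i, (M %| w i 0%R)%Z].

Lemma sum_grid_expi w :
  \sum_(a : X) expi (2 * pi * dotp (gridpt a) (intv w)) =
  ((M ^ d)%:R : R[i]) *+ dvdv w.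
Proof.
transitivity (\sum_(a : X) \prod_i
    (expi (2 * pi * ((w i 0)%:~R * ((a i)%:R / M%:R))) : R[i])).
  apply: eq_bigr => a _; rewrite -expi_sum mulr_sumr; congr expi.
  by apply: eq_bigr => i _; rewrite !mxE [X in _ * X]mulrC.
rewrite -(bigA_distr_bigA (fun i (a : 'I_M) =>
  expi (2 * pi * ((w i 0)%:~R * (a%:R / M%:R)) : R))).
under eq_bigr do rewrite sum_expi_ratio//.
have [/forallP wM|] := boolP (dvdv w).
  rewrite mulr1n (eq_bigr (fun=> M%:R)) => [|i _]; last by rewrite wM.
  by rewrite prodr_const card_ord natrX.
rewrite negb_forall => /existsP[i /negPf wi].
by rewrite (bigD1 i)//= wi mul0r.
Qed.

Lemma dotp_intv (v w : 'cV[int]_d) :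
  dotp (intv v) (intv w) = (\sum_i v i 0 * w i 0)%:~R.
Proof.
rewrite /dotp rmorph_sum.
by apply: eq_bigr => i _; rewrite !mxE rmorphM.
Qed.

(** The base point [a] drops out: the sum is nonzero only if [M] divides [w], and then the character
    is 1 at [a] as well. *)
Lemma sum_grid_cos w (a : X) :
  \sum_(b : X) cos (2 * pi * dotp (gridpt a - gridpt b) (intv w)) =
  (M ^ d)%:R *+ dvdv w.
Proof.
have -> : \sum_(b : X) cos (2 * pi * dotp (gridpt a - gridpt b) (intv w)) =
    complex.Re (\sum_(b : X) expi (2 * pi * dotp (gridpt a - gridpt b) (intv w))).
  by rewrite raddf_sum.
under eq_bigr do rewrite dotpBl mulrBr expiD expiN.
rewrite -mulr_sumr -rmorph_sum/= sum_grid_expi.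
have [/forallP wM|_] := boolP (dvdv w); last by rewrite !mulr0n rmorph0 mulr0.
rewrite !mulr1n rmorph_nat.
have -> : expi (2 * pi * dotp (gridpt a) (intv w)) = 1 :> R[i].
  have -> : dotp (gridpt a) (intv w) = (\sum_i (a i : int) * (w i 0%R %/ M)%Z)%:~R.
    rewrite /dotp rmorph_sum; apply: eq_bigr => i _.
    rewrite !mxE rmorphM/= -[in LHS](divzK (wM i)) intrM.
    have MR : M%:R != 0 :> R by rewrite pnatr_eq0 -lt0n.
    have ME (n : nat) : (n : int)%:~R = n%:R :> R by [].
    by rewrite !ME; field.
  exact: expi_int.
by rewrite mul1r -[(M ^ d)%:R]/(_ *+ _) raddfMn.
Qed.

(** The product formula for cosines spreads the frequency [u] over [u], [u + w] and [u - w]. In the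
    application [u] runs through the cosine series of the small-t part of the kernel. *)
Lemma sum_grid_cosM u w (a : X) :
  \sum_(b : X) cos (2 * pi * dotp (gridpt a - gridpt b) (intv u)) *
    (1 - cos (2 * pi * dotp (gridpt a - gridpt b) (intv w))) =
  (M ^ d)%:R * ((dvdv u)%:R - ((dvdv (u + w))%:R + (dvdv (u - w))%:R) / 2).
Proof.
have term (z : 'cV[R]_d) : cos (2 * pi * dotp z (intv u)) *
    (1 - cos (2 * pi * dotp z (intv w))) = cos (2 * pi * dotp z (intv u)) -
    (cos (2 * pi * dotp z (intv (u + w))) + cos (2 * pi * dotp z (intv (u - w)))) / 2.
  rewrite /intv map_mxD map_mxB dotpDr dotpBr.
  rewrite [2 * pi * (_ + _)]mulrDr [2 * pi * (_ - _)]mulrBr cosD cosB.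
  by field.
under eq_bigr do rewrite term.
rewrite sumrB -mulr_suml big_split/= !sum_grid_cos.
by case: (dvdv u) (dvdv (u + w)) (dvdv (u - w)) => [] [] [];
  rewrite ?(mulr0n, mulr1n); field.
Qed.

End grid.

(** * Theta sums as Riemann sums of Gaussian integrals *)

Section exp_dominated.
Variable R : realType.
Local Notation mu := (@lebesgue_measure R).
Implicit Types (f F : R -> R) (K l y : R).

Lemma is_derive_continuous f (df : R -> R) :
  (forall x : R, is_derive x 1 f (df x)) -> continuous f.
Proof. by move=> fdf x; apply/differentiable_continuous/derivable1_diffP; case: (fdf x). Qed.

Lemma is_derive_expRN (x : R) : is_derive x 1 (fun y : R => expR (- y)) (- expR (- x)).
Proof.
by apply: is_derive_eq; rewrite mulrN1.
Qed.

Lemma cvg_expRN : expR (- x) @[x --> +oo%R] --> (0 : R).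
Proof. exact: cvgr_expR. Qed.

Lemma continuous_expRN : continuous (fun y : R => expR (- y)).
Proof. exact: is_derive_continuous is_derive_expRN. Qed.

Lemma integral_expRN : (\int[mu]_(x in `[0%R, +oo[) (expR (- x))%:E = 1)%E.
Proof.
rewrite (@ge0_continuous_FTC2y _ _ (fun x => - expR (- x)) _ 0) => [|x _|||x _||x _].
- by rewrite oppr0 expR0 -EFinB opprK add0r.
- exact: expR_ge0.
- by apply: continuous_subspaceT; exact: continuous_expRN.
- by rewrite -oppr0; apply: cvgN; exact: cvg_expRN.
- by have ? := is_derive_expRN x; apply: derivableN.
- apply: cvg_at_right_filter; apply: cvgN; exact: continuous_expRN.
- by have ? := is_derive_expRN x; rewrite derive1E derive_val opprK.
Qed.

Lemma exp_dominated_integrable f K : continuous f ->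
  (forall y, 0 <= y -> `|f y| <= K * expR (- y)) ->
  mu.-integrable `[0%R, +oo[ (EFin \o f).
Proof.
move=> cf fK.
have ie : mu.-integrable `[0%R, +oo[ (EFin \o (fun y => expR (- y))).
  apply/integrableP; split.
    apply/measurable_EFinP/measurable_funTS; apply: continuous_measurable_fun.
    exact: continuous_expRN.
  under eq_integral do rewrite /= ger0_norm ?expR_ge0//.
  by rewrite integral_expRN ltry.
apply: (le_integrable _ _ _ (integrableZl _ K ie)) => //=.
  by apply/measurable_EFinP/measurable_funTS; apply: continuous_measurable_fun.
move=> y; rewrite in_itv/= andbT => y0; rewrite lee_fin.
by apply: le_trans (fK y y0) _; exact: ler_norm.
Qed.

(** [ge0_continuous_FTC2y] asks for a nonnegative integrand, whereas [f] may change sign: it is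
    applied to [f x + K * expR (- x)], and the integral [K] of the correction is then cancelled. *)
Lemma exp_dominated_FTC2y f F K l : continuous f ->
  (forall y, 0 <= y -> `|f y| <= K * expR (- y)) ->
  (forall x : R, is_derive x 1 F (f x)) -> F x @[x --> +oo%R] --> l ->
  \int[mu]_(x in `[0%R, +oo[) f x = l - F 0.
Proof.
move=> cf fK dF Fl.
have iKe : mu.-integrable `[0%R, +oo[ (EFin \o (fun y => K * expR (- y))).
  apply: (@exp_dominated_integrable _ `|K|).
    by move=> x; apply: cvgM; [exact: cvg_cst|exact: continuous_expRN].
  by move=> y _; rewrite normrM (ger0_norm (expR_ge0 _)).
have if_ := exp_dominated_integrable cf fK.
suff : \int[mu]_(x in `[0%R, +oo[) (f x + K * expR (- x)) = l - F 0 + K.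
  rewrite RintegralD// RintegralZl//; last first.
    apply: (@exp_dominated_integrable _ 1); first exact: continuous_expRN.
    by move=> y _; rewrite mul1r ger0_norm ?expR_ge0.
  by rewrite {2}/Rintegral integral_expRN mulr1 => /addIr.
have dG (x : R) : is_derive x 1 (fun y => F y - K * expR (- y)) (f x + K * expR (- x)).
  have ? := is_derive_expRN x; have ? := dF x.
  by apply: is_derive_eq; rewrite scalerN opprK.
rewrite /Rintegral (@ge0_continuous_FTC2y _ _ (fun x => F x - K * expR (- x)) _ l).
- by rewrite oppr0 expR0 mulr1 -EFinB/= opprD opprK addrA.
- move=> x x0; have := fK _ x0; rewrite ler_norml => /andP[? _]; lra.
- apply: continuous_subspaceT => x; apply: cvgD; first exact: cf.
  by apply: cvgM; [exact: cvg_cst|exact: continuous_expRN].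
- rewrite -[l]subr0 -(mulr0 K); apply: cvgB => //; apply: cvgM; first exact: cvg_cst.
  exact: cvg_expRN.
- by move=> x _; case: (dG x).
- by apply: cvg_at_right_filter; exact: is_derive_continuous dG _.
- by move=> x _; have ? := dG x; rewrite derive1E derive_val.
Qed.

End exp_dominated.

(** * Cosine transform of the Gaussian *)

Section gauss_fourier.
Variable R : realType.
Local Notation mu := (@lebesgue_measure R).
Implicit Types u y : R.

Lemma expRN_sqr_le y : 0 <= y -> expR (- y ^+ 2) <= expR 1 * expR (- y).
Proof.
by move=> y0; rewrite -expRD ler_expR; have := sqr_ge0 (y - 1); rewrite sqrrB1; lra.
Qed.

Lemma mul_expRN_sqr_le y : 0 <= y -> y * expR (- y ^+ 2) <= expR 1 * expR (- y).
Proof.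
move=> y0; apply: (@le_trans _ _ (expR y * expR (1 - y *+ 2))).
  apply: ler_pM; rewrite ?expR_ge0//.
    by have := expR_ge1Dx y; lra.
  by rewrite ler_expR; have := sqr_ge0 (y - 1); rewrite sqrrB1; lra.
by rewrite -!expRD ler_expR; lra.
Qed.

Let f u y := expR (- y ^+ 2) * cos (2 * u * y).
Let df u y := - (2 * y * expR (- y ^+ 2) * sin (2 * u * y)).

Let cf u : continuous (f u).
Proof.
by apply: (@is_derive_continuous _ _ (fun y => _)) => y; apply: is_derive_eq.
Qed.

Let cdf u : continuous (df u).
Proof.
by apply: (@is_derive_continuous _ _ (fun y => _)) => y; apply: is_derive_eq.
Qed.

Let f_le u y : 0 <= y -> `|f u y| <= expR 1 * expR (- y).
Proof.
move=> y0; rewrite normrM ger0_norm ?expR_ge0//.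
apply: le_trans (expRN_sqr_le y0).
by rewrite ler_piMr ?expR_ge0// cos_max.
Qed.

Let df_le u y : 0 <= y -> `|df u y| <= 2 * expR 1 * expR (- y).
Proof.
move=> y0; rewrite normrN normrM ger0_norm ?mulr_ge0 ?expR_ge0//.
rewrite -mulrA; apply: (@le_trans _ _ (2 * (y * expR (- y ^+ 2)))).
  by rewrite ler_piMr ?mulr_ge0 ?expR_ge0// sin_max.
by rewrite -mulrA ler_wpM2l// mul_expRN_sqr_le.
Qed.

Let intf u : mu.-integrable `[0%R, +oo[ (EFin \o f u).
Proof. exact: (exp_dominated_integrable (@cf u) (@f_le u)). Qed.

Let intdf u : mu.-integrable `[0%R, +oo[ (EFin \o df u).
Proof. exact: (exp_dominated_integrable (@cdf u) (@df_le u)). Qed.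

Let Phi u := \int[mu]_(y in `[0%R, +oo[) f u y.

Let dfE u y : is_derive u (1 : R) (f^~ y) (df u y).
Proof.
by apply: is_derive_eq; rewrite /df /GRing.scale/=; ring.
Qed.

(** Integration by parts: [expR (- y ^+ 2) * sin (2 * u * y)] has derivative
    [df u y + 2 * u * f u y] and vanishes both at 0 and at infinity. *)
Let intT_df u : \int[mu]_(y in `[0%R, +oo[) df u y = - (2 * u * Phi u).
Proof.
pose F y := expR (- y ^+ 2) * sin (2 * u * y).
pose g y := df u y + 2 * u * f u y.
have dF (y : R) : is_derive y 1 F (g y).
  by apply: is_derive_eq; rewrite /g /f /df /GRing.scale/=; ring.
have F0 : F x @[x --> +oo%R] --> (0 : R).
  apply/cvgr0Pnorm_le => e e0.
  have : expR 1 * expR (- x) @[x --> +oo%R] --> (0 : R).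
    by rewrite -(mulr0 (expR 1)); apply: cvgM; [exact: cvg_cst|exact: cvg_expRN].
  move=> /cvgr0Pnorm_le /(_ _ e0) H; near=> x.
  have x0 : 0 <= x by near: x; exact: nbhs_pinfty_ge.
  apply: (@le_trans _ _ `|expR 1 * expR (- x)|); last by near: x.
  rewrite /F normrM (ger0_norm (expR_ge0 _)) [leRHS]ger0_norm ?mulr_ge0 ?expR_ge0//.
  apply: le_trans (expRN_sqr_le x0).
  by rewrite ler_piMr ?expR_ge0// sin_max.
have cg : continuous g.
  move=> y; apply: cvgD; first exact: cdf.
  by apply: cvgM; [exact: cvg_cst|exact: cf].
have gle y : 0 <= y -> `|g y| <= (2 * expR 1 + 2 * `|u| * expR 1) * expR (- y).
  move=> y0; rewrite mulrDl (le_trans (ler_normD _ _))// lerD ?df_le//.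
  by rewrite -[leRHS]mulrA normrM ler_pM// ?f_le// normrM ger0_norm.
have /eqP := exp_dominated_FTC2y cg gle dF F0.
rewrite /F mulr0 sin0 mulr0 subr0 /g RintegralD//; last first.
  exact: (integrableZl _ (2 * u) (@intf u)).
by rewrite RintegralZl// addr_eq0 => /eqP.
Unshelve. all: by end_near. Qed.

Let dPhi u : is_derive u (1 : R) Phi (- (2 * u * Phi u)).
Proof.
have Iu : `]u - 1, u + 1[%classic u.
  by rewrite /= in_itv/=; apply/andP; split; lra.
have d1E x y : (partial1of2 f x y) = df x y.
  by have ? := dfE x y; rewrite partial1of2E derive_val.
have G0 (y : R) : 0 <= 2 * expR 1 * expR (- y) by rewrite !mulr_ge0 ?expR_ge0.
have intG : mu.-integrable `[0%R, +oo[ (EFin \o fun y => 2 * expR 1 * expR (- y)).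
  apply: (@exp_dominated_integrable _ _ (2 * expR 1)).
    by move=> y; apply: cvgM; [exact: cvg_cst|exact: continuous_expRN].
  by move=> y y0; rewrite ger0_norm.
have db x y : `]u - 1, u + 1[%classic x -> `[0, +oo[%classic y ->
    `|partial1of2 f x y| <= 2 * expR 1 * expR (- y).
  by move=> _; rewrite /= in_itv/= andbT => y0; rewrite d1E df_le.
have derf x y : `]u - 1, u + 1[%classic x -> `[0, +oo[%classic y ->
  derivable (f^~ y) x 1 by move=> _ _; case: (dfE x y).
have intf' x : `]u - 1, u + 1[%classic x -> mu.-integrable `[0, +oo[ (EFin \o f x).
  by [].
have mI : measurable (`[0, +oo[%classic : set (measurableTypeR R)).
  exact: measurable_itv.
split; first exact: (derivable_under_integral mI Iu intf' derf G0 intG db).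
rewrite -derive1E (differentiation_under_integral mI Iu intf' derf G0 intG db).
by rewrite -intT_df; apply: eq_Rintegral => y _; rewrite d1E.
Qed.

(** Differentiation under the integral sign ([dPhi]) yields Phi' = -2 u Phi, so
    [Phi u * expR (u ^+ 2)] is constant; at [u = 0] it is the Gaussian integral. *)
Lemma integral0y_gauss_cos u :
  \int[mu]_(y in `[0%R, +oo[) (expR (- y ^+ 2) * cos (2 * u * y)) =
  Num.sqrt pi / 2 * expR (- u ^+ 2).
Proof.
have dE (v : R) : is_derive v 1 (fun v => Phi v * expR (v ^+ 2)) 0.
  have ? := dPhi v.
  by apply: is_derive_eq; rewrite /GRing.scale/=; ring.
have := is_derive_0_is_cst u 0 dE.
have -> : Phi 0 = Num.sqrt pi / 2.
  rewrite /Phi /Rintegral -[RHS]/(fine (Num.sqrt pi / 2)%:E) -integral0y_gauss.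
  by congr fine; apply: eq_integral => y _; rewrite /f mulr0 mul0r cos0 mulr1.
rewrite expr0n expR0 mulr1 => <-.
by rewrite -mulrA -expRD subrr expR0 mulr1.
Qed.

End gauss_fourier.

(** * Truncated Riemann sums on the half-line *)

Section riemann_sum.
Variable R : realType.
Local Notation mu := (@lebesgue_measure R).

Let cell (h : R) (k : nat) : set R := `[h * k%:R, h * k.+1%:R[.

(** Sampling at the right end of each cell puts the node beyond [x]; the decreasing bound
    [K * expR (- y)] then dominates every step function at [x] itself, for all meshes at once. *)
Let step (f : R -> R) (h : R) L (x : R) :=
  \sum_(k < L) f (h * k.+1%:R) * \1_(cell h k) x.

Let stepE f h L x : 0 < h -> 0 <= x -> step f h L x =
  if (Num.truncn (x / h) < L)%N then f (h * (Num.truncn (x / h)).+1%:R) else 0.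
Proof.
move=> h0 x0; have xh0 : 0 <= x / h by rewrite divr_ge0// ltW.
have cellE (k : nat) : (x \in cell h k) = (k == Num.truncn (x / h)).
  rewrite eq_sym truncn_eq// ler_pdivlMr// ltr_pdivrMr// !(mulrC _ h).
  apply/idP/idP => [/set_mem|xk]; first by rewrite /cell/= in_itv.
  by apply/mem_set; rewrite /cell/= in_itv.
case: ifPn => [aL|La].
  rewrite /step (bigD1 (Ordinal aL))//= indicE cellE eqxx mulr1 big1 ?addr0// => k kL.
  by rewrite indicE cellE (_ : (_ == _) = false) ?mulr0//; apply/negbTE.
apply: big1 => k _; rewrite indicE cellE.
case: eqP => [kE|_]; last by rewrite mulr0.
by move: La; rewrite -kE ltn_ord.
Qed.

Let mcell h k : measurable (cell h k : set (measurableTypeR R)).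
Proof. exact: measurable_itv. Qed.

Let int_step f h L : 0 < h ->
  (\int[mu]_(x in `[0%R, +oo[) (step f h L x)%:E)%E =
  (h * \sum_(k < L) f (h * k.+1%:R))%:E.
Proof.
move=> h0; have mI : measurable (`[0%R, +oo[%classic : set (measurableTypeR R)).
  exact: measurable_itv.
have muI k : mu (cell h k `&` `[0, +oo[) = h%:E.
  rewrite (_ : _ `&` _ = cell h k).
    rewrite lebesgue_measure_itv/= lte_fin ltr_pM2l// ltr_nat ltnSn.
    by rewrite -EFinD -mulrBr -natrB// subSnn mulr1.
  apply/seteqP; split=> [x []//|x xk]; split => //; move: xk.
  rewrite /cell /= !in_itv/= andbT => /andP[+ _]; apply: le_trans.
  by rewrite mulr_ge0// ltW.
under eq_integral do rewrite /step -sumEFin.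
rewrite integral_sum//=.
  rewrite mulr_sumr -sumEFin; apply: eq_bigr => k _.
  under eq_integral do rewrite EFinM.
  rewrite integralZl//; last first.
    exact: (integrableS measurableT) (integrable_indic_itv _ _ _ _).
  rewrite [X in (_ * X)%E](_ : _ = h%:E) ?EFinM 1?muleC//.
  by apply: etrans (muI k); apply: integral_indic => //; exact: mcell.
move=> k; apply: (integrableZl mI (f (h * k.+1%:R))
  (f := fun x => (\1_(cell h k) x)%:E)).
exact: (integrableS measurableT) (integrable_indic_itv _ _ _ _).
Qed.

(** Dominated convergence for [step]. The divergence of [h n * (L n)%:R] ensures that the truncation
    eventually passes any given [x]. *)
Lemma cvg_riemann_sum (f : R -> R) (K : R) (h : R^nat) (L : nat -> nat) :
  continuous f -> (forall y, 0 <= y -> `|f y| <= K * expR (- y)) ->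
  (forall n, 0 < h n) -> h n @[n --> \oo] --> (0 : R) ->
  h n * (L n)%:R @[n --> \oo] --> +oo%R ->
  h n * \sum_(k < L n) f (h n * k.+1%:R) @[n --> \oo] -->
    \int[mu]_(x in `[0%R, +oo[) f x.
Proof.
move=> cf fK h0 h_0 hL.
have mI : measurable (`[0%R, +oo[%classic : set (measurableTypeR R)).
  exact: measurable_itv.
have mstep n : measurable_fun (`[0%R, +oo[%classic : set (measurableTypeR R))
    (EFin \o step f (h n) (L n)).
  apply/measurable_EFinP/measurable_funTS; apply: measurable_sum => k.
  by apply: measurable_funM => //; exact: measurable_indic.
have K0 : 0 <= K.
  by have := le_trans (normr_ge0 _) (fK _ (lexx 0)); rewrite oppr0 expR0 mulr1.
have iK : mu.-integrable `[0%R, +oo[ (EFin \o (fun y => K * expR (- y))).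
  apply: (@exp_dominated_integrable _ _ K).
    by move=> x; apply: cvgM; [exact: cvg_cst|exact: continuous_expRN].
  by move=> y _; rewrite ger0_norm ?mulr_ge0 ?expR_ge0.
have next n (x : R) : 0 <= x ->
    x < h n * (Num.truncn (x / h n)).+1%:R <= x + h n.
  move=> x0; have xh0 : 0 <= x / h n by rewrite divr_ge0// ltW.
  have /andP[tx xt] := truncn_itv xh0.
  rewrite mulrC -ltr_pdivrMr// xt/= -natr1 mulrDl mul1r lerD2r.
  by rewrite -ler_pdivlMr.
have [||||_ _] := @dominated_convergence _ _ R mu _ mI
    (fun n => EFin \o step f (h n) (L n)) (EFin \o f)
    (EFin \o (fun y => K * expR (- y))) mstep.
- by apply/measurable_EFinP/measurable_funTS; apply: continuous_measurable_fun.
- apply: aeW => x /=; rewrite in_itv/= andbT => x0; apply: cvg_EFin; first exact: nearW.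
  have cx : h n * (Num.truncn (x / h n)).+1%:R @[n --> \oo] --> x.
    apply: (@squeeze_cvgr _ _ _ _ (cst x) (fun n => x + h n)).
    - by apply: nearW => n; have /andP[/ltW -> ->] := next n _ x0.
    - exact: cvg_cst.
    - by rewrite -[X in _ --> X]addr0; apply: cvgD => //; exact: cvg_cst.
  have : f (h n * (Num.truncn (x / h n)).+1%:R) @[n --> \oo] --> f x.
    exact: (cvg_comp _ _ cx (cf x)).
  apply: cvg_trans; apply: near_eq_cvg.
  have : \forall n \near \oo, x < h n * (L n)%:R by move/cvgryPgt : hL.
  apply: filterS => n xL /=.
  rewrite stepE// ifT// -(ltr_nat R); apply: le_lt_trans (_ : x / h n < _).
    by rewrite truncn_le divr_ge0// ltW.
  by rewrite ltr_pdivrMr// mulrC.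
- exact: iK.
- apply: aeW => x n /=; rewrite in_itv/= andbT => x0.
  rewrite lee_fin stepE//; case: ifPn => _; last first.
    by rewrite normr0 mulr_ge0 ?expR_ge0.
  have /andP[xt _] := next n _ x0.
  apply: (le_trans (fK _ _)); first by rewrite (le_trans x0) ?ltW.
  by rewrite ler_wpM2l// ler_expR lerN2 ltW.
rewrite -[X in _ --> X]fineK; last first.
  apply: integrable_fin_num => //.
  exact: (exp_dominated_integrable cf fK).
move=> /fine_cvg; apply: cvg_trans; apply: near_eq_cvg; apply: nearW => n /=.
by rewrite int_step.
Qed.

End riemann_sum.

(** * One-dimensional theta sums *)

Section theta.
Variable R : realType.
Implicit Types (y theta r t u w : R) (L M : nat).

(** The ordinals below 2L+1 stand for the integers from -L to L, so that boxes of Z^d are finite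
    types of functions and a product of sums distributes over them. *)
Definition centered L (j : 'I_L.*2.+1) : int := j%:Z - L%:Z.
Local Notation ctr j := ((centered j)%:~R : R).

Definition theta_sum L y theta :=
  \sum_(j < L.*2.+1) expR (- (ctr j ^+ 2 * y)) * cos (theta * ctr j).

Lemma centered_rev L (j : 'I_L.*2.+1) : centered (rev_ord j) = - centered j.
Proof.
case: j => j jL; rewrite /centered /= subSS -subzn//.
by rewrite -addnn PoszD opprB addrAC addrK.
Qed.

Lemma sum_centered L (g : R -> R) :
  \sum_(j < L.*2.+1) g (ctr j) =
  g 0 + \sum_(k < L) (g k.+1%:R + g (- k.+1%:R)).
Proof.
rewrite (eq_bigr (fun j : 'I_L.*2.+1 => g (j%:R - L%:R))); last first.
  by move=> j _; rewrite /centered intrB.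
elim: L => [|L IH]; first by rewrite big_ord1 big_ord0 addr0 subrr.
rewrite doubleS big_ord_recl big_ord_recr [in RHS]big_ord_recr/=.
rewrite (eq_bigr (fun j : 'I_L.*2.+1 => g (j%:R - L%:R))); last first.
  move=> j _; congr g; rewrite /bump/= add1n -natr1 -[L.+1%:R]natr1; ring.
have e : (bump 0 L.*2.+1)%:R - L.+1%:R = L.+1%:R :> R.
  by rewrite /bump/= add1n -doubleS -addnn natrD addrK.
by rewrite IH sub0r e; ring.
Qed.

(** The sines cancel under the reflection [rev_ord]. The complex form serves in dimension d, where
    exponentials, unlike cosines, multiply over the coordinates. *)
Lemma theta_sum_expi L y theta :
  \sum_(j < L.*2.+1) ((expR (- (ctr j ^+ 2 * y)))%:C)%C * expi (theta * ctr j) =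
  ((theta_sum L y theta)%:C)%C.
Proof.
have S0 : \sum_(j < L.*2.+1) expR (- (ctr j ^+ 2 * y)) * sin (theta * ctr j) = 0.
  set S := \sum_j _; suff : S = - S by lra.
  rewrite /S -sumrN [LHS](reindex_inj rev_ord_inj); apply: eq_bigr => j _.
  by rewrite centered_rev rmorphN sqrrN mulrN sinN mulrN.
rewrite /theta_sum.
transitivity (\sum_(j < L.*2.+1) ((expR (- (ctr j ^+ 2 * y)) * cos (theta * ctr j))
   +i* (expR (- (ctr j ^+ 2 * y)) * sin (theta * ctr j)))%C).
  apply: eq_bigr => j _; rewrite /expi; set a := expR _.
  by apply/eqP; rewrite eq_complex /= !mul0r subr0 addr0 !eqxx.
apply/eqP; rewrite eq_complex; apply/andP; split.
  by rewrite (raddf_sum (@complex.Re R)).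
by rewrite (raddf_sum (@complex.Im R))/= S0.
Qed.

Lemma theta_sumE L y theta : theta_sum L y theta =
  1 + 2 * \sum_(k < L) expR (- (k.+1%:R ^+ 2 * y)) * cos (theta * k.+1%:R).
Proof.
rewrite /theta_sum (sum_centered L (fun z => expR (- (z ^+ 2 * y)) * cos (theta * z))).
rewrite expr0n mul0r oppr0 expR0 mulr0 cos0 mulr1 mulr_sumr; congr (_ + _).
by apply: eq_bigr => k _; rewrite sqrrN mulrN cosN mulr2n mulrDl !mul1r.
Qed.

(** From (kr - 1)^2 >= 0 one gets exp(-k^2 r^2) <= e exp(-2r)^k, and the geometric series is at most
    1/(2r); the central term 1 is absorbed in 1/r since r <= 1. *)
Lemma theta_sum0_le L r : 0 < r -> r <= 1 ->
  theta_sum L (r ^+ 2) 0 <= (1 + expR 1) / r.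
Proof.
move=> r0 r1; rewrite theta_sumE.
have geo : (2 * r) * \sum_(k < L) expR (- (2 * r)) ^+ k.+1 <= 1.
  set q := expR _.
  have q0 : 0 <= q by exact: expR_ge0.
  suff H : (2 * r) * \sum_(k < L) q ^+ k.+1 <= 1 - q ^+ L.
    by apply: (le_trans H); rewrite gerBl exprn_ge0.
  elim: L => [|L IH]; first by rewrite big_ord0 mulr0 expr0 subrr.
  rewrite big_ord_recr/= mulrDr; apply: (le_trans (lerD IH (lexx _))).
  have : (1 + 2 * r) * q <= 1.
    rewrite /q expRN -ler_pdivlMr ?invr_gt0 ?expR_gt0// invrK mul1r.
    exact: expR_ge1Dx.
  rewrite exprS => /(ler_wpM2r (exprn_ge0 L q0)); lra.
have term k : expR (- (k.+1%:R ^+ 2 * r ^+ 2)) * cos (0 * k.+1%:R) <=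
    expR 1 * expR (- (2 * r)) ^+ k.+1.
  rewrite mul0r cos0 mulr1 -expRM_natl -expRD ler_expR.
  have := sqr_ge0 (k.+1%:R * r - 1); rewrite sqrrB1 exprMn mulrN -mulr_natl; lra.
have : \sum_(k < L) expR (- (k.+1%:R ^+ 2 * r ^+ 2)) * cos (0 * k.+1%:R) <=
    expR 1 * \sum_(k < L) expR (- (2 * r)) ^+ k.+1.
  by rewrite mulr_sumr; apply: ler_sum => k _; exact: term.
move: geo; set S := \sum_(k < L) _ ^+ _; set S' := \sum_(k < L) _ * _ => geo S'S.
rewrite ler_pdivlMr// mulrDl mul1r lerD// -mulrA mulrC -mulrA.
have : S' * r <= expR 1 * S * r by rewrite ler_wpM2r// ltW.
have := ler_wpM2l (expR_ge0 1) geo; lra.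
Qed.

(** Riemann sum of mesh sqrt(t)/M of a Gaussian times a cosine. [M n ^ 2 <= L n] makes the summation
    range, of order L/M, tend to infinity; the central term disappears through the factor 1/M. *)
Lemma cvg_theta_sum t w (M L : nat -> nat) : 0 < t ->
  (forall n, (n < M n)%N) -> (forall n, (M n ^ 2 <= L n)%N) ->
  (M n)%:R^-1 * theta_sum (L n) (t / (M n)%:R ^+ 2) (2 * pi * (w / (M n)%:R))
    @[n --> \oo] --> Num.sqrt (pi / t) * expR (- (pi ^+ 2 * w ^+ 2 / t)).
Proof.
move=> t0 nM ML.
have st0 : 0 < Num.sqrt t by rewrite sqrtr_gt0.
have M0 n : 0 < (M n)%:R :> R by rewrite ltr0n (leq_ltn_trans (leq0n n)).
pose h n := Num.sqrt t / (M n)%:R.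
have h0 n : 0 < h n by rewrite divr_gt0.
pose u := pi * w / Num.sqrt t.
pose f x := expR (- x ^+ 2) * cos (2 * u * x).
have Minv0 : (M n)%:R^-1 @[n --> \oo] --> (0 : R).
  apply: (@squeeze_cvgr _ _ _ _ (cst 0) (fun n => n.+1%:R^-1)).
  - by apply: nearW => n; rewrite invr_ge0 ler0n/= lef_pV2 ?posrE ?M0 ?ltr0Sn// ler_nat nM.
  - exact: cvg_cst.
  - exact: cvg_harmonic.
have h_0 : h n @[n --> \oo] --> (0 : R).
  by rewrite -(mulr0 (Num.sqrt t)); apply: cvgM => //; exact: cvg_cst.
have hL : h n * (L n)%:R @[n --> \oo] --> +oo%R.
  apply/cvgryPge => A; near=> n.
  apply: (@le_trans _ _ (Num.sqrt t * n%:R)).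
    rewrite mulrC -ler_pdivrMr//; near: n; exact: nbhs_infty_ger.
  rewrite /h -mulrA ler_pM2l// ler_pdivlMl//.
  apply: (@le_trans _ _ ((M n)%:R ^+ 2)); last by rewrite -natrX ler_nat.
  by rewrite expr2 ler_pM2l// ler_nat ltnW.
have cf : continuous f.
  by apply: (@is_derive_continuous _ _ (fun y => _)) => y; apply: is_derive_eq.
have fK y : 0 <= y -> `|f y| <= expR 1 * expR (- y).
  move=> y0; rewrite normrM ger0_norm ?expR_ge0//.
  apply: le_trans (expRN_sqr_le y0).
  by rewrite ler_piMr ?expR_ge0// cos_max.
have := cvg_riemann_sum cf fK h0 h_0 hL.
rewrite integral0y_gauss_cos => H.
have -> : Num.sqrt (pi / t) * expR (- (pi ^+ 2 * w ^+ 2 / t)) =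
    0 + 2 / Num.sqrt t * (Num.sqrt pi / 2 * expR (- u ^+ 2)) :> R.
  rewrite /u expr_div_n sqr_sqrtr ?ltW// exprMn sqrtrM ?pi_ge0// sqrtrV ?ltW//.
  by field; rewrite gt_eqF.
have H' : (M n)%:R^-1 + 2 / Num.sqrt t * (h n * \sum_(k < L n) f (h n * k.+1%:R))
    @[n --> \oo] --> 0 + 2 / Num.sqrt t * (Num.sqrt pi / 2 * expR (- u ^+ 2)).
  by apply: cvgD => //; apply: cvgM => //; exact: cvg_cst.
apply: cvg_trans H'; apply: near_eq_cvg; apply: nearW => n /=.
rewrite theta_sumE mulrDr mulr1; congr (_ + _).
rewrite !mulr_sumr; apply: eq_bigr => k _; rewrite /f.
have -> : 2 * u * (h n * k.+1%:R) = 2 * pi * (w / (M n)%:R) * k.+1%:R.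
  by rewrite /u /h; field; rewrite !gt_eqF.
have -> : (h n * k.+1%:R) ^+ 2 = k.+1%:R ^+ 2 * (t / (M n)%:R ^+ 2).
  by rewrite /h exprMn expr_div_n sqr_sqrtr ?ltW// mulrC.
by rewrite /h; field; rewrite !gt_eqF.
Unshelve. all: by end_near. Qed.

End theta.

(** * Gaussian sums over boxes of Z^d *)

Section box.
Variables (R : realType) (d : nat).
Local Notation box L := {ffun 'I_d -> 'I_L.*2.+1}.
Local Notation ctr j := ((centered j)%:~R : R).
Local Notation intv := (@intv R d).

Definition boxpt L (k : box L) : 'cV[int]_d := \col_i centered (k i).

Lemma boxpt_inj L : injective (@boxpt L).
Proof.
move=> k l /colP kl; apply/ffunP => i; have := kl i; rewrite !mxE /centered.
by move/addIr => [] /val_inj.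
Qed.

Lemma boxptP L (v : 'cV[int]_d) :
  reflect (exists k : box L, v = boxpt k) [forall i, (`|v i 0%R| <= L)%N].
Proof.
apply: (iffP forallP) => [vL|[k ->] i]; last first.
  by rewrite !mxE; case: (k i) => j; rewrite /centered /= -addnn; lia.
have H i : (`|(v i 0 + L%:Z)%R| < L.*2.+1)%N by have := vL i; rewrite -addnn; lia.
exists [ffun i => Ordinal (H i)]; apply/colP => i.
rewrite !mxE ffunE /centered /=; have := vL i; lia.
Qed.

Lemma box_exhaust (X : seq 'cV[int]_d) :
  exists L0, forall L, (L0 <= L)%N -> forall v, v \in X -> exists k : box L, v = boxpt k.
Proof.
exists (\max_(v <- X) \max_i `|v i 0%R|)%N => L L0 v vX.
apply/boxptP/forallP => i; apply: leq_trans L0.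
by apply: (bigmaxn_sup_seq v) => //; exact: (leq_bigmax (F := fun i => `|v i 0%R|)%N i).
Qed.

Lemma dotp_intv_ge1 (v : 'cV[int]_d) : v != 0 -> 1 <= dotp (intv v) (intv v).
Proof.
move=> v0; rewrite dotp_intv -[1]/(1%:~R) ler_int -gtz0_ge1.
rewrite -(ltr_int R) -dotp_intv lt_def dotp_ge0 andbT.
rewrite -enorm_sqr sqrf_eq0 enorm_eq0; apply: contra v0 => /eqP /colP v0.
apply/eqP/colP => i; have := v0 i; rewrite !mxE => /eqP; rewrite intr_eq0.
by move/eqP.
Qed.

Lemma sum_box_theta L y (theta : 'cV[R]_d) :
  \sum_(k : box L) expR (- (dotp (intv (boxpt k)) (intv (boxpt k)) * y)) *
    cos (dotp (intv (boxpt k)) theta) = \prod_i theta_sum L y (theta i 0).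
Proof.
have -> : \prod_i theta_sum L y (theta i 0) =
    complex.Re (\prod_i ((theta_sum L y (theta i 0))%:C)%C : R[i]).
  by rewrite -(rmorph_prod (real_complex R)).
under eq_bigr do rewrite -theta_sum_expi.
rewrite bigA_distr_bigA (raddf_sum (@complex.Re R)); apply: eq_bigr => k _.
rewrite big_split/= -(rmorph_prod (real_complex R)) -expi_sum.
have -> : \prod_i expR (- (ctr (k i) ^+ 2 * y)) =
    expR (- (dotp (intv (boxpt k)) (intv (boxpt k)) * y)).
  rewrite -expR_sum; congr expR; rewrite sumrN -mulr_suml; congr (- (_ * _)).
  by apply: eq_bigr => i _; rewrite !mxE -expr2.
have -> : \sum_i theta i 0 * ctr (k i) = dotp (intv (boxpt k)) theta.
  by apply: eq_bigr => i _; rewrite !mxE mulrC.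
by rewrite /expi /= mul0r subr0.
Qed.

(* The Riemann sum with mesh 1/M, truncated to |k_i| <= L, of the integral of
   exp(-|x|^2 t) (1 - cos(2 pi <x, w>)). *)
Definition gauss_box (M L : nat) (t : R) (w : 'cV[int]_d) : R :=
  (M%:R ^+ d)^-1 * \sum_(k : box L)
    expR (- (dotp (intv (boxpt k)) (intv (boxpt k)) * (t / M%:R ^+ 2))) *
    (1 - cos (2 * pi * (dotp (intv (boxpt k)) (intv w) / M%:R))).

Lemma gauss_box_ge0 M L t w : 0 <= gauss_box M L t w.
Proof.
rewrite mulr_ge0 ?invr_ge0 ?exprn_ge0//; apply: sumr_ge0 => k _.
by rewrite mulr_ge0 ?expR_ge0// subr_ge0 cos_le1.
Qed.

Lemma gauss_box_theta M L t w : gauss_box M L t w =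
  \prod_(i < d) (M%:R^-1 * theta_sum L (t / M%:R ^+ 2) (2 * pi * (0 / M%:R))) -
  \prod_(i < d) (M%:R^-1 *
    theta_sum L (t / M%:R ^+ 2) (2 * pi * ((w i 0)%:~R / M%:R))).
Proof.
rewrite !big_split/= !prodr_const card_ord exprVn -mulrBr; congr (_ * _).
pose e (k : box L) :=
  expR (- (dotp (intv (boxpt k)) (intv (boxpt k)) * (t / M%:R ^+ 2))).
rewrite (eq_bigr (fun k => e k - e k *
  cos (2 * pi * (dotp (intv (boxpt k)) (intv w) / M%:R)))); last first.
  by move=> k _; rewrite [LHS]mulrBr mulr1.
rewrite sumrB; congr (_ - _).
  pose th : 'cV[R]_d := 0.
  rewrite -[RHS](_ : \prod_i theta_sum L (t / M%:R ^+ 2) (th i 0) = _); last first.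
    rewrite -[in RHS](card_ord d) -prodr_const; apply: eq_bigr => i _.
    by rewrite mxE mul0r mulr0.
  rewrite -sum_box_theta; apply: eq_bigr => k _.
  rewrite /e [X in cos X](_ : _ = 0) ?cos0 ?mulr1//.
  by rewrite /dotp big1// => i _; rewrite [th _ _]mxE mulr0.
pose th : 'cV[R]_d := \col_i (2 * pi * ((w i 0)%:~R / M%:R)).
transitivity (\prod_i theta_sum L (t / M%:R ^+ 2) (th i 0)); last first.
  by apply: eq_bigr => i _; rewrite mxE.
rewrite -sum_box_theta; apply: eq_bigr => k _; congr (_ * cos _).
rewrite /dotp mulr_suml mulr_sumr; apply: eq_bigr => i _.
by rewrite !mxE; ring.
Qed.

Lemma cvg_gauss_box t w (M L : nat -> nat) : 0 < t ->
  (forall n, (n < M n)%N) -> (forall n, (M n ^ 2 <= L n)%N) ->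
  gauss_box (M n) (L n) t w @[n --> \oo] -->
    Num.sqrt (pi / t) ^+ d *
    (1 - expR (- (pi ^+ 2 * dotp (intv w) (intv w) / t))).
Proof.
move=> t0 nM ML.
under eq_fun do rewrite gauss_box_theta.
have -> : Num.sqrt (pi / t) ^+ d *
    (1 - expR (- (pi ^+ 2 * dotp (intv w) (intv w) / t))) =
  \prod_(i < d) (Num.sqrt (pi / t) * expR (- (pi ^+ 2 * 0 ^+ 2 / t))) -
  \prod_(i < d) (Num.sqrt (pi / t) *
    expR (- (pi ^+ 2 * (w i 0)%:~R ^+ 2 / t))).
  rewrite !big_split/= !prodr_const card_ord expr0n/= mulr0 mul0r oppr0 expR0.
  rewrite expr1n [LHS]mulrBr; congr (_ - _ * _).
  rewrite -expR_sum; congr expR; rewrite sumrN -mulr_suml -mulr_sumr.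
  by congr (- (_ * _ / _)); apply: eq_bigr => i _; rewrite !mxE -expr2.
by apply: cvgB; apply: (cvg_big (@mul_continuous R)) => i _; exact: cvg_theta_sum.
Qed.

Lemma sum_box_exp_le L (r : R) : 0 < r -> r <= 1 ->
  \sum_(k : box L) expR (- (dotp (intv (boxpt k)) (intv (boxpt k)) * r ^+ 2))
    <= ((1 + expR 1) / r) ^+ d.
Proof.
move=> r0 r1; have := sum_box_theta L (r ^+ 2) 0.
rewrite (eq_bigr (fun k : box L =>
    expR (- (dotp (intv (boxpt k)) (intv (boxpt k)) * r ^+ 2)))); last first.
  move=> k _; rewrite [X in cos X](_ : _ = 0) ?cos0 ?mulr1//.
  by rewrite /dotp big1// => i _; rewrite [X in _ * X]mxE mulr0.
move=> ->; rewrite -[in leRHS](card_ord d) -prodr_const.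
apply: ler_prod => i _; rewrite mxE theta_sum0_le// andbT.
rewrite /theta_sum sumr_ge0// => j _; rewrite mul0r cos0 mulr1.
exact: expR_ge0.
Qed.

(** exp(r^2/d) >= r^2/d >= r/d, raised to the power d. *)
Let expRN_sqr_pow_le (r : R) : (0 < d)%N -> 1 <= r -> expR (- r ^+ 2) <= d%:R ^+ d / r ^+ d.
Proof.
move=> d0 r1; have r0 : 0 < r by lra.
have dR : 0 < d%:R :> R by rewrite ltr0n.
rewrite -expr_div_n expRN -[leRHS]invrK lef_pV2 ?posrE ?expR_gt0//; last first.
  by rewrite invr_gt0 exprn_gt0// divr_gt0.
have -> : r ^+ 2 = d%:R * (r ^+ 2 / d%:R) by field; rewrite gt_eqF.
rewrite expRM_natl -exprVn invf_div; apply: lerXn2r.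
- by rewrite nnegrE divr_ge0// ltW.
- by rewrite nnegrE expR_ge0.
apply: (@le_trans _ _ (r ^+ 2 / d%:R)).
  by rewrite ler_pM2r ?invr_gt0// expr2 ler_peMl// ltW.
have := expR_ge1Dx (r ^+ 2 / d%:R); lra.
Qed.

(** The factor 2 bounds 1 - cos, [(1 + expR 1) ^+ d] comes from the theta sums, and
    [expR 1 * d%:R ^+ d] from the range where the mesh sqrt(t)/M exceeds 1. *)
Definition gauss_box_cst : R := 2 * (1 + expR 1) ^+ d * (expR 1 * d%:R ^+ d).

(** The term k = 0 is killed by 1 - cos. Were it present, it would contribute M^(-d) for every t,
    which is not integrable against t^(s/2-1) at infinity. The other terms are bounded by the theta
    sums if the mesh [r] is at most 1, and by the decay of exp(-r^2) beyond. *)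
Lemma gauss_box_le M L t w : (0 < d)%N -> (0 < M)%N -> 0 < t ->
  gauss_box M L t w <= gauss_box_cst / Num.sqrt t ^+ d.
Proof.
move=> d0 M0 t0.
have MR : 0 < M%:R :> R by rewrite ltr0n.
have st0 : 0 < Num.sqrt t by rewrite sqrtr_gt0.
pose r := Num.sqrt t / M%:R; have r0 : 0 < r by rewrite divr_gt0.
have c0 : 0 < 1 + expR 1 :> R by rewrite addr_gt0 ?expR_gt0.
have yE : t / M%:R ^+ 2 = r ^+ 2 by rewrite /r expr_div_n sqr_sqrtr// ltW.
pose q (k : box L) := dotp (intv (boxpt k)) (intv (boxpt k)).
pose S := \sum_(k : box L | boxpt k != 0) expR (- (q k * r ^+ 2)).
have ed1 : 1 <= expR 1 * d%:R ^+ d :> R.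
  have e1 : 1 <= expR 1 :> R by rewrite -[leLHS]expR0 ler_expR.
  by rewrite mulr_ege1// exprn_ege1// ler1n.
have boxS : gauss_box M L t w <= (M%:R ^+ d)^-1 * (2 * S).
  rewrite /gauss_box ler_pM2l ?invr_gt0 ?exprn_gt0// yE.
  rewrite (bigID (fun k => boxpt k != 0))/= [X in _ + X]big1 ?addr0; last first.
    move=> k; rewrite negbK => /eqP ->; rewrite [X in cos X](_ : _ = 0).
      by rewrite cos0 subrr mulr0.
    rewrite /dotp big1 ?mul0r ?mulr0// => i _.
    by rewrite !mxE mul0r.
  rewrite mulr_sumr; apply: ler_sum => k _.
  rewrite mulrC ler_wpM2r ?expR_ge0//.
  have := cos_geN1 (2 * pi * (dotp (intv (boxpt k)) (intv w) / M%:R)); lra.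
have S_le : S <= (1 + expR 1) ^+ d * (expR 1 * d%:R ^+ d) / r ^+ d.
  have [r1|/ltW r1] := leP r 1.
    apply: (@le_trans _ _ (((1 + expR 1) / r) ^+ d)).
      apply: le_trans (sum_box_exp_le L r0 r1).
      rewrite /S big_mkcond; apply: ler_sum => k _.
      by case: ifP => // _; exact: expR_ge0.
    rewrite expr_div_n ler_pM2r ?invr_gt0 ?exprn_gt0//.
    by rewrite ler_peMr// exprn_ge0// ltW.
  (* For q >= 1 and r >= 1, (q - 1)(r^2 - 1) >= 0 gives exp(-q r^2) <= exp(1 - r^2) exp(-q), which
     reduces the sum to the mesh 1. *)
  apply: (@le_trans _ _ (expR (1 - r ^+ 2) * ((1 + expR 1) / 1) ^+ d)).
    have H := sum_box_exp_le L ltr01 (lexx 1).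
    apply: le_trans (ler_wpM2l (expR_ge0 _) H).
    rewrite mulr_sumr /S big_mkcond; apply: ler_sum => k _.
    case: ifPn => [k0|_]; last by rewrite mulr_ge0 ?expR_ge0.
    rewrite -expRD ler_expR expr1n mulr1.
    have q1 : 1 <= q k by exact: dotp_intv_ge1.
    have r21 : 0 <= r ^+ 2 - 1 by rewrite subr_ge0 exprn_ege1.
    by have := ler_wpM2r r21 q1; rewrite /q; lra.
  rewrite divr1 mulrC -[leRHS]mulrA ler_pM2l ?exprn_gt0//.
  by rewrite expRD -[leRHS]mulrA ler_pM2l ?expR_gt0// expRN_sqr_pow_le.
apply: (le_trans boxS).
apply: (@le_trans _ _ ((M%:R ^+ d)^-1 *
    (2 * ((1 + expR 1) ^+ d * (expR 1 * d%:R ^+ d) / r ^+ d)))).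
  by rewrite ler_pM2l ?invr_gt0 ?exprn_gt0// ler_pM2l.
rewrite /gauss_box_cst /r expr_div_n le_eqVlt; apply/orP; left; apply/eqP.
by field; rewrite !expf_neq0 ?gt_eqF.
Qed.

End box.

(** * Incomplete Gamma integrals *)

Section gamma_integral.
Variable R : realType.
Local Notation mu := (@lebesgue_measure R).
Implicit Types a c t x : R.

Lemma is_derive_continuous_at (f : R -> R) x (df : R) :
  is_derive x 1 f df -> {for x, continuous f}.
Proof. by case=> ? _; apply/differentiable_continuous/derivable1_diffP. Qed.

Lemma cvg_powRN a : 0 < a -> t `^ (- a) @[t --> +oo%R] --> (0 : R).
Proof.
move=> a0; apply/cvgr0Pnorm_le => e e0; near=> t.
have t0 : 0 < t by near: t; exact: nbhs_pinfty_gt.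
rewrite ger0_norm ?powR_ge0// powRN -[e]invrK lef_pV2 ?posrE ?invr_gt0 ?powR_gt0//.
have -> : e^-1 = (e^-1 `^ a^-1) `^ a.
  by rewrite -powRrM mulVf ?gt_eqF// powRr1// invr_ge0 ltW.
apply: ge0_ler_powR; rewrite ?nnegrE ?powR_ge0 ?(ltW a0) ?(ltW t0)//.
Unshelve. all: by end_near. Qed.

Lemma integral_powR a : 0 < a ->
  (\int[mu]_(t in `[1%R, +oo[) (t `^ (- a - 1))%:E = (a^-1)%:E)%E.
Proof.
move=> a0.
have dF (t : R) : 1 <= t ->
    is_derive t 1 (fun t => - (a^-1 * t `^ (- a))) (t `^ (- a - 1)).
  move=> t1; have t0 : 0 < t by lra.
  have ? := is_derive1_powR (- a) t0.
  by apply: is_derive_eq; rewrite /GRing.scale/=; field; rewrite gt_eqF.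
rewrite (@ge0_continuous_FTC2y _ _ (fun t => - (a^-1 * t `^ (- a))) _ 0).
- by rewrite powR1 mulr1 -EFinB opprK add0r.
- by move=> x _; exact: powR_ge0.
- apply: derivable_within_continuous => x; rewrite in_itv/= andbT => x1.
  have x0 : 0 < x by lra.
  by have [] := is_derive1_powR (- a - 1) x0.
- rewrite -oppr0; apply: cvgN; rewrite -(mulr0 a^-1); apply: cvgM.
    exact: cvg_cst.
  exact: cvg_powRN.
- by move=> x x1; have [] := dF x (ltW x1).
- by apply: cvg_at_right_filter; exact: is_derive_continuous_at (dF _ (lexx 1)).
- move=> x; rewrite in_itv/= andbT => x1.
  by have ? := dF x (ltW x1); rewrite derive1E derive_val.
Qed.

(* 1 / t is written t `^ (- 1) because powR is known to be measurable. *)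
Definition inv_gamma_fun a c t := t `^ (- a - 1) * expR (- (c * t `^ (- 1))).

Lemma inv_gamma_fun_ge0 a c t : 0 <= inv_gamma_fun a c t.
Proof. by rewrite mulr_ge0 ?powR_ge0 ?expR_ge0. Qed.

Lemma measurable_inv_gamma_fun a c : measurable_fun setT (inv_gamma_fun a c).
Proof.
apply: measurable_funM; first exact: measurable_powR.
apply: measurableT_comp => //; apply: measurableT_comp => //.
by apply: measurable_funM => //; exact: measurable_powR.
Qed.

Lemma inv_gamma_funE a c t : 0 <= t ->
  inv_gamma_fun a c t = t `^ (- a - 1) * expR (- (c / t)).
Proof. by move=> t0; rewrite /inv_gamma_fun powR_inv1. Qed.

Definition gamma_fun a x := x `^ (a - 1) * expR (- x).

Lemma measurable_gamma_fun a : measurable_fun setT (gamma_fun a).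
Proof.
apply: measurable_funM; first exact: measurable_powR.
by apply: measurableT_comp => //; apply: measurableT_comp.
Qed.

Lemma gamma_fun_ge0 a x : 0 <= gamma_fun a x.
Proof. by rewrite mulr_ge0 ?powR_ge0 ?expR_ge0. Qed.

(** The intervals are adapted to the substitution t = c/x, which maps [1/n, n] onto [c/n, cn]: it is
    done on these compact intervals, away from 0, and followed by a passage to the limit. *)
Let pos_exhaust c : 0 < c ->
  \bigcup_n (`[c / n.+1%:R, c * n.+1%:R]%classic : set R) = `]0, +oo[%classic.
Proof.
move=> c0; apply/seteqP; split => [x [n _]|x] /=; rewrite !in_itv/= ?andbT.
  by move=> /andP[+ _]; apply: lt_le_trans; rewrite divr_gt0.
move=> x0; exists (maxn (Num.truncn (x / c)) (Num.truncn (c / x))) => //=.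
have lt_max (y : R) m n : 0 <= y -> (Num.truncn y <= maxn m n)%N ->
    y <= (maxn m n).+1%:R.
  move=> y0 yx; have /andP[_ /ltW] := truncn_itv y0.
  by move/le_trans; apply; rewrite ler_nat ltnS.
rewrite in_itv/=; apply/andP; split.
  rewrite ler_pdivrMr// mulrC -ler_pdivrMr//.
  by apply: lt_max; rewrite ?divr_ge0 ?leq_maxr// ltW.
rewrite mulrC -ler_pdivrMr//.
by apply: lt_max; rewrite ?divr_ge0 ?leq_maxl// ltW.
Qed.

Let cvg_exhaust c (f : R -> R) : 0 < c -> measurable_fun setT f ->
  (forall x, 0 <= f x) ->
  (\int[mu]_(x in `[(c / n.+1%:R)%R, (c * n.+1%:R)%R]) (f x)%:E)%E @[n --> \oo] -->
  (\int[mu]_(x in `]0%R, +oo[) (f x)%:E)%E.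
Proof.
move=> c0 mf f0; rewrite -(pos_exhaust c0).
apply: (@ge0_nondecreasing_set_cvg_integral _ (measurableTypeR R) R
  (fun n => `[(c / n.+1%:R)%R, (c * n.+1%:R)%R]%classic) (EFin \o f) mu).
- apply/nondecreasing_seqP => n; apply/subsetPset => x /=; rewrite !in_itv/=.
  move=> /andP[H1 H2]; apply/andP; split.
    by apply: le_trans H1; rewrite ler_pM2l// lef_pV2 ?posrE ?ltr0n// ler_nat.
  by apply: (le_trans H2); rewrite ler_pM2l// ler_nat.
- by move=> i; exact: measurable_itv.
- by move=> i; apply/measurable_EFinP/measurable_funTS.
- by move=> i x _; rewrite lee_fin.
Qed.

Let subst_exhaust a c n : 0 < c ->
  (\int[mu]_(t in `[(c / n.+1%:R)%R, (c * n.+1%:R)%R]) (inv_gamma_fun a c t)%:E =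
   (c `^ (- a))%:E *
   \int[mu]_(x in `[(1 / n.+1%:R)%R, (1 * n.+1%:R)%R]) (gamma_fun a x)%:E)%E.
Proof.
move=> c0; set u := 1 / _; set v := 1 * _.
have u0 : 0 < u by rewrite divr_gt0.
have v0 : 0 < v by rewrite mulr_gt0.
have uv : u <= v.
  apply: (@le_trans _ _ 1); last by rewrite /v mul1r ler1n.
  by rewrite /u ler_pdivrMr ?ltr0n// mul1r ler1n.
have Fv : c / v = c / n.+1%:R by rewrite /v mul1r.
have Fu : c / u = c * n.+1%:R by rewrite /u invf_div divr1.
have dF (x : R) : 0 < x -> is_derive x 1 (fun x => c / x) (- (c * x ^- 2)).
  move=> x0; have x0' : x != 0 by rewrite gt_eqF.
  have ? := @is_deriveV R id x 1 1 x0' _.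
  by apply: is_derive_eq; rewrite /GRing.scale/=; ring.
have F'E (x : R) : 0 < x -> (fun x => c / x)^`()%classic x = - (c * x ^- 2).
  by move=> x0; have ? := dF x x0; rewrite derive1E derive_val.
have cF' (x : R) : 0 < x -> {for x, continuous (fun x => c / x)^`()%classic}.
  move=> x0.
  have H : - (c * y ^- 2) @[y --> x] --> - (c * x ^- 2).
    apply: cvgN; apply: cvgM; first exact: cvg_cst.
    by apply: cvgV; [rewrite expf_neq0// gt_eqF|exact: exprn_continuous].
  rewrite /prop_for /continuous_at F'E//; apply: cvg_trans H.
  apply: near_eq_cvg; near=> y; rewrite F'E//.
  by near: y; exact: lt_nbhsr.
rewrite -Fv -Fu (@integration_by_substitution_decreasing _ (fun x => c / x)) //.
- rewrite -ge0_integralZl//=.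
  + apply: eq_integral => x; rewrite inE/= in_itv/= => /andP[ux _].
    have x0 : 0 < x by exact: lt_le_trans ux.
    congr EFin; rewrite [LHS]/= !fctE /= F'E// opprK.
    rewrite inv_gamma_funE ?divr_ge0 ?ltW//.
    have -> : c / (c / x) = x by rewrite invf_div mulrCA mulfV ?mulr1// gt_eqF.
    rewrite powRM ?invr_ge0 ?ltW// /gamma_fun -powR_inv1 ?(ltW x0)// -powRrM.
    have -> : - a - 1 = - (a + 1) by ring.
    rewrite mulN1r opprK powRN.
    have -> : x ^- 2 = x `^ (- 2) by rewrite powR_invn// ltW.
    have cE : c = c `^ 1 by rewrite powRr1// ltW.
    rewrite {2}cE -powRN !mulrA.
    have -> : c `^ (- (a + 1)) * x `^ (a + 1) * expR (- x) * c `^ 1 * x `^ (- 2) =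
      (c `^ (- (a + 1)) * c `^ 1) * (x `^ (a + 1) * x `^ (- 2)) * expR (- x) by ring.
    rewrite -!powRD ?(gt_eqF c0) ?(gt_eqF x0) ?implybT//.
    by congr (_ `^ _ * _ `^ _ * _); ring.
  + by apply/measurable_EFinP/measurable_funTS; exact: measurable_gamma_fun.
  + by move=> x _; rewrite lee_fin gamma_fun_ge0.
  + by rewrite lee_fin powR_ge0.
- move=> x y; rewrite !in_itv/= => /andP[ux _] /andP[uy _] xy.
  rewrite ltr_pM2l// ltf_pV2 ?posrE//; exact: lt_le_trans u0 _.
- move=> x; rewrite in_itv/= => /andP[ux _].
  by apply: cF'; exact: lt_trans ux.
- by apply/cvg_ex; eexists; apply: cvg_at_right_filter; exact: cF'.
- by apply/cvg_ex; eexists; apply: cvg_at_left_filter; exact: cF'.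
- split.
  + move=> x; rewrite in_itv/= => /andP[ux _].
    by case: (dF x (lt_trans u0 ux)).
  + by apply: cvg_at_right_filter; exact: is_derive_continuous_at (dF _ u0).
  + by apply: cvg_at_left_filter; exact: is_derive_continuous_at (dF _ v0).
- apply: derivable_within_continuous => x; rewrite in_itv/= => /andP[vx _].
  have x0 : 0 < x by apply: lt_le_trans vx; rewrite divr_gt0.
  have ? := is_derive1_powR (- a - 1) x0; have ? := is_derive1_powR (- 1) x0.
  by apply: ex_derive.
Unshelve. all: by end_near. Qed.

Lemma integral_inv_gamma_fun a c : 0 < c ->
  (\int[mu]_(t in `]0%R, +oo[) (inv_gamma_fun a c t)%:E =
   (c `^ (- a))%:E * \int[mu]_(x in `]0%R, +oo[) (gamma_fun a x)%:E)%E.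
Proof.
move=> c0.
have H1 := cvg_exhaust c0 (measurable_inv_gamma_fun a c) (inv_gamma_fun_ge0 a c).
have H2 := cvg_exhaust ltr01 (measurable_gamma_fun a) (gamma_fun_ge0 a).
have H3 : ((c `^ (- a))%:E *
    \int[mu]_(x in `[(1 / n.+1%:R)%R, (1 * n.+1%:R)%R]) (gamma_fun a x)%:E)%E
    @[n --> \oo] -->
    ((c `^ (- a))%:E * \int[mu]_(x in `]0%R, +oo[) (gamma_fun a x)%:E)%E.
  exact: cvgeZl.
apply: (cvg_unique (@ereal_hausdorff R) H1).
apply: cvg_trans H3; apply: near_eq_cvg; apply: nearW => n.
by rewrite -subst_exhaust.
Qed.

(** For 0 < t <= 1, (c - c')/t >= c/(2t) >= c/2. This gives the exponential decay in c that makes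
    the dual sum converge. *)
Lemma inv_gamma_fun_le a c c' t : 0 < a -> 0 < c' -> 0 <= t <= 1 -> 2 * c' <= c ->
  inv_gamma_fun a c t <= expR (- (c / 2)) * inv_gamma_fun a c' t.
Proof.
move=> a0 c0 /andP[]; rewrite le_eqVlt => /predU1P[<- _ _|t0 t1 cc].
  by rewrite /inv_gamma_fun powR0 ?mul0r ?mulr0//; rewrite lt_eqF//; lra.
rewrite /inv_gamma_fun mulrCA ler_wpM2l ?powR_ge0// -expRD ler_expR.
have z1 : 1 <= t `^ (- 1) by rewrite (powR_inv1 (ltW t0)) invf_ge1.
have : (2 * c') * t `^ (- 1) <= c * t `^ (- 1) by rewrite ler_wpM2r// powR_ge0.
have : c * 1 <= c * t `^ (- 1) by rewrite ler_wpM2l//; lra.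
lra.
Qed.

Lemma integral_inv_gamma_fun01_fin a c : 0 < a -> 0 < c ->
  (\int[mu]_(t in `[0%R, 1%R]) (inv_gamma_fun a c t)%:E)%E \is a fin_num.
Proof.
move=> a0 c0; pose n := (Num.truncn (a + 1)).+1.
have an : a + 1 <= n%:R.
  by have /andP[_ /ltW] := truncn_itv (ltW (addr_gt0 a0 ltr01)).
pose B := (n%:R / c) ^+ n.
have le_B t : 0 <= t <= 1 -> inv_gamma_fun a c t <= B.
  move=> /andP[]; rewrite le_eqVlt => /predU1P[<- _|t0 t1].
    rewrite /inv_gamma_fun powR0 ?mul0r; last by rewrite lt_eqF//; lra.
    by rewrite exprn_ge0// divr_ge0// ltW.
  rewrite (inv_gamma_funE _ _ (ltW t0)).
  (* exp(c/t) = exp(c/(tn))^n >= (c/(tn))^n; the power t^n with n >= a + 1 then compensates t^(-a-1)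
     on [0, 1]. *)
  have E : expR (- (c / t)) <= B * t ^+ n.
    rewrite /B -exprMn expRN -[leRHS]invrK lef_pV2 ?posrE ?expR_gt0//; last first.
      by rewrite invr_gt0 exprn_gt0// mulr_gt0// divr_gt0.
    have -> : c / t = n%:R * (c / t / n%:R) by field; rewrite (gt_eqF t0) pnatr_eq0.
    rewrite expRM_natl -exprVn; apply: lerXn2r; rewrite ?nnegrE ?expR_ge0//.
      by rewrite invr_ge0 mulr_ge0 ?ltW// divr_gt0.
    have -> : (n%:R / c * t)^-1 = c / t / n%:R.
      by field; rewrite (gt_eqF t0) (gt_eqF c0) pnatr_eq0.
    by have := expR_ge1Dx (c / t / n%:R); lra.
  apply: (le_trans (ler_wpM2l (powR_ge0 _ _) E)).
  rewrite mulrCA ger_pMr; last by rewrite exprn_gt0// divr_gt0.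
  rewrite -powR_mulrn ?(ltW t0)// -powRD ?(gt_eqF t0) ?implybT//.
  rewrite -[leRHS](powRr0 t); apply: ger_powR; first by rewrite t0.
  lra.
rewrite ge0_fin_numE; last by apply: integral_ge0 => t _; rewrite lee_fin inv_gamma_fun_ge0.
apply: (@le_lt_trans _ _ (\int[mu]_(t in `[0%R, 1%R]) (cst B%:E) t)%E).
  apply: ge0_le_integral => //=.
  - by move=> t _; rewrite lee_fin inv_gamma_fun_ge0.
  - by apply/measurable_EFinP/measurable_funTS; exact: measurable_inv_gamma_fun.
rewrite integral_cst//.
by rewrite [X in (_ * X)%E](lebesgue_measure_itv `[0%R, 1%R])/= lte01 oppr0 adde0 mule1 ltry.
Qed.

Lemma integral_inv_gamma_fun1y_le a c : 0 < a -> 0 < c ->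
  (\int[mu]_(t in `[1%R, +oo[) (inv_gamma_fun a c t)%:E <= (a^-1)%:E)%E.
Proof.
move=> a0 c0; rewrite -integral_powR//; apply: ge0_le_integral => //=.
- by move=> t _; rewrite lee_fin inv_gamma_fun_ge0.
- by apply/measurable_EFinP/measurable_funTS; exact: measurable_inv_gamma_fun.
- by apply/measurable_EFinP/measurable_funTS; exact: measurable_powR.
- move=> t _; rewrite lee_fin ler_piMr ?powR_ge0// -expR0 ler_expR oppr_le0.
  by rewrite mulr_ge0 ?powR_ge0 ?ltW.
Qed.

Definition inv_gamma01 a c := \int[mu]_(t in `[0%R, 1%R]) inv_gamma_fun a c t.
Definition inv_gamma1y a c := \int[mu]_(t in `[1%R, +oo[) inv_gamma_fun a c t.

Lemma inv_gamma01_ge0 a c : 0 <= inv_gamma01 a c.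
Proof. by apply: Rintegral_ge0 => t _; exact: inv_gamma_fun_ge0. Qed.

Lemma integral_inv_gamma_fun1y_fin a c : 0 < a -> 0 < c ->
  (\int[mu]_(t in `[1%R, +oo[) (inv_gamma_fun a c t)%:E)%E \is a fin_num.
Proof.
move=> a0 c0; rewrite ge0_fin_numE.
  by apply: le_lt_trans (integral_inv_gamma_fun1y_le a0 c0) _; rewrite ltry.
by apply: integral_ge0 => t _; rewrite lee_fin inv_gamma_fun_ge0.
Qed.

Lemma inv_gammaD a c : 0 < a -> 0 < c ->
  inv_gamma01 a c + inv_gamma1y a c = c `^ (- a) * Gamma a.
Proof.
move=> a0 c0.
have f01 := integral_inv_gamma_fun01_fin a0 c0.
have f1y := integral_inv_gamma_fun1y_fin a0 c0.
have mf : measurable_fun setT (EFin \o inv_gamma_fun a c).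
  by apply/measurable_EFinP; exact: measurable_inv_gamma_fun.
have E : (\int[mu]_(t in `]0%R, +oo[) (inv_gamma_fun a c t)%:E =
   (inv_gamma01 a c + inv_gamma1y a c)%:E)%E.
  rewrite EFinD /inv_gamma01 /inv_gamma1y /Rintegral !fineK//.
  rewrite -(integral_itv_obnd_cbnd (r := 0)); last exact: measurable_funTS.
  rewrite -(integral_itv_obnd_cbnd (r := 1)); last exact: measurable_funTS.
  rewrite -ge0_integral_setU//=.
  - congr (integral _ _ _); apply/seteqP; split=> t /=; rewrite !in_itv/= ?andbT.
      by move=> t0; case: (leP t 1) => t1; [left; rewrite t0|right].
    by move=> [/andP[]//|]; exact: lt_trans ltr01.
  - exact: measurable_funTS.
  - by move=> t _; rewrite lee_fin inv_gamma_fun_ge0.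
  - rewrite disj_set2E; apply/eqP/seteqP; split => t //=; rewrite !in_itv/= andbT.
    by move=> [/andP[_ t1] t1']; have := lt_le_trans t1' t1; rewrite ltxx.
have := integral_inv_gamma_fun a c0; rewrite E.
rewrite -[Gamma a]/(fine (\int[mu]_(x in `]0%R, +oo[) (gamma_fun a x)%:E)%E).
have ca0 : (0 < (c `^ (- a))%:E)%E by rewrite lte_fin powR_gt0.
case: (\int[mu]_(x in `]0%R, +oo[) (gamma_fun a x)%:E)%E => [r|/=|/=].
- by rewrite -EFinM => -[].
- by rewrite gt0_muley.
- by rewrite gt0_muleNy.
Qed.

Lemma inv_gamma01_le a c c' : 0 < a -> 0 < c' -> 2 * c' <= c ->
  inv_gamma01 a c <= expR (- (c / 2)) * inv_gamma01 a c'.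
Proof.
move=> a0 c0 cc.
have mI : measurable (`[0%R, 1%R]%classic : set (measurableTypeR R)).
  exact: measurable_itv.
have int b : 0 < b -> mu.-integrable `[0%R, 1%R] (EFin \o inv_gamma_fun a b).
  move=> b0; apply/integrableP; split.
    by apply/measurable_EFinP/measurable_funTS; exact: measurable_inv_gamma_fun.
  under eq_integral do rewrite /= ger0_norm ?inv_gamma_fun_ge0//.
  have := integral_inv_gamma_fun01_fin a0 b0.
  by rewrite ge0_fin_numE// integral_ge0// => t _; rewrite lee_fin inv_gamma_fun_ge0.
have c0' : 0 < c by lra.
rewrite -RintegralZl//; last exact: int.
apply: le_Rintegral => //; [exact: int| |].
  exact: (integrableZl _ (expR (- (c / 2))) (int _ c0)).
by move=> t; rewrite /= in_itv/= => t01; exact: inv_gamma_fun_le.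
Qed.

End gamma_integral.

(** * Grid averages of the periodic Riesz kernel of Z^d *)

Section esum_extra.
Variables (R : realType) (T : choiceType).
Implicit Types (f : T -> \bar R) (D : set T).

Lemma le_mule_esum (c : R) f D : 0 <= c -> (forall x, (0 <= f x)%E) ->
  (c%:E * (\esum_(x in D) f x) <= \esum_(x in D) (c%:E * f x))%E.
Proof.
rewrite le_eqVlt => /predU1P[<- f0|c0 f0].
  by rewrite mul0e; apply: esum_ge0 => x _; rewrite mul0e.
rewrite -lee_pdivlMl//; apply: ge_ereal_sup => _ [X [fX XD] <-].
rewrite lee_pdivlMl// ge0_mule_fsumr//; apply: esum_ge; exists X => //.
Qed.

End esum_extra.

Lemma measurable_gauss_box (R : realType) d M L (w : 'cV[int]_d) :
  measurable_fun setT (fun t : R => gauss_box M L t w).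
Proof.
apply: measurable_funM => //; apply: measurable_sum => k.
apply: measurable_funM => //; apply: measurableT_comp => //.
apply: measurableT_comp => //; apply: measurable_funM => //.
exact: measurable_funM.
Qed.

(** * Limit of the Gaussian part, t >= 1 *)

Section large_t.
Variables (R : realType) (d : nat) (s : R).
Hypotheses (d0 : (0 < d)%N) (s0 : 0 < s) (sd : s < d%:R).
Local Notation mu := (@lebesgue_measure R).
Local Notation intv := (@intv R d).
Let a : R := (d%:R - s) / 2.
Let a0 : 0 < a. Proof. by rewrite divr_gt0 ?subr_gt0. Qed.

Definition qform (w : 'cV[int]_d) : R := dotp (intv w) (intv w).

Let sqrt_powR (t : R) : 0 < t -> Num.sqrt t ^+ d = t `^ (d%:R / 2).
Proof.
move=> t0; rewrite -powR12_sqrt ?ltW// -powR_mulrn ?powR_ge0// -powRrM.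
by congr (_ `^ _); ring.
Qed.

Let weight_powR (t : R) : 0 < t -> (Num.sqrt t ^+ d)^-1 * t `^ (s / 2 - 1) = t `^ (- a - 1).
Proof.
move=> t0; rewrite sqrt_powR// -powRN -powRD; last by rewrite (gt_eqF t0) implybT.
by congr (_ `^ _); rewrite /a; field.
Qed.

(* The integral over t >= 1 of t^(s/2-1) times the limit of gauss_box. *)
Definition large_t_val (w : 'cV[int]_d) : R :=
  pi `^ (d%:R / 2) * (a^-1 - inv_gamma1y a (pi ^+ 2 * qform w)).

Let f_ (M L : nat) (w : 'cV[int]_d) (t : R) := gauss_box M L t w * t `^ (s / 2 - 1).

Let mf_ M L w : measurable_fun setT (f_ M L w).
Proof.
by apply: measurable_funM; [exact: measurable_gauss_box|exact: measurable_powR].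
Qed.

Let qform_gt0 w : w != 0 -> 0 < pi ^+ 2 * qform w.
Proof.
move=> w0; rewrite mulr_gt0 ?exprn_gt0 ?pi_gt0//.
by apply: lt_le_trans (dotp_intv_ge1 R w0).
Qed.

(** Dominated convergence: by [gauss_box_le] the majorant is a multiple of t^(-a-1), integrable on
    [1, +oo) because a > 0, that is, s < d. *)
Let cvg_int w (M L : nat -> nat) : w != 0 ->
  (forall n, (n < M n)%N) -> (forall n, (M n ^ 2 <= L n)%N) ->
  (\int[mu]_(t in `[1%R, +oo[) (f_ (M n) (L n) w t)%:E)%E @[n --> \oo] -->
    (large_t_val w)%:E.
Proof.
move=> w0 nM ML.
have mI : measurable (`[1%R, +oo[%classic : set (measurableTypeR R)).
  exact: measurable_itv.
have c0 := qform_gt0 w0.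
pose c := pi ^+ 2 * qform w.
pose h (t : R) := pi `^ (d%:R / 2) * (t `^ (- a - 1) - inv_gamma_fun a c t).
have mf1 n : measurable_fun (`[1%R, +oo[%classic : set (measurableTypeR R))
    (EFin \o f_ (M n) (L n) w).
  by apply/measurable_EFinP/measurable_funTS; exact: mf_.
have ip : mu.-integrable `[1%R, +oo[ (EFin \o (fun t => t `^ (- a - 1))).
  apply/integrableP; split.
    by apply/measurable_EFinP/measurable_funTS; exact: measurable_powR.
  under eq_integral do rewrite /= ger0_norm ?powR_ge0//.
  by rewrite integral_powR// ltry.
have ig : mu.-integrable `[1%R, +oo[ (EFin \o (inv_gamma_fun a c)).
  apply/integrableP; split.
    by apply/measurable_EFinP/measurable_funTS; exact: measurable_inv_gamma_fun.
  under eq_integral do rewrite /= ger0_norm ?inv_gamma_fun_ge0//.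
  by apply: le_lt_trans (integral_inv_gamma_fun1y_le a0 c0) _; rewrite ltry.
have := @dominated_convergence _ _ R mu _ mI
    (fun n => EFin \o f_ (M n) (L n) w) (EFin \o h)
    (EFin \o (fun t => gauss_box_cst R d * t `^ (- a - 1))) mf1.
case.
- apply/measurable_EFinP/measurable_funTS; apply: measurable_funM => //.
  by apply: measurable_funB; [exact: measurable_powR|exact: measurable_inv_gamma_fun].
- apply: aeW => t /=; rewrite in_itv/= andbT => t1; apply: cvg_EFin; first exact: nearW.
  have t0 : 0 < t by lra.
  have -> : h t = Num.sqrt (pi / t) ^+ d *
      (1 - expR (- (pi ^+ 2 * dotp (intv w) (intv w) / t))) * t `^ (s / 2 - 1).
    rewrite /h (inv_gamma_funE _ _ (ltW t0)) -{1}[t `^ (- a - 1)]mulr1 -mulrBr.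
    rewrite -weight_powR// sqrtrM ?pi_ge0// (sqrtrV (ltW t0)) exprMn exprVn.
    by rewrite (sqrt_powR (pi_gt0 R)) (sqrt_powR t0) /c /qform; ring.
  by apply: cvgM; [exact: cvg_gauss_box|exact: cvg_cst].
- exact: (integrableZl mI (gauss_box_cst R d) ip).
- apply: aeW => t n /=; rewrite in_itv/= andbT => t1.
  have t0 : 0 < t by lra.
  rewrite lee_fin ger0_norm; last by rewrite mulr_ge0 ?powR_ge0 ?gauss_box_ge0.
  rewrite -weight_powR// mulrA ler_wpM2r ?powR_ge0//.
  by apply: gauss_box_le => //; exact: leq_ltn_trans (nM n).
move=> _ _; suff -> : (\int[mu]_(x in `[1%R, +oo[) (EFin \o h) x)%E =
  (large_t_val w)%:E by [].
have ih : mu.-integrable `[1%R, +oo[ (EFin \o h).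
  exact: (integrableZl mI (pi `^ (d%:R / 2)) (integrableB mI ip ig)).
rewrite -[LHS]fineK ?(integrable_fin_num mI ih)//; congr EFin.
rewrite -[LHS]/(\int[mu]_(x in `[1%R, +oo[) h x) /h RintegralZl//; last first.
  exact: (integrableB mI ip ig).
by rewrite RintegralB// {1}/Rintegral integral_powR.
Qed.

(** Passes from sequences to a threshold on [M] uniform in [L]: failing pairs for every [n] would
    form sequences contradicting [cvg_int]. Uniformity matters because [L] is later chosen after
    [M], large enough to contain a given finite set. *)
Lemma large_t_eventually w (e : R) : w != 0 -> 0 < e -> exists M0 : nat,
  forall M L, (M0 <= M)%N -> (M ^ 2 <= L)%N ->
  (\int[mu]_(t in `[1%R, +oo[) (gauss_box M L t w * t `^ (s / 2 - 1))%:E <=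
    (large_t_val w + e)%:E)%E.
Proof.
move=> w0 e0; apply: contrapT => /forallNP H.
have {}H n : exists ML : nat * nat, [/\ (n < ML.1)%N, (ML.1 ^ 2 <= ML.2)%N &
    ((large_t_val w + e)%:E < \int[mu]_(t in `[1%R, +oo[) (f_ ML.1 ML.2 w t)%:E)%E].
  apply: contrapT => /forallNP H'; apply: (H n.+1) => M L nM ML.
  rewrite leNgt; apply/negP => lt; apply: (H' (M, L)); split => //.
have [ML HML] := choice H.
have nM n : (n < (ML n).1)%N by have [] := HML n.
have MLn n : ((ML n).1 ^ 2 <= (ML n).2)%N by have [] := HML n.
have cv := cvg_int w0 nM MLn.
have : ((large_t_val w + e)%:E <= (large_t_val w)%:E)%E.
  rewrite -(cvg_lim _ cv)//; apply: lime_ge; first by apply/cvg_ex; eexists; exact: cv.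
  by apply: nearW => n; have [_ _ /ltW] := HML n.
by rewrite lee_fin; lra.
Qed.

End large_t.

Section integer_lattice.
Variables (R : realType) (d : nat).
Local Notation intv := (@intv R d).
Local Notation box L := {ffun 'I_d -> 'I_L.*2.+1}.

Lemma intv_inj : injective intv.
Proof.
move=> v w /colP vw; apply/colP => i; have := vw i; rewrite !mxE.
exact: intr_inj.
Qed.

Lemma lattice1 : lattice (1%:M : 'M[R]_d) = intv @` setT.
Proof. by congr (_ @` _); apply/funext => z; rewrite mul1mx. Qed.

Lemma dual_lattice1 : dual_lattice (1%:M : 'M[R]_d) = intv @` setT.
Proof. by rewrite /dual_lattice trmx1 invmx1 lattice1. Qed.

Lemma sum_uniq_le_box L (G : 'cV[int]_d -> R) (S : seq 'cV[int]_d) :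
  (forall v, 0 <= G v) -> uniq S ->
  (forall v, v \in S -> exists k : box L, v = boxpt k) ->
  \sum_(v <- S) G v <= \sum_(k : box L) G (boxpt k).
Proof.
move=> G0 uS SL.
pose ks := [seq k <- enum (predT : pred (box L)) | boxpt k \in S].
have SE : perm_eq S [seq boxpt k | k <- ks].
  apply: uniq_perm => //.
    by rewrite map_inj_uniq; [rewrite filter_uniq// enum_uniq|exact: boxpt_inj].
  move=> v; apply/idP/mapP => [vS|[k + ->]]; last by rewrite mem_filter => /andP[].
  have [k vk] := SL _ vS; exists k => //.
  by rewrite mem_filter -vk vS mem_enum.
rewrite (perm_big _ SE) big_map big_filter big_enum_cond/= big_mkcond.
by apply: ler_sum => k _; case: ifP.
Qed.

End integer_lattice.

(** * Grid averages of the Gaussian part *)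

Section large_t_bound.
Variables (R : realType) (d : nat) (s : R).
Hypotheses (d0 : (0 < d)%N) (s0 : 0 < s) (sd : s < d%:R).
Local Notation mu := (@lebesgue_measure R).
Local Notation intv := (@intv R d).
Local Notation box L := {ffun 'I_d -> 'I_L.*2.+1}.

Lemma Gamma_ge0 (z : R) : 0 <= Gamma z.
Proof.
by apply: Rintegral_ge0 => t _; rewrite mulr_ge0 ?powR_ge0 ?expR_ge0.
Qed.

Definition large_t_term (y : 'cV[R]_d) : \bar R :=
  (\int[mu]_(t in `[1%R, +oo[)
    (expR (- (enorm y ^+ 2 * t)) * (t `^ (s / 2 - 1) / Gamma (s / 2)))%:E)%E.

Definition large_t_part (x : 'cV[R]_d) : \bar R :=
  (\esum_(v in lattice (1%:M : 'M[R]_d)) large_t_term (x + v))%E.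

Let integrand_ge0 (y : 'cV[R]_d) (t : R) :
  0 <= expR (- (enorm y ^+ 2 * t)) * (t `^ (s / 2 - 1) / Gamma (s / 2)).
Proof. by rewrite mulr_ge0 ?expR_ge0// divr_ge0 ?powR_ge0// Gamma_ge0. Qed.

Let measurable_integrand (y : 'cV[R]_d) : measurable_fun setT
  (fun t => expR (- (enorm y ^+ 2 * t)) * (t `^ (s / 2 - 1) / Gamma (s / 2))).
Proof.
apply: measurable_funM; last by apply: measurable_funM => //; exact: measurable_powR.
by apply: measurableT_comp => //; apply: measurableT_comp => //; exact: measurable_funM.
Qed.

Lemma large_t_term_ge0 y : (0 <= large_t_term y)%E.
Proof. by apply: integral_ge0 => t _; rewrite lee_fin integrand_ge0. Qed.

Lemma large_t_part_ge0 x : (0 <= large_t_part x)%E.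
Proof. by apply: esum_ge0 => v _; exact: large_t_term_ge0. Qed.

Lemma large_t_partE x :
  large_t_part x = (\esum_(z in [set: 'cV[int]_d]) large_t_term (x + intv z))%E.
Proof.
rewrite /large_t_part lattice1 esum_image// => z z' _ _; exact: intv_inj.
Qed.

(** The points [gridpt R a - gridpt R b + intv z] run through (1/M) Z^d without repetition, and the
    shift by [z] leaves the cosine unchanged since [w] is integral. Any finite part of the average
    is thus a partial sum of [gauss_box] with [L] large, and its terms are nonnegative. *)
Lemma large_t_part_bound w (e : R) : w != 0 -> 0 < e -> exists M0 : nat,
  forall M, (M0 <= M)%N -> (0 < M)%N -> forall a : {ffun 'I_d -> 'I_M},
  (\sum_(b : {ffun 'I_d -> 'I_M})
    ((M%:R ^+ d)^-1 *
      (1 - cos (2 * pi * dotp (gridpt R a - gridpt R b) (intv w))))%:E *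
    large_t_part (gridpt R a - gridpt R b) <=
  ((Gamma (s / 2))^-1 * (large_t_val s w + e))%:E)%E.
Proof.
move=> w0 e0; have [M0 HM0] := large_t_eventually d0 sd w0 e0.
exists M0 => M M0M Mpos a.
have MR : 0 < M%:R :> R by rewrite ltr0n.
have MRn : M%:R != 0 :> R by rewrite gt_eqF.
pose c (b : {ffun 'I_d -> 'I_M}) : R := (M%:R ^+ d)^-1 *
  (1 - cos (2 * pi * dotp (gridpt R a - gridpt R b) (intv w))).
have c0 b : 0 <= c b.
  by rewrite mulr_ge0 ?invr_ge0 ?exprn_ge0// subr_ge0 cos_le1.
pose tm (b : {ffun 'I_d -> 'I_M}) (z : 'cV[int]_d) :=
  ((c b)%:E * large_t_term (gridpt R a - gridpt R b + intv z))%E.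
apply: (@le_trans _ _ (\esum_(z in [set: 'cV[int]_d]) \sum_b tm b z)%E).
  rewrite esum_sum; last first.
    by move=> z b _ _; rewrite mule_ge0 ?lee_fin// large_t_term_ge0.
  apply: lee_sum => b _; rewrite large_t_partE.
  by apply: le_mule_esum => // z; exact: large_t_term_ge0.
apply: ge_ereal_sup => _ [X [fX _] <-].
(* M times the point a/M - b/M + z. Its residue mod M determines [b], since [b i < M], and then [z]
   is determined; hence [uS]. *)
pose kap (z : 'cV[int]_d) (b : {ffun 'I_d -> 'I_M}) : 'cV[int]_d :=
  \col_i ((a i)%:Z - (b i)%:Z + M%:Z * z i 0).
pose XS : seq 'cV[int]_d := fset_set X.
pose S := [seq kap z b | z <- XS, b <- enum (predT : pred {ffun 'I_d -> 'I_M})].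
have [L0 HL0] := box_exhaust S.
(* [L0] makes the box contain the finite set [S]; [M ^ 2] is what [large_t_eventually] requires. *)
pose L := maxn L0 (M ^ 2).
have SL := HL0 L (leq_maxl _ _).
have uS : uniq S.
  apply: allpairs_uniq; [exact: fset_uniq|exact: enum_uniq|].
  move=> [z b] [z' b'] _ _ /= /colP E.
  have Eb i : b i = b' i.
    apply/val_inj; have := E i; rewrite !mxE => {}E.
    have : ((b i)%:Z = (b' i)%:Z %[mod M])%Z.
      have -> : (b i)%:Z = ((z i 0 - z' i 0) * M + (b' i)%:Z)%R.
        apply/eqP; rewrite -subr_eq0; move/eqP : E; rewrite -subr_eq0 => /eqP E.
        by rewrite -oppr0 -E; apply/eqP; ring.
      by rewrite modzMDl.
    by rewrite !modz_nat !modn_small// => -[].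
  have Ez i : z i 0 = z' i 0.
    have := E i; rewrite !mxE Eb => /addrI.
    by apply: mulfI; rewrite -lt0n.
  congr (_, _); first exact/colP.
  exact/ffunP.
pose F (z : 'cV[int]_d) (b : {ffun 'I_d -> 'I_M}) (t : R) :=
  c b * (expR (- (enorm (gridpt R a - gridpt R b + intv z) ^+ 2 * t)) *
    (t `^ (s / 2 - 1) / Gamma (s / 2))).
have tmE b z : tm b z = (\int[mu]_(t in `[1%R, +oo[) (F z b t)%:E)%E.
  rewrite /tm /large_t_term -ge0_integralZl//=.
  - by apply/measurable_EFinP/measurable_funTS; exact: measurable_integrand.
  - by move=> t _; rewrite lee_fin integrand_ge0.
  - by rewrite lee_fin.
have F0 z b t : 0 <= F z b t by rewrite mulr_ge0// integrand_ge0.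
have mF z b : measurable_fun setT (F z b).
  by apply: measurable_funM => //; exact: measurable_integrand.
apply: (@le_trans _ _ (\int[mu]_(t in `[1%R, +oo[)
    ((Gamma (s / 2))^-1 * (gauss_box M L t w * t `^ (s / 2 - 1)))%:E)%E).
  rewrite fsbig_finite//=.
  under eq_bigr do under eq_bigr do rewrite tmE.
  under eq_bigr => z _.
    rewrite -ge0_integral_sum//; last 2 first.
    - by move=> b; apply/measurable_EFinP/measurable_funTS; exact: mF.
    - by move=> b t _; rewrite lee_fin.
    over.
  rewrite -ge0_integral_sum//; last 2 first.
  - move=> z; apply: emeasurable_sum => b.
    by apply/measurable_EFinP/measurable_funTS; exact: mF.
  - by move=> z t _; apply: sume_ge0 => b _; rewrite lee_fin.
  apply: ge0_le_integral => //=.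
  - by move=> t _; do 2 (apply: sume_ge0 => ? _); rewrite lee_fin.
  - apply: emeasurable_sum => z; apply: emeasurable_sum => b.
    by apply/measurable_EFinP/measurable_funTS; exact: mF.
  - apply/measurable_EFinP/measurable_funTS; apply: measurable_funM => //.
    by apply: measurable_funM; [exact: measurable_gauss_box|exact: measurable_powR].
  move=> t; rewrite in_itv/= andbT => t1.
  pose G (v : 'cV[int]_d) : R :=
    expR (- (dotp (intv v) (intv v) * (t / M%:R ^+ 2))) *
    (1 - cos (2 * pi * (dotp (intv v) (intv w) / M%:R))).
  have G0 v : 0 <= G v by rewrite mulr_ge0 ?expR_ge0// subr_ge0 cos_le1.
  pose g := (Gamma (s / 2))^-1 * t `^ (s / 2 - 1) * (M%:R ^+ d)^-1.
  have FE z b : F z b t = g * G (kap z b).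
    have kapE : gridpt R a - gridpt R b + intv z = M%:R^-1 *: intv (kap z b).
      apply/colP => i; rewrite !mxE intrD intrB intrM.
      have ME (n : nat) : (n%:Z)%:~R = n%:R :> R by [].
      by rewrite !ME; field.
    have dotZ (x y : 'cV[R]_d) (r : R) : dotp (r *: x) y = r * dotp x y.
      by rewrite /dotp mulr_sumr; apply: eq_bigr => i _; rewrite mxE mulrA.
    have cosE : cos (2 * pi * dotp (gridpt R a - gridpt R b) (intv w)) =
        cos (2 * pi * (dotp (intv (kap z b)) (intv w) / M%:R)).
      have -> : dotp (intv (kap z b)) (intv w) / M%:R =
          dotp (gridpt R a - gridpt R b) (intv w) + dotp (intv z) (intv w).
        by rewrite -dotpDl kapE dotZ mulrC.
      by rewrite (dotp_intv R z w) [2 * pi * (_ + _)]mulrDr cosDint.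
    rewrite /F /G /c cosE enorm_sqr kapE dotZ [dotp _ (_ *: _)]dotpC dotZ.
    rewrite (_ : M%:R^-1 * (M%:R^-1 * dotp (intv (kap z b)) (intv (kap z b))) * t =
      dotp (intv (kap z b)) (intv (kap z b)) * (t / M%:R ^+ 2)); last by field.
    by rewrite /g; ring.
  have -> : (\sum_(z <- fset_set X) \sum_b (F z b t)%:E)%E =
      (g * \sum_(v <- S) G v)%:E.
    rewrite mulr_sumr big_allpairs_dep/= -sumEFin; apply: eq_bigr => z _.
    by rewrite -sumEFin big_enum/=; apply: eq_bigr => b _; rewrite FE.
  rewrite lee_fin /gauss_box.
  have : \sum_(v <- S) G v <= \sum_(k : box L) G (boxpt k) by exact: sum_uniq_le_box.
  move=> /(ler_wpM2l (_ : 0 <= g)); rewrite {1}/g.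
  rewrite !mulr_ge0 ?invr_ge0 ?Gamma_ge0 ?powR_ge0 ?exprn_ge0// => /(_ isT) H.
  apply: (le_trans H); rewrite le_eqVlt; apply/orP; left; apply/eqP.
  by rewrite /g /G; ring.
under eq_integral do rewrite EFinM.
rewrite ge0_integralZl//=.
- rewrite EFinM lee_wpmul2l ?lee_fin ?invr_ge0 ?Gamma_ge0//.
  by apply: HM0 => //; exact: leq_maxr.
- apply/measurable_EFinP/measurable_funTS.
  by apply: measurable_funM; [exact: measurable_gauss_box|exact: measurable_powR].
- by move=> t _; rewrite lee_fin mulr_ge0 ?gauss_box_ge0 ?powR_ge0.
- by rewrite lee_fin invr_ge0 Gamma_ge0.
Qed.

End large_t_bound.

(** * Absolutely convergent signed sums *)

Section sumset_theory.
Variables (R : realType) (T : choiceType).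
Implicit Types (D : set T) (f b : T -> R) (r : seq T).

Lemma esum_seq (a : T -> \bar R) r : uniq r -> (forall x, (0 <= a x)%E) ->
  (\esum_(x in [set` r]) a x = \sum_(x <- r) a x)%E.
Proof. by move=> ur a0; rewrite esum_fset// -fsbig_seq. Qed.

Lemma esum_seqD (a : T -> \bar R) D r : uniq r -> [set` r] `<=` D ->
  (forall x, (0 <= a x)%E) ->
  (\esum_(x in D) a x = \sum_(x <- r) a x + \esum_(x in D `\` [set` r]) a x)%E.
Proof.
move=> ur rD a0; rewrite (esumID [set` r])//; congr (_ + _)%E.
by rewrite setIC (setIidl rD) esum_seq.
Qed.

Lemma esum_tail D b (e : R) : (forall x, 0 <= b x) ->
  (\esum_(x in D) (b x)%:E < +oo)%E -> 0 < e ->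
  exists2 X : seq T, [set` X] `<=` D & forall r, uniq r ->
    [set` X] `<=` [set` r] -> [set` r] `<=` D ->
    (\esum_(x in D `\` [set` r]) (b x)%:E <= e%:E)%E.
Proof.
move=> b0 boo e0.
have fin : (\esum_(x in D) (b x)%:E)%E \is a fin_num.
  by rewrite ge0_fin_numE// esum_ge0// => x _; rewrite lee_fin.
have [_ [X [fX XD] <-] ltX] := ub_ereal_sup_adherent e0 fin.
exists (fset_set X : seq T) => [x /=|r ur Xr rD].
  by rewrite in_fset_set// inE => /XD.
have Xr' : (\sum_(x \in X) (b x)%:E <= \sum_(x <- r) (b x)%:E)%E.
  rewrite -[leRHS](@esum_seq (EFin \o b) r ur)//.
  apply: esum_ge; exists X => //; split => // x Xx; apply: Xr => /=.
  by rewrite in_fset_set// inE.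
have tE := @esum_seqD (EFin \o b) D r ur rD b0.
move: fin ltX; rewrite -[ereal_sup _]/(\esum_(x in D) (b x)%:E)%E tE /=.
set t := (\esum_(x in D `\` _) _)%E; move: Xr'.
rewrite fsbig_finite//= !sumEFin; case: t => [t| |] //=.
by rewrite !lee_fin lte_fin; lra.
Qed.

Let funepos_fin f x : ((EFin \o f)^\+%E x) = (Num.max (f x) 0)%:E.
Proof. by rewrite funeposE EFin_max. Qed.

Let funeneg_fin f x : ((EFin \o f)^\-%E x) = (Num.max (- f x) 0)%:E.
Proof. by rewrite funenegE EFin_max. Qed.

(** Outside [r] the positive part costs at most [e] and the negative part can only lower the sum. *)
Lemma sumset_le D f b r (e : R) : (forall x, `|f x| <= b x) -> uniq r ->
  [set` r] `<=` D -> (\esum_(x in D `\` [set` r]) (b x)%:E <= e%:E)%E ->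
  (sumset D (EFin \o f) <= (\sum_(x <- r) f x + e)%:E)%E.
Proof.
move=> fb ur rD be; rewrite /sumset.
have -> : \sum_(x <- r) f x + e =
    (\sum_(x <- r) Num.max (f x) 0 + e) - \sum_(x <- r) Num.max (- f x) 0.
  rewrite addrAC -sumrB; congr (_ + _); apply: eq_bigr => x _.
  by case: (leP (f x) 0) => fx; case: (leP (- f x) 0) => fx'; lra.
rewrite EFinB; apply: leeB.
  rewrite (esum_seqD ur rD) => [|x]; last by rewrite funepos_fin lee_fin le_max lexx orbT.
  rewrite EFinD -sumEFin; apply: leeD.
    by apply: lee_sum => x _; rewrite funepos_fin.
  apply: le_trans be; apply: le_esum => x _; rewrite funepos_fin lee_fin.
  by rewrite ge_max (le_trans (normr_ge0 _) (fb x)) (le_trans (ler_norm _) (fb x)).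
rewrite (esum_seqD ur rD) => [|x]; last by rewrite funeneg_fin lee_fin le_max lexx orbT.
rewrite -sumEFin -[X in (X <= _)%E]adde0; apply: leeD.
  by apply: lee_sum => x _; rewrite funeneg_fin.
by apply: esum_ge0 => x _; rewrite funeneg_fin lee_fin le_max lexx orbT.
Qed.

Lemma sumset_fin D f b (B : R) : (forall x, `|f x| <= b x) ->
  (\esum_(x in D) (b x)%:E <= B%:E)%E ->
  (sumset D (EFin \o f) \is a fin_num) /\ ((- B)%:E <= sumset D (EFin \o f))%E.
Proof.
move=> fb bB; rewrite /sumset.
have p0 : (0 <= \esum_(x in D) (EFin \o f)^\+%E x)%E.
  by apply: esum_ge0 => x _; rewrite funepos_fin lee_fin le_max lexx orbT.
have n0 : (0 <= \esum_(x in D) (EFin \o f)^\-%E x)%E.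
  by apply: esum_ge0 => x _; rewrite funeneg_fin lee_fin le_max lexx orbT.
have pB : (\esum_(x in D) (EFin \o f)^\+%E x <= B%:E)%E.
  apply: le_trans bB; apply: le_esum => x _; rewrite funepos_fin lee_fin.
  by rewrite ge_max (le_trans (normr_ge0 _) (fb x)) (le_trans (ler_norm _) (fb x)).
have nB : (\esum_(x in D) (EFin \o f)^\-%E x <= B%:E)%E.
  apply: le_trans bB; apply: le_esum => x _; rewrite funeneg_fin lee_fin.
  rewrite ge_max (le_trans (normr_ge0 _) (fb x)) andbT.
  by rewrite (le_trans (ler_norm _))// normrN.
move: p0 n0 pB nB; set p := (\esum_(x in D) _)%E; set n := (\esum_(x in D) _)%E.
case: p => [p| |] //; case: n => [n| |] //; rewrite !lee_fin => *; split => //.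
lra.
Qed.

Lemma sumset_image (T' : choiceType) (h : T -> T') D (f : T' -> \bar R) :
  injective h -> sumset (h @` D) f = sumset D (f \o h).
Proof.
move=> hi; have hD : set_inj D h by move=> x y _ _; exact: hi.
rewrite /sumset !(@esum_image R T T' D h _ hD).
by congr (_ - _)%E; apply: eq_esum => x _; rewrite ?funeposE ?funenegE.
Qed.

End sumset_theory.

(** * Grid averages of the cosine series, t <= 1 *)

Section small_t_bound.
Variables (R : realType) (d : nat) (s : R).
Hypotheses (d0 : (0 < d)%N) (sd : s < d%:R).
Local Notation mu := (@lebesgue_measure R).
Local Notation intv := (@intv R d).
Local Notation qform := (@qform R d).
Local Notation box L := {ffun 'I_d -> 'I_L.*2.+1}.
Let a : R := (d%:R - s) / 2.
Let a0 : 0 < a. Proof. by rewrite divr_gt0 ?subr_gt0. Qed.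
Let nonzero : set 'cV[int]_d := [set z | z != 0].

Definition small_t_coef (z : 'cV[int]_d) : R :=
  (Gamma (s / 2))^-1 * pi `^ (d%:R / 2) * inv_gamma01 a (pi ^+ 2 * qform z).

(** Kept in the exact shape of the dual sum in [periodic_riesz], so that [periodic_riesz1] holds by
    conversion; the usable form is [small_t_partE]. *)
Definition small_t_part (x : 'cV[R]_d) : \bar R :=
  sumset (dual_lattice (1%:M : 'M[R]_d) `\ 0%R) (fun w =>
       ((complex.Re (expi (2 * pi * dotp x w)))%:E *
       \int[mu]_(t in `[0%R, 1%R])
         (pi `^ (d%:R / 2) / t `^ (d%:R / 2) *
          expR (- (pi ^+ 2 * enorm w ^+ 2 / t)) *
          (t `^ (s / 2 - 1) / Gamma (s / 2)))%:E)%E).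

Lemma small_t_coef_ge0 z : 0 <= small_t_coef z.
Proof. by rewrite !mulr_ge0 ?invr_ge0 ?Gamma_ge0 ?powR_ge0 ?inv_gamma01_ge0. Qed.

Let qform_gt0 z : z != 0 -> 0 < pi ^+ 2 * qform z.
Proof.
move=> z0; rewrite mulr_gt0 ?exprn_gt0 ?pi_gt0//.
by apply: lt_le_trans (dotp_intv_ge1 R z0).
Qed.

Let integral_coef z : z != 0 -> (\int[mu]_(t in `[0%R, 1%R])
         (pi `^ (d%:R / 2) / t `^ (d%:R / 2) *
          expR (- (pi ^+ 2 * enorm (intv z) ^+ 2 / t)) *
          (t `^ (s / 2 - 1) / Gamma (s / 2)))%:E = (small_t_coef z)%:E)%E.
Proof.
move=> z0; rewrite /small_t_coef; set c := pi ^+ 2 * qform z.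
have c0 : 0 < c by exact: qform_gt0.
rewrite EFinM /inv_gamma01 /Rintegral fineK; last exact: integral_inv_gamma_fun01_fin.
rewrite -ge0_integralZl//=; last 3 first.
- by apply/measurable_EFinP/measurable_funTS; exact: measurable_inv_gamma_fun.
- by move=> t _; rewrite lee_fin inv_gamma_fun_ge0.
- by rewrite lee_fin mulr_ge0 ?invr_ge0 ?Gamma_ge0 ?powR_ge0.
suff H (t : R) : 0 <= t <= 1 -> pi `^ (d%:R / 2) / t `^ (d%:R / 2) *
    expR (- (pi ^+ 2 * enorm (intv z) ^+ 2 / t)) *
    (t `^ (s / 2 - 1) / Gamma (s / 2)) =
    (Gamma (s / 2))^-1 * pi `^ (d%:R / 2) * inv_gamma_fun a c t.
  apply: eq_integral => t; rewrite inE/= in_itv/= => t01.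
  by rewrite -EFinM; congr EFin; exact: H.
(* At t = 0 both sides are 0 by convention: 0 to a nonzero power is 0, and so is the inverse of
   0. *)
move=> /andP[]; rewrite le_eqVlt => /predU1P[<- _|t0 _].
  rewrite /inv_gamma_fun (powR0 (x := d%:R / 2)); last first.
    by rewrite gt_eqF// divr_gt0// ltr0n.
  rewrite (powR0 (x := - a - 1)); last by rewrite lt_eqF//; move: a0; lra.
  by rewrite invr0 mulr0 !mul0r mulr0.
rewrite (inv_gamma_funE _ _ (ltW t0)).
have -> : t `^ (- a - 1) = t `^ (s / 2 - 1) / t `^ (d%:R / 2).
  rewrite -powRB; last by rewrite (gt_eqF t0) implybT.
  by congr (_ `^ _); rewrite /a; field.
by rewrite enorm_sqr /c /qform; ring.
Qed.

Lemma small_t_partE x : small_t_part x =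
  sumset nonzero (EFin \o (fun z => cos (2 * pi * dotp x (intv z)) * small_t_coef z)).
Proof.
have DE : dual_lattice (1%:M : 'M[R]_d) `\ 0%R = intv @` nonzero.
  have intv0 : intv 0 = 0 by apply/colP => i; rewrite !mxE.
  rewrite dual_lattice1; apply/seteqP; split => [_ [[z _ <-] z0]|_ [z z0 <-]].
    by exists z => //; apply/eqP => zE; apply: z0; rewrite zE intv0.
  split; first by exists z.
  by rewrite /= -intv0 => /intv_inj zE; rewrite /nonzero/= zE eqxx in z0.
rewrite /small_t_part DE sumset_image; last exact: intv_inj.
rewrite /sumset; congr (_ - _)%E; apply: eq_esum => z z0;
  by rewrite ?funeposE ?funenegE /= integral_coef.
Qed.

Let K : R := (Gamma (s / 2))^-1 * pi `^ (d%:R / 2) * inv_gamma01 a (pi ^+ 2 / 2).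

(** [inv_gamma01_le] is used with c = pi^2 |z|^2 and c' = pi^2/2, which is allowed because |z|^2 >=
    1; pi^2 >= 4 then leaves at least the decay exp(-|z|^2), summable by the theta bound. *)
Let small_t_coef_le z : z != 0 -> small_t_coef z <= K * expR (- (qform z * 1 ^+ 2)).
Proof.
move=> z0; have q1 : 1 <= qform z by exact: dotp_intv_ge1.
have pi2 : 4 <= pi ^+ 2 :> R.
  have := pi_ge2 R => p2; rewrite (_ : 4 = 2 * 2 :> R); last by ring.
  by rewrite expr2 ler_pM.
have -> : K * expR (- (qform z * 1 ^+ 2)) = (Gamma (s / 2))^-1 * pi `^ (d%:R / 2) *
   (expR (- (qform z * 1 ^+ 2)) * inv_gamma01 a (pi ^+ 2 / 2)) by rewrite /K; ring.
apply: ler_wpM2l; first by rewrite mulr_ge0 ?invr_ge0 ?Gamma_ge0 ?powR_ge0.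
have c0 : 0 < pi ^+ 2 / 2 :> R by lra.
have cc : 2 * (pi ^+ 2 / 2) <= pi ^+ 2 * qform z :> R.
  rewrite mulrCA divff// mulr1 ler_peMr//; lra.
apply: (le_trans (inv_gamma01_le a0 c0 cc)).
apply: ler_wpM2r; first exact: inv_gamma01_ge0.
rewrite ler_expR lerN2 expr1n mulr1.
have : 4 * qform z <= pi ^+ 2 * qform z by rewrite ler_wpM2r//; lra.
lra.
Qed.

Definition small_t_cst : R := K * ((1 + expR 1) / 1) ^+ d.

Lemma esum_small_t_coef : (\esum_(z in nonzero) (small_t_coef z)%:E <= small_t_cst%:E)%E.
Proof.
have K0 : 0 <= K by rewrite !mulr_ge0 ?invr_ge0 ?Gamma_ge0 ?powR_ge0 ?inv_gamma01_ge0.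
apply: ge_ereal_sup => _ [X [fX Xnz] <-].
rewrite fsbig_finite//= sumEFin lee_fin.
have [L HL] := box_exhaust (fset_set X : seq 'cV[int]_d).
have uX : uniq (fset_set X : seq 'cV[int]_d) by exact: fset_uniq.
have XL := HL L (leqnn L).
apply: (@le_trans _ _ (\sum_(z <- fset_set X) K * expR (- (qform z * 1 ^+ 2)))).
  rewrite !big_seq; apply: ler_sum => z; rewrite in_fset_set// inE => /Xnz z0.
  exact: small_t_coef_le.
apply: (@le_trans _ _ (\sum_(k : box L) K * expR (- (qform (boxpt k) * 1 ^+ 2)))).
  apply: (@sum_uniq_le_box R d L (fun z => K * expR (- (qform z * 1 ^+ 2)))) => //.
  by move=> v; rewrite mulr_ge0 ?expR_ge0.
rewrite -mulr_sumr /small_t_cst ler_wpM2l//.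
exact: sum_box_exp_le.
Qed.

Let term_le x z : `|cos (2 * pi * dotp x (intv z)) * small_t_coef z| <= small_t_coef z.
Proof.
rewrite normrM (ger0_norm (small_t_coef_ge0 z)) ler_piMl ?small_t_coef_ge0//.
exact: cos_max.
Qed.

Lemma small_t_part_fin x : small_t_part x \is a fin_num.
Proof. by rewrite small_t_partE; have [] := sumset_fin (term_le x) esum_small_t_coef. Qed.

Lemma small_t_part_ge x : ((- small_t_cst)%:E <= small_t_part x)%E.
Proof. by rewrite small_t_partE; have [] := sumset_fin (term_le x) esum_small_t_coef. Qed.

(** The series is truncated to the nonzero vectors of a box of radius [L < M] containing [w] and
    [- w]. No such vector is divisible by M, so the frequency z itself averages to 0; the
    frequencies z + w and z - w enter with a minus sign and nonnegative coefficients. Keeping only z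
    = - w and z = w, each with weight 1/2, gives [- small_t_coef w]; aliased terms would only
    improve the bound. *)
Lemma small_t_part_bound w (e : R) : w != 0 -> 0 < e -> exists M0 : nat,
  forall M, (M0 <= M)%N -> (0 < M)%N -> forall b : {ffun 'I_d -> 'I_M},
  (\sum_(b' : {ffun 'I_d -> 'I_M})
    ((M%:R ^+ d)^-1 *
      (1 - cos (2 * pi * dotp (gridpt R b - gridpt R b') (intv w))))%:E *
    small_t_part (gridpt R b - gridpt R b') <= (e - small_t_coef w)%:E)%E.
Proof.
move=> w0 e0.
(* Half of [e], because the grid weights sum to at most 2 ([sumc]). *)
have [X Xnz HX] := @esum_tail R _ nonzero small_t_coef (e / 2) small_t_coef_ge0
  (le_lt_trans esum_small_t_coef (ltry _)) (divr_gt0 e0 (ltr0Sn _ 1)).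
have [L HL] := box_exhaust (w :: - w :: X).
have {}HL := HL L (leqnn L).
exists L.+1 => M LM Mpos b.
have MR : 0 < M%:R :> R by rewrite ltr0n.
have [r ur rP] : exists2 r : seq 'cV[int]_d, uniq r &
    forall z, (z \in r) = (z != 0) && [forall i, (`|z i 0%R| <= L)%N].
  exists [seq boxpt k | k <- enum [pred k : box L | boxpt k != 0]].
    by rewrite map_inj_uniq ?enum_uniq//; exact: boxpt_inj.
  move=> z; apply/mapP/andP => [[k + ->]|[z0 /boxptP[k zk]]].
    by rewrite mem_enum inE => k0; split => //; apply/boxptP; exists k.
  by exists k => //; rewrite mem_enum inE -zk.
have inr z : z != 0 -> z \in w :: - w :: X -> z \in r.
  by move=> z0 /HL zL; rewrite rP z0; apply/boxptP.
have rnz : [set` r] `<=` nonzero by move=> z /=; rewrite rP => /andP[].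
have tail := HX r ur _ rnz.
have {}tail : (\esum_(x in nonzero `\` [set` r]) (small_t_coef x)%:E <= (e / 2)%:E)%E.
  apply: tail => z /= zX; apply: inr; first exact: Xnz.
  by rewrite !inE zX !orbT.
have small_le x : (small_t_part x <=
    (\sum_(z <- r) cos (2 * pi * dotp x (intv z)) * small_t_coef z + e / 2)%:E)%E.
  by rewrite small_t_partE; apply: sumset_le tail => //; exact: term_le.
pose c (b' : {ffun 'I_d -> 'I_M}) : R := (M%:R ^+ d)^-1 *
  (1 - cos (2 * pi * dotp (gridpt R b - gridpt R b') (intv w))).
have c0 b' : 0 <= c b'.
  by rewrite mulr_ge0 ?invr_ge0 ?exprn_ge0// subr_ge0 cos_le1.
apply: (@le_trans _ _ (\sum_b' (c b' * (\sum_(z <- r)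
    cos (2 * pi * dotp (gridpt R b - gridpt R b') (intv z)) * small_t_coef z
    + e / 2))%:E)%E).
  apply: lee_sum => b' _; have cb : (0 <= (c b')%:E)%E by rewrite lee_fin.
  by rewrite EFinM; exact: (lee_wpmul2l cb (small_le _)).
rewrite sumEFin lee_fin.
have sumc : \sum_b' c b' <= 2.
  apply: (@le_trans _ _ (\sum_(b' : {ffun 'I_d -> 'I_M}) (M%:R ^+ d)^-1 * 2)).
    apply: ler_sum => b' _; apply: ler_wpM2l; first by rewrite invr_ge0 exprn_ge0.
    have := cos_geN1 (2 * pi * dotp (gridpt R b - gridpt R b') (intv w)); lra.
  rewrite sumr_const card_ffun !card_ord -[leLHS]mulr_natl natrX.
  by rewrite mulrA mulfV ?mul1r// expf_neq0// gt_eqF.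
have main : \sum_b' c b' * (\sum_(z <- r)
    cos (2 * pi * dotp (gridpt R b - gridpt R b') (intv z)) * small_t_coef z) =
  \sum_(z <- r) small_t_coef z * ((dvdv M z)%:R -
      ((dvdv M (z + w))%:R + (dvdv M (z - w))%:R) / 2).
  under eq_bigr do rewrite mulr_sumr.
  rewrite exchange_big/=; apply: eq_bigr => z _.
  have := sum_grid_cosM R Mpos z w b; rewrite natrX => H.
  have Md : M%:R ^+ d != 0 :> R by rewrite expf_neq0// gt_eqF.
  rewrite -[X in _ = _ * X](mulKf Md) -H.
  rewrite !mulr_sumr; apply: eq_bigr => b' _; rewrite /c; ring.
under eq_bigr do rewrite mulrDr.
rewrite big_split/= -mulr_suml main.
have coefN : small_t_coef (- w) = small_t_coef w.
  rewrite /small_t_coef /qform (_ : intv (- w) = - intv w) ?dotpNl 1?dotpC ?dotpNl ?opprK//.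
  by rewrite /intv map_mxN.
have dvd0 : dvdv M (0 : 'cV[int]_d).
  by apply/forallP => i; rewrite mxE dvdz0.
have wr : w \in r by apply: inr => //; rewrite inE eqxx.
have nwr : - w \in r by apply: inr; rewrite ?oppr_eq0// !inE eqxx orbT.
have H1 : small_t_coef w <= \sum_(z <- r) small_t_coef z * (dvdv M (z - w))%:R.
  rewrite (bigD1_seq w)//= subrr dvd0 mulr1 lerDl sumr_ge0// => z _.
  by rewrite mulr_ge0// small_t_coef_ge0.
have H2 : small_t_coef w <= \sum_(z <- r) small_t_coef z * (dvdv M (z + w))%:R.
  rewrite (bigD1_seq (- w))//= addNr dvd0 mulr1 coefN lerDl sumr_ge0// => z _.
  by rewrite mulr_ge0// small_t_coef_ge0.
have -> : \sum_(z <- r) small_t_coef z * ((dvdv M z)%:R -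
      ((dvdv M (z + w))%:R + (dvdv M (z - w))%:R) / 2) =
  - (\sum_(z <- r) small_t_coef z * (dvdv M (z + w))%:R
     + \sum_(z <- r) small_t_coef z * (dvdv M (z - w))%:R) / 2.
  rewrite -big_split/= mulNr mulr_suml -sumrN !big_seq; apply: eq_bigr => z.
  rewrite rP => /andP[z0 /forallP zL].
  have -> : dvdv M z = false.
    apply/negP => /forallP dz; move/negP: z0; apply; apply/eqP/colP => i.
    rewrite mxE; have /dvdzP[q qE] := dz i; have := zL i; rewrite qE abszM.
    case: (q =P 0) => [-> _|q0]; first by rewrite mul0r.
    have : (0 < `|q|)%N by rewrite absz_gt0; apply/eqP.
    by rewrite absz_nat => /(leq_pmull M) H /(leq_trans H); rewrite leqNgt LM.
  by rewrite /=; field.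
have := ler_wpM2r (_ : 0 <= e / 2) sumc => /(_ (ltW (divr_gt0 e0 (ltr0Sn _ 1)))).
lra.
Qed.

End small_t_bound.

Lemma eventually_forall (I : finType) (P : I -> nat -> Prop) :
  (forall i, exists M0, forall M, (M0 <= M)%N -> P i M) ->
  exists M0, forall M, (M0 <= M)%N -> forall i, P i M.
Proof.
move=> /choice[M0 HM0]; exists (\max_i M0 i)%N => M M0M i; apply: HM0.
exact: leq_trans (leq_bigmax i) M0M.
Qed.

(** * Energy bound for distinct frequencies on Z^d *)

Section energy_bound.
Variables (R : realType) (d : nat) (s : R).
Hypotheses (d0 : (0 < d)%N) (s0 : 0 < s) (sd : s < d%:R).
Local Notation intv := (@intv R d).
Local Notation qform := (@qform R d).
Let a : R := (d%:R - s) / 2.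
Let a0 : 0 < a. Proof. by rewrite divr_gt0 ?subr_gt0. Qed.
Let gamma : R := (Gamma (s / 2))^-1.
Let gamma0 : 0 <= gamma. Proof. by rewrite invr_ge0 Gamma_ge0. Qed.

(** Also the coefficient of N^2 in the expansion for Z^d, so that the quadratic terms cancel in the
    final comparison. *)
Definition riesz_mean : R := 2 * pi `^ (d%:R / 2) / (Gamma (s / 2) * (d%:R - s)).

Definition riesz_kappa : R :=
  pi `^ (s - d%:R / 2) * Gamma ((d%:R - s) / 2) / Gamma (s / 2).

(* The mean over the torus of the periodic Riesz kernel of Z^d times
   1 - cos(2 pi <x, w>). *)
Definition riesz_pair (w : 'cV[int]_d) : R :=
  riesz_mean - riesz_kappa * (enorm (intv w) `^ (d%:R - s))^-1.

Local Notation F := (periodic_riesz (1%:M : 'M[R]_d) s).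

Lemma periodic_riesz1 x : F x = (large_t_part s x + small_t_part s x)%E.
Proof.
rewrite /periodic_riesz /covolume det1 normr1 invr1 mul1e.
by [].
Qed.

(** The integrals over [0, 1] and [1, +oo) recombine by [inv_gammaD] at c = pi^2 |w|^2 into c^(-a)
    Gamma(a), where c^(-a) = pi^(s-d) |w|^(s-d). *)
Lemma riesz_pairE w : w != 0 ->
  riesz_pair w = gamma * large_t_val s w - small_t_coef s w.
Proof.
move=> w0; have q0 : 0 < qform w by apply: lt_le_trans (dotp_intv_ge1 R w0).
have c0 : 0 < pi ^+ 2 * qform w by rewrite mulr_gt0 ?exprn_gt0 ?pi_gt0.
have := inv_gammaD a0 c0; set I0 := inv_gamma01 _ _; set I1 := inv_gamma1y _ _ => I01.
have e0 : 0 <= enorm (intv w) by exact: sqrtr_ge0.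
have cE : (pi ^+ 2 * qform w) `^ (- a) = pi `^ (s - d%:R) * (enorm (intv w) `^ (d%:R - s))^-1.
  have -> : qform w = enorm (intv w) ^+ 2 by rewrite enorm_sqr.
  rewrite (powRM _ (exprn_ge0 2 (pi_ge0 R)) (exprn_ge0 2 e0)).
  rewrite -(powR_mulrn 2 (pi_ge0 R)) -(powR_mulrn 2 e0) -!powRrM -powRN.
  by congr (_ `^ _ * _ `^ _); rewrite /a; field.
have piE : pi `^ (s - d%:R / 2) = pi `^ (d%:R / 2) * pi `^ (s - d%:R) :> R.
  rewrite -powRD; last by rewrite (gt_eqF (pi_gt0 R)) implybT.
  by congr (_ `^ _); field.
rewrite /riesz_pair /riesz_kappa /riesz_mean /large_t_val /small_t_coef.
rewrite -/a -/I0 -/I1 -/gamma.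
have -> : gamma * (pi `^ (d%:R / 2) * (a^-1 - I1)) - gamma * pi `^ (d%:R / 2) * I0 =
  gamma * pi `^ (d%:R / 2) * (a^-1 - (I0 + I1)) by ring.
rewrite I01 cE piE invfM -/gamma.
have -> : a^-1 = 2 / (d%:R - s) by rewrite /a invf_div.
by ring.
Qed.

Lemma periodic_riesz_bound w (e : R) : w != 0 -> 0 < e -> exists M0 : nat,
  forall M, (M0 <= M)%N -> (0 < M)%N -> forall b : {ffun 'I_d -> 'I_M},
  (\sum_(b' : {ffun 'I_d -> 'I_M})
    ((M%:R ^+ d)^-1 *
      (1 - cos (2 * pi * dotp (gridpt R b - gridpt R b') (intv w))))%:E *
    F (gridpt R b - gridpt R b') <= (riesz_pair w + (gamma + 1) * e)%:E)%E.
Proof.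
move=> w0 e0.
have [M1 H1] := large_t_part_bound d0 sd w0 e0.
have [M2 H2] := small_t_part_bound d0 sd w0 e0.
exists (maxn M1 M2) => M; rewrite geq_max => /andP[M1M M2M] Mpos b.
have := leeD (H1 M M1M Mpos b) (H2 M M2M Mpos b).
rewrite -big_split/= -EFinD.
set r1 := (X in (_ <= X%:E)%E -> _) => Hle.
apply: (@le_trans _ _ r1%:E); last first.
  by rewrite lee_fin riesz_pairE// /r1 /gamma; lra.
apply: le_trans Hle; apply: lee_sum => b' _.
have cf : 0 <= (M%:R ^+ d)^-1 *
    (1 - cos (2 * pi * dotp (gridpt R b - gridpt R b') (intv w))).
  by rewrite mulr_ge0 ?invr_ge0 ?exprn_ge0// subr_ge0 cos_le1.
rewrite periodic_riesz1 muleDr//.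
by rewrite fin_num_adde_defl// small_t_part_fin.
Qed.

Lemma periodic_riesz_ge x : ((- small_t_cst d s)%:E <= F x)%E.
Proof.
rewrite periodic_riesz1 -[X in (X <= _)%E]add0e leeD ?large_t_part_ge0//.
exact: small_t_part_ge.
Qed.

(** Finiteness off the diagonal is extracted from [large_t_part_bound] with w a unit vector: if [b]
    and [b'] differ in coordinate [i], the weight 1 - cos is positive there, so a finite average
    forces a finite value. *)
Lemma grid_periodic_riesz_fin : exists M0 : nat,
  forall M, (M0 <= M)%N -> (0 < M)%N -> forall b b' : {ffun 'I_d -> 'I_M},
  b != b' -> F (gridpt R b - gridpt R b') \is a fin_num.
Proof.
have [|M0 HM0] := @eventually_forall 'I_d (fun i M => (0 < M)%N ->
  forall b : {ffun 'I_d -> 'I_M},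
  (\sum_(b' : {ffun 'I_d -> 'I_M})
    ((M%:R ^+ d)^-1 *
      (1 - cos (2 * pi * dotp (gridpt R b - gridpt R b')
         (intv (delta_mx i 0 : 'cV[int]_d)))))%:E *
    large_t_part s (gridpt R b - gridpt R b') <
  +oo)%E).
  move=> i; have i0 : (delta_mx i 0 : 'cV[int]_d) != 0.
    apply/eqP => /colP /(_ i); rewrite !mxE !eqxx => /eqP; by [].
  have [M0 HM0] := large_t_part_bound d0 sd i0 ltr01.
  exists M0 => M M0M Mpos b; apply: le_lt_trans (HM0 M M0M Mpos b) _.
  by rewrite ltry.
exists M0 => M M0M Mpos b b' bb'.
have [i bi] : exists i, b i != b' i.
  by apply/existsP; rewrite -negb_forall; apply: contra bb' => /forallP bb';
    apply/eqP/ffunP => i; apply/eqP.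
have := HM0 M M0M i Mpos b.
rewrite (bigD1 b')//= => /(le_lt_trans _) H.
have {H} : ((((M%:R ^+ d)^-1 *
      (1 - cos (2 * pi * dotp (gridpt R b - gridpt R b')
         (intv (delta_mx i 0 : 'cV[int]_d)))))%:E *
    large_t_part s (gridpt R b - gridpt R b')) < +oo)%E.
  apply: H; rewrite leeDl//; apply: sume_ge0 => c _.
  by rewrite mule_ge0 ?large_t_part_ge0// lee_fin mulr_ge0 ?invr_ge0 ?exprn_ge0//
    subr_ge0 cos_le1.
set k := (_ * _)%R => H.
have k0 : 0 < k.
  rewrite mulr_gt0 ?invr_gt0 ?exprn_gt0 ?ltr0n// subr_gt0.
  have -> : dotp (gridpt R b - gridpt R b') (intv (delta_mx i 0)) =
     ((b i)%:R - (b' i)%:R) / M%:R.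
    rewrite /dotp (bigD1 i)//= big1 ?addr0 => [|j /negPf ji].
      by rewrite !mxE !eqxx/= mulr1 mulrBl.
    by rewrite !mxE ji/= mulr0.
  wlog lt : b b' {bb' H k} bi / (b' i < b i)%N => [wl|].
    have : (b i : nat) != b' i by [].
    rewrite neq_ltn => /orP[lt|lt]; last exact: wl.
    rewrite -cosN -mulrN -mulNr opprB; apply: wl => //.
    by rewrite eq_sym.
  rewrite -natrB ?(ltnW lt)//; apply: cos_ratio_lt1.
  by rewrite subn_gt0 lt/= (leq_ltn_trans (leq_subr _ _)).
have L0 := large_t_part_ge0 s (gridpt R b - gridpt R b').
have Sf := small_t_part_fin d0 sd (gridpt R b - gridpt R b').
rewrite periodic_riesz1 fin_numD Sf andbT ge0_fin_numE//.
move: H; case: (large_t_part _ _) L0 => [r _ _|//|//]; first by rewrite ltry.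
by rewrite gt0_muley ?lte_fin.
Qed.

(** Excludes the value -oo, so that [fine] is faithful in the asymptotic hypothesis. *)
Lemma min_riesz_energy_ge N : exists B : R,
  (B%:E <= min_riesz_energy (1%:M : 'M[R]_d) s N)%E.
Proof.
exists (\sum_(k < N) \sum_(j < N | j != k) - small_t_cst d s).
apply: le_ereal_inf_tmp => _ [x _ <-]; rewrite -sumEFin.
apply: lee_sum => k _; rewrite -sumEFin; apply: lee_sum => j _.
exact: periodic_riesz_ge.
Qed.

Let phi M N (W : 'I_N -> 'cV[int]_d) (i : 'I_N) (b : {ffun 'I_d -> 'I_M}) : R[i] :=
  expi (2 * pi * dotp (gridpt R b) (intv (W i))).

Let phiM M N (W : 'I_N -> 'cV[int]_d) i j (b : {ffun 'I_d -> 'I_M}) :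
  phi W i b * (phi W j b)^* = expi (2 * pi * dotp (gridpt R b) (intv (W i - W j))).
Proof.
rewrite /phi -expiN -expiD /intv map_mxB dotpBr; congr expi; ring.
Qed.

Lemma min_riesz_energy_le N (W : 'I_N -> 'cV[int]_d) : injective W ->
  (min_riesz_energy (1%:M : 'M[R]_d) s N <=
    (\sum_i \sum_(j | j != i) riesz_pair (W i - W j))%:E)%E.
Proof.
move=> Winj; apply/lee_addgt0Pr => e e0.
(* At most N^2 pairs lose [(gamma + 1) * e'] each, for a total of at most [e]; the two [+ 1] keep
   the denominator positive. *)
pose e' := e / ((gamma + 1) * (N%:R ^+ 2 + 1)).
have N1 : 0 < N%:R ^+ 2 + 1 :> R by rewrite ltr_wpDl// exprn_ge0.
have g1 : 0 < gamma + 1 by rewrite ltr_wpDl.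
have e'0 : 0 < e' by rewrite divr_gt0// mulr_gt0.
have [|M1 HM1] := @eventually_forall ('I_N * 'I_N)%type (fun p M => p.1 != p.2 ->
  (0 < M)%N -> forall b : {ffun 'I_d -> 'I_M},
  (\sum_(b' : {ffun 'I_d -> 'I_M})
    ((M%:R ^+ d)^-1 *
      (1 - cos (2 * pi * dotp (gridpt R b - gridpt R b') (intv (W p.1 - W p.2)))))%:E *
    F (gridpt R b - gridpt R b') <=
    (riesz_pair (W p.1 - W p.2) + (gamma + 1) * e')%:E)%E).
  move=> [i j] /=; have [ij|ij] := boolP (i == j); first by exists 0%N.
  have Wij : W i - W j != 0.
    by rewrite subr_eq0; apply: contra ij => /eqP /Winj ->.
  have [M0 HM0] := periodic_riesz_bound Wij e'0.
  by exists M0 => M M0M _ Mpos b; exact: HM0.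
have [M2 HM2] := grid_periodic_riesz_fin.
(* For M beyond the coordinates of all differences, the frequencies stay distinct mod M, so their
   characters are orthogonal on the grid. *)
have [|M3 HM3] := @eventually_forall ('I_N * 'I_N)%type (fun p M => p.1 != p.2 ->
  dvdv M (W p.1 - W p.2) = false).
  move=> [i j] /=; exists (\max_l `|((W i - W j) l 0)%R|)%N.+1 => M; rewrite ltnNge.
  move=> /negP M3M ij; apply/negP => /forallP dv; apply: M3M.
  have Wij : W i - W j != 0.
    by rewrite subr_eq0; apply: contra ij => /eqP /Winj ->.
  have [l Wl] : exists l, (W i - W j) l 0 != 0.
    apply: contrapT => /forallNP H; move/eqP : Wij; apply; apply/colP => l.
    by apply/eqP; rewrite [X in _ == X]mxE; apply/negPn/negP => /H.
  apply: leq_trans (leq_bigmax l); have := dv l; rewrite /dvdz/= => /dvdn_leq.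
  by apply; rewrite lt0n absz_eq0.
pose M := maxn (maxn M1 M2) (maxn M3 1).
have M1M : (M1 <= M)%N by rewrite /M; lia.
have M2M : (M2 <= M)%N by rewrite /M; lia.
have M3M : (M3 <= M)%N by rewrite /M; lia.
have Mpos : (0 < M)%N by rewrite /M; lia.
have {}HM1 i j := HM1 M M1M (i, j); have {}HM2 := HM2 M M2M Mpos.
have {}HM3 i j := HM3 M M3M (i, j).
move: M Mpos HM1 HM2 HM3 {M1M M2M M3M} => M Mpos HM1 HM2 HM3.
have Md : 0 < M%:R ^+ d :> R by rewrite exprn_gt0// ltr0n.
pose c : R[i] := (M ^ d)%:R.
have c0 : 0 < c by rewrite ltr0n expn_gt0 Mpos.
have orth i j : \sum_(b : {ffun 'I_d -> 'I_M}) phi W i b * (phi W j b)^* = c *+ (i == j).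
  under eq_bigr do rewrite phiM.
  rewrite sum_grid_expi//; congr (_ *+ nat_of_bool _).
  have [->|ij] := eqVneq i j; last exact: HM3.
  by rewrite subrr; apply/forallP => l; rewrite mxE dvdz0.
(* Real values are needed, so the infinite diagonal is replaced by 0. This is harmless twice: the
   configuration found is injective, and 1 - cos vanishes on the diagonal of the averages. *)
pose g (b b' : {ffun 'I_d -> 'I_M}) : R :=
  if b == b' then 0 else fine (F (gridpt R b - gridpt R b')).
have [|x xinj] := @determinantal_energy R[i] _ N (phi W) c c0 orth
   (fun b b' => (g b b')%:C%C).
  by move=> b b'; rewrite complex_real.
set lhs := (X in X <= _); set rhs := (X in _ <= X) => le_x.
have xinj' k l : l != k -> x k != x l by move=> lk; apply: contra lk => /eqP /xinj ->.
apply: (@le_trans _ _ (riesz_energy (1%:M : 'M[R]_d) s (fun k => gridpt R (x k)))).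
  by apply: ereal_inf_lbound; exists (fun k => gridpt R (x k)).
have -> : riesz_energy (1%:M : 'M[R]_d) s (fun k => gridpt R (x k)) =
    (complex.Re lhs)%:E.
  have -> : complex.Re lhs = \sum_k \sum_(l | l != k) g (x k) (x l).
    rewrite /lhs (raddf_sum (@complex.Re R)); apply: eq_bigr => k _.
    by rewrite (raddf_sum (@complex.Re R)).
  rewrite -sumEFin; apply: eq_bigr => k _; rewrite -sumEFin; apply: eq_bigr => l lk.
  by rewrite /g (negPf (xinj' _ _ lk)) fineK// HM2// xinj'.
rewrite -EFinD lee_fin.
have {}le_x : complex.Re lhs <= complex.Re rhs by move: le_x; rewrite lecE => /andP[].
apply: (le_trans le_x).
have -> : complex.Re rhs = \sum_i \sum_(j | j != i)
    (M%:R ^+ d)^-1 * \sum_(b : {ffun 'I_d -> 'I_M})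
      \sum_(b' : {ffun 'I_d -> 'I_M}) (M%:R ^+ d)^-1 *
      (1 - cos (2 * pi * dotp (gridpt R b - gridpt R b') (intv (W i - W j)))) * g b b'.
  have ReM (r : R) (z : R[i]) : complex.Re (r%:C%C * z) = r * complex.Re z.
    by case: z => u v /=; rewrite mul0r subr0.
  have cE : c ^- 2 = ((M%:R ^+ d) ^- 2)%:C%C.
    by rewrite /c natrX fmorphV !rmorphXn/= rmorph_nat.
  rewrite /rhs cE ReM (raddf_sum (@complex.Re R)) mulr_sumr.
  apply: eq_bigr => i _; rewrite (raddf_sum (@complex.Re R)) mulr_sumr.
  apply: eq_bigr => j _; rewrite (raddf_sum (@complex.Re R)) !mulr_sumr.
  apply: eq_bigr => b _; rewrite (raddf_sum (@complex.Re R)) !mulr_sumr.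
  apply: eq_bigr => b' _; rewrite !phiM !subrr.
  rewrite [X in _ * X](ReM (g b b')).
  have -> : intv 0 = 0 by apply/colP => l; rewrite !mxE.
  have d00 y : dotp y (0 : 'cV[R]_d) = 0.
    by rewrite /dotp big1// => l _; rewrite mxE mulr0.
  rewrite !d00 !mulr0 !expi0 mul1r.
  have -> : intv (W j - W i) = - intv (W i - W j) by rewrite /intv -map_mxN opprB.
  rewrite -expiD [dotp (gridpt R b') _]dotpC dotpNl dotpC.
  rewrite (_ : 2 * pi * dotp (intv (W i - W j)) (gridpt R b) +
     2 * pi * - dotp (intv (W i - W j)) (gridpt R b') =
     2 * pi * dotp (gridpt R b - gridpt R b') (intv (W i - W j))); last first.
    by rewrite dotpBl !(dotpC (intv _)); ring.
  rewrite -[complex.Re (_ - _)]/(1 - cos _) -exprVn; ring.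
apply: (@le_trans _ _ (\sum_i \sum_(j | j != i)
   (riesz_pair (W i - W j) + (gamma + 1) * e'))).
  apply: ler_sum => i _; apply: ler_sum => j ji.
  rewrite ler_pdivrMl//.
  have ij : i != j by rewrite eq_sym.
  have row b : \sum_(b' : {ffun 'I_d -> 'I_M}) (M%:R ^+ d)^-1 *
      (1 - cos (2 * pi * dotp (gridpt R b - gridpt R b') (intv (W i - W j)))) * g b b'
      <= riesz_pair (W i - W j) + (gamma + 1) * e'.
    rewrite -lee_fin; apply: le_trans (HM1 i j ij Mpos b); rewrite -sumEFin.
    apply: lee_sum => b' _; rewrite EFinM /g.
    have [->|bb'] := eqVneq b b'; last by rewrite fineK// HM2.
    rewrite [X in cos X](_ : _ = 0) ?cos0 ?subrr ?mulr0 ?mul0e//.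
    by rewrite /dotp big1 ?mulr0// => l _; rewrite mxE mul0r.
  apply: le_trans (ler_sum _ (fun b _ => row b)) _.
  by rewrite sumr_const card_ffun !card_ord -[leLHS]mulr_natl natrX.
under eq_bigr do rewrite big_split/=.
rewrite big_split/= lerD2l.
have x0 : 0 <= (gamma + 1) * e' by rewrite mulr_ge0// ltW.
apply: (@le_trans _ _ (\sum_(i < N) \sum_(j < N) (gamma + 1) * e')).
  by apply: ler_sum => i _; rewrite big_mkcond; apply: ler_sum => j _; case: ifP.
rewrite !sumr_const !card_ord -mulrnA -[leLHS]mulr_natr natrM -expr2.
have -> : (gamma + 1) * e' = e / (N%:R ^+ 2 + 1).
  by rewrite /e'; field; rewrite !gt_eqF.
by rewrite mulrAC ler_pdivrMr// ler_wpM2l ?(ltW e0)// lerDl.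
Qed.

End energy_bound.

(** * Cells of an open set and the Riesz integral *)

Section product_sets.
Variable R : realType.

Lemma measurable_prod_set n (J : 'I_n -> set R) :
  (forall i, measurable (J i)) ->
  measurable [set x : 'cV[R]_n | forall i, J i (x i 0)].
Proof.
move=> mJ; rewrite (_ : mkset _ =
    \bigcap_(i in [set: 'I_n]) (@cV_coord _ R n i @^-1` J i)).
  apply: fin_bigcap_measurable => // i _.
  rewrite -[X in measurable X]setTI.
  exact: (@measurable_cV_coord _ R n i).
by apply/seteqP; split=> x /= xJ i; have := xJ i => //; apply.
Qed.

(** Same induction as for closed boxes, for arbitrary measurable sides: the cells below are
    half-open. *)
Lemma lebesgue_cV_prod n (J : 'I_n -> set R) (l : 'I_n -> R) :
  (forall i, measurable (J i)) ->
  (forall i, lebesgue_measure (J i) = (l i)%:E) ->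
  lebesgue_cV R n [set x : 'cV[R]_n | forall i, J i (x i 0)] = (\prod_i l i)%:E.
Proof.
elim: n J l => [|n IHn] J l mJ Jl.
  by rewrite big_ord0 /= diracE mem_set//= => -[].
rewrite /= /lebesgue_cV_step /pushforward big_ord_recl.
have -> : @consV R n @^-1` [set x : 'cV[R]_n.+1 | forall i, J i (x i 0)] =
    J ord0 `*` [set x : 'cV[R]_n | forall i, J (lift ord0 i) (x i 0)].
  apply/seteqP; split => [p Bp|p [/= p1 p2] i].
    split; first by have := Bp 0; rewrite consV0.
    by move=> i; have := Bp (lift ord0 i); rewrite consVS.
  by have [j ->|->] := unliftP ord0 i; rewrite ?consVS ?consV0.
rewrite product_measure1E; first last.
- exact: (@measurable_prod_set _ (fun i => J (lift ord0 i))).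
- exact: mJ.
rewrite EFinM; congr (_ * _)%E; first exact: Jl.
exact: (IHn (fun i => J (lift ord0 i)) (fun i => l (lift ord0 i))).
Qed.

End product_sets.

Section cells.
Variables (R : realType) (d : nat).

(** Half-open sides make the cells a partition of R^d, with [cellidx] as index map; the mesh is
    1/(m+1) so that it is defined for every m. *)
Definition cell_side (m : nat) (w : 'cV[int]_d) (i : 'I_d) : set R :=
  `[(w i 0)%:~R / m.+1%:R, ((w i 0)%:~R + 1) / m.+1%:R[%classic.

Definition cell (m : nat) (w : 'cV[int]_d) : set 'cV[R]_d :=
  [set x | forall i, cell_side m w i (x i 0)].

Definition cellidx (m : nat) (x : 'cV[R]_d) : 'cV[int]_d :=
  \col_i Num.floor (m.+1%:R * x i 0).

Lemma cellP m w x : cell m w x <-> w = cellidx m x.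
Proof.
have m0 : 0 < m.+1%:R :> R by [].
split=> [xw|->] /=.
  apply/colP => i; rewrite mxE; have := xw i; rewrite /cell_side /= in_itv/=.
  rewrite ler_pdivrMr// ltr_pdivlMr// mulrC => H.
  by apply/esym/floor_def; rewrite intrD.
move=> i; rewrite /cell_side /= in_itv/= !mxE ler_pdivrMr// ltr_pdivlMr// ![x i 0 * _]mulrC.
by rewrite floor_le_tmp -intrD1 floorD1_gt.
Qed.

Lemma measurable_cell m w : measurable (cell m w).
Proof. by apply: (measurable_prod_set (J := cell_side m w)) => i; exact: measurable_itv. Qed.

Lemma lebesgue_cell m w : lebesgue_cV R d (cell m w) = ((m.+1%:R ^+ d)^-1)%:E.
Proof.
rewrite (@lebesgue_cV_prod _ _ (cell_side m w) (fun=> m.+1%:R^-1)).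
- by rewrite prodr_const card_ord exprVn.
- by move=> i; exact: measurable_itv.
move=> i; rewrite /cell_side lebesgue_measure_itv/= lte_fin ltr_pM2r ?invr_gt0// ltrDl ltr01.
by rewrite -EFinD -mulrBl addrAC subrr add0r mul1r.
Qed.

Lemma open_cV_ball (D : set 'cV[R]_d) x : open D -> D x ->
  exists2 r : R, 0 < r & forall y : 'cV[R]_d,
    (forall i, `|x i 0 - y i 0| < r) -> D y.
Proof.
move=> oD Dx; have := open_nbhs_nbhs (conj oD Dx).
move=> /nbhs_ballP[r r0 rD]; exists r => // y xy; apply: rD; split=> // i j.
by rewrite (ord1 j); exact: xy.
Qed.

Lemma cell_cellidx_near m x y : cell m (cellidx m x) y ->
  forall i, `|x i 0 - y i 0| < m.+1%:R^-1.
Proof.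
have m0 : 0 < m.+1%:R :> R by [].
move=> yc i; have /(_ m (cellidx m x) x) [_ /(_ erefl) xc] := cellP.
have := yc i; have := xc i; rewrite /cell_side /= !in_itv/= mulrDl mul1r.
set A := (_ / _); set B := m.+1%:R^-1; move: A B => A B /andP[? ?] /andP[? ?].
by rewrite ltr_norml; apply/andP; split; lra.
Qed.

Lemma cellidx_sub_open (D : set 'cV[R]_d) x : open D -> D x ->
  \forall m \near \oo, cell m (cellidx m x) `<=` D.
Proof.
move=> oD Dx; have [r r0 rD] := open_cV_ball oD Dx.
near=> m => y /cell_cellidx_near yx; apply: rD => i.
apply: lt_trans (yx i) _; near: m.
exact: near_infty_natSinv_lt (PosNum r0).
Unshelve. all: by end_near. Qed.

Lemma cvg_cellidx x i : (cellidx m x i 0)%:~R / m.+1%:R @[m --> \oo] --> x i 0.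
Proof.
apply: (@squeeze_cvgr _ _ _ _ (fun m => x i 0 - m.+1%:R^-1) (cst (x i 0))).
- apply: nearW => m; have /(_ m (cellidx m x) x) [_ /(_ erefl) /(_ i)] := cellP.
  rewrite /cell_side /= in_itv/= mulrDl mul1r => /andP[? ?]; apply/andP; split => //.
  by rewrite lerBlDr ltW.
- rewrite -[X in _ --> X]subr0; apply: cvgB; first exact: cvg_cst.
  exact: cvg_harmonic.
- exact: cvg_cst.
Qed.

Lemma cvg_enorm_cellidx x y :
  enorm (m.+1%:R^-1 *: (intv R (cellidx m x) - intv R (cellidx m y))) @[m --> \oo]
    --> enorm (x - y).
Proof.
pose z m : 'cV[R]_d := m.+1%:R^-1 *: (intv R (cellidx m x) - intv R (cellidx m y)).
have zi i : z m i 0 @[m --> \oo] --> (x - y) i 0.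
  have -> : (fun m => z m i 0) = (fun m => (cellidx m x i 0)%:~R / m.+1%:R -
      (cellidx m y i 0)%:~R / m.+1%:R).
    by apply/funext => m; rewrite /z 6!mxE mulrBr ![_^-1 * _]mulrC.
  by rewrite !mxE; apply: cvgB; exact: cvg_cellidx.
have : dotp (z m) (z m) @[m --> \oo] --> dotp (x - y) (x - y).
  by apply: (cvg_big (@add_continuous R^o)) => i _; apply: cvgM; exact: zi.
by move=> H; exact: (cvg_comp _ _ H (@sqrt_continuous R _)).
Qed.

End cells.

Section cells_of_open_set.
Variables (R : realType) (d : nat) (D : set 'cV[R]_d).
Hypotheses (d0 : (0 < d)%N) (oD : open D) (bD : bounded_set D).
Local Notation box L := {ffun 'I_d -> 'I_L.*2.+1}.

Lemma bounded_coord : exists B : nat, forall x, D x -> forall i, `|x i 0| <= B%:R.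
Proof.
have [M [_ HM]] := bD.
exists (Num.truncn (`|M| + 1)).+1 => x Dx i.
have : `|x| <= `|M| + 1 by apply: HM => //; have := ler_norm M; lra.
have /andP[_ /ltW] := truncn_itv (addr_ge0 (normr_ge0 M) ler01).
move=> h1 h2; apply: le_trans (le_trans h2 h1).
rewrite [leRHS]mx_normrE.
exact: (le_bigmax_cond 0 (fun ij : 'I_d * 'I_1 => `|x ij.1 ij.2|) (j := (i, 0))).
Qed.

Lemma cellidx_box (B m : nat) (x : 'cV[R]_d) : (forall i, `|x i 0| <= B%:R) ->
  exists k : box (m.+1 * B.+1), cellidx m x = boxpt k.
Proof.
move=> xB; apply/boxptP/forallP => i; rewrite mxE.
have m0 : 0 < m.+1%:R :> R by [].
have : `|m.+1%:R * x i 0| <= (m.+1 * B)%:R.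
  by rewrite normrM ger0_norm// natrM ler_pM2l.
rewrite ler_norml => /andP[h1 h2].
have f1 : Num.floor (m.+1%:R * x i 0) <= (m.+1 * B)%:Z.
  by rewrite -(ler_int R); apply: le_trans (floor_le_tmp _) h2.
have f2 : - (m.+1 * B)%:Z <= Num.floor (m.+1%:R * x i 0).
  by rewrite floor_ge_int_tmp rmorphN.
rewrite mulnS; lia.
Qed.

Lemma inner_cells (m : nat) : exists2 r : seq 'cV[int]_d, uniq r &
  forall w, (w \in r) <-> cell m w `<=` D.
Proof.
have [B HB] := bounded_coord.
exists [seq boxpt k | k <- enum [pred k : box (m.+1 * B.+1) |
    `[< @cell R d m (boxpt k) `<=` D >]]].
  by rewrite map_inj_uniq ?enum_uniq//; exact: boxpt_inj.
move=> w; split => [/mapP[k + ->]|wD].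
  by rewrite mem_enum inE => /asboolP/asboolP.
(* The corner belongs to its half-open cell, hence to the bounded set [D], which confines [w] to a
   finite box. *)
pose x : 'cV[R]_d := \col_i ((w i 0)%:~R / m.+1%:R).
have xw : cell m w x.
  move=> i; rewrite /cell_side /= in_itv/= mxE lexx/= ltr_pM2r ?invr_gt0//.
  by rewrite ltrDl.
have [k wk] := cellidx_box m (HB _ (wD _ xw)).
have wk' : w = boxpt k by rewrite -wk; exact/cellP.
apply/mapP; exists k => //; rewrite mem_enum inE; do 2!apply/asboolP.
by rewrite -wk'.
Qed.

Variables (r : nat -> seq 'cV[int]_d).
Hypotheses (ur : forall m, uniq (r m)).
Hypothesis rP : forall m w, (w \in r m) <-> cell m w `<=` D.

(** The sigma-algebra is generated by the coordinates, not by the open sets; but every point of [D]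
    lies in some inner cell, so [D] is a countable union of cells. *)
Lemma open_cV_measurable : measurable D.
Proof.
rewrite (_ : D = \bigcup_m \bigcup_(w in [set` r m]) cell m w); last first.
  apply/seteqP; split=> [x Dx|x [m _ [w /= /rP wD] xw]]; last exact: wD.
  have [m _ Hm] := cellidx_sub_open oD Dx.
  exists m => //; exists (cellidx m x); last exact/cellP.
  by apply/rP; apply: Hm => /=.
apply: bigcupT_measurable => m; apply: fin_bigcup_measurable; first exact: finite_seq.
by move=> w _; exact: measurable_cell.
Qed.

Lemma size_inner_cells m (mu : {measure set 'cV[R]_d -> \bar R}) (c : R) :
  (forall w, mu (cell m w) = c%:E) -> (((size (r m))%:R * c)%:E <= mu D)%E.
Proof.
move=> mc.
have E : mu (\bigcup_(w in [set` r m]) cell m w) = ((size (r m))%:R * c)%:E.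
  rewrite measure_fin_bigcup//.
  - rewrite -fsbig_seq// (eq_bigr (fun=> c%:E)) => [|w _]; last exact: mc.
    by rewrite sumEFin big_const_seq count_predT iter_addr_0 mulr_natl.
  - exact: finite_seq.
  - move=> w w' _ _ [x [xw xw']]; have /cellP -> := xw.
    by have /cellP -> := xw'.
  - by move=> w _; exact: measurable_cell.
rewrite -E; apply: le_measure; rewrite ?inE.
- apply: fin_bigcup_measurable; first exact: finite_seq.
  by move=> w _; exact: measurable_cell.
- exact: open_cV_measurable.
- by move=> x [w /= /rP wD /wD].
Qed.

(** A row of [N0] adjacent cells along the first axis, starting at the cell of a point of [D], stays
    within (N0+1)/(m+1) of that point, hence in [D] for large m. *)
Lemma size_inner_cells_infty : D !=set0 ->
  forall N0, \forall m \near \oo, (N0 <= size (r m))%N.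
Proof.
move=> [x0 Dx0] N0; have [e e0 eD] := open_cV_ball oD Dx0.
near=> m.
have me : N0.+1%:R / m.+1%:R < e.
  rewrite ltr_pdivrMr// mulrC -ltr_pdivrMr//.
  apply: lt_trans (_ : m%:R < _); last by rewrite ltr_nat.
  by near: m; exact: nbhs_infty_gtr.
pose i0 := Ordinal d0.
pose v (j : nat) : 'cV[int]_d := cellidx m x0 + (delta_mx i0 0 *+ j).
have vr (j : 'I_N0) : v j \in r m.
  apply/rP => y yv; apply: eD => i.
  have m0 : 0 < m.+1%:R :> R by [].
  have := yv i; have [_ /(_ erefl) /(_ i)] := cellP m (cellidx m x0) x0.
  rewrite /cell_side /= !in_itv/= /v !mxE mulmxnE intrD.
  set c : int := delta_mx i0 0 i 0 *+ j.
  have /andP[c0 cN] : (0 <= c%:~R :> R) && (c%:~R <= N0%:R :> R).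
    have -> : c = ((i == i0) * j)%N%:Z.
      by rewrite /c !mxE eqxx andbT; case: (i == i0); rewrite ?mul0rn ?mul1n ?natz.
    rewrite -pmulrn ler0n ler_nat; case: (i == i0) => //=.
    by rewrite mul1n ltnW.
  rewrite -(ltr_pM2r m0) mulrVK ?unitfE ?gt_eqF// in me.
  rewrite !ler_pdivrMr// !ltr_pdivlMr// => /andP[a1 a2] /andP[b1 b2].
  rewrite -(ltr_pM2r m0) -[X in _ * X]gtr0_norm// -normrM mulrBl.
  move: me; rewrite -natr1 => me.
  by apply: le_lt_trans me; rewrite ler_norml; apply/andP; split; lra.
have vinj : injective (fun j : 'I_N0 => v j).
  move=> j k /addrI /colP /(_ i0); rewrite !mulmxnE !mxE eqxx/= => jk; apply: val_inj.
  by move/eqP: jk; rewrite eqr_nat => /eqP.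
rewrite -[N0]card_ord cardE -(size_map (fun j : 'I_N0 => v j)).
apply: uniq_leq_size; first by rewrite map_inj_uniq// enum_uniq.
by move=> w /mapP[j _ ->]; exact: vr.
Unshelve. all: by end_near. Qed.

End cells_of_open_set.

Section energy_of_frequencies.
Variables (R : realType) (d : nat) (s : R).
Hypotheses (d0 : (0 < d)%N) (s0 : 0 < s) (sd : s < d%:R).

Definition freq_energy (r : seq 'cV[int]_d) : R :=
  \sum_(w <- r) \sum_(w' <- r) (enorm (intv R (w - w')) `^ (d%:R - s))^-1.

(** The mean is counted N^2 times instead of N(N-1) times, which only enlarges the bound as
    [riesz_mean] is nonnegative. *)
Lemma min_riesz_energy_le_seq (r : seq 'cV[int]_d) : uniq r ->
  (min_riesz_energy (1%:M : 'M[R]_d) s (size r) <=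
    (riesz_mean d s * (size r)%:R ^+ 2 - riesz_kappa d s * freq_energy r)%:E)%E.
Proof.
move=> ur; pose W (i : 'I_(size r)) := nth 0 r i.
have Winj : injective W.
  by move=> i j /eqP; rewrite /W nth_uniq// => /eqP/val_inj.
apply: le_trans (min_riesz_energy_le d0 s0 sd Winj) _; rewrite lee_fin.
have V0 : 0 <= riesz_mean d s.
  rewrite /riesz_mean; apply: divr_ge0; last by rewrite mulr_ge0 ?Gamma_ge0// subr_ge0 ltW.
  by rewrite mulr_ge0// powR_ge0.
have e0 : (enorm (intv R (0 : 'cV[int]_d)) `^ (d%:R - s))^-1 = 0.
  have -> : enorm (intv R (0 : 'cV[int]_d)) = 0.
    rewrite /enorm /dotp big1 ?sqrtr0// => i _.
    by rewrite !mxE mulr0.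
  by rewrite powR0 ?invr0// gt_eqF// subr_gt0.
have -> : freq_energy r = \sum_(i < size r) \sum_(j < size r | j != i)
    (enorm (intv R (W i - W j)) `^ (d%:R - s))^-1.
  rewrite /freq_energy (big_nth 0) big_mkord; apply: eq_bigr => i _.
  rewrite (big_nth 0) big_mkord (bigD1 i)//= subrr e0 add0r.
  by [].
have -> : riesz_mean d s * (size r)%:R ^+ 2 =
    \sum_(i < size r) \sum_(j < size r) riesz_mean d s.
  by rewrite !sumr_const card_ord -mulrnA -natrX mulr_natr.
rewrite mulr_sumr -sumrB; apply: ler_sum => i _.
rewrite /riesz_pair sumrB; apply: lerB; last by rewrite mulr_sumr.
by rewrite [leRHS](bigD1 i)//= lerDr.
Qed.

End energy_of_frequencies.

Lemma limn_einf_le_near (R : realType) (u : (\bar R)^nat) (b : \bar R) :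
  (\forall m \near \oo, (u m <= b)%E) -> (limn_einf u <= b)%E.
Proof.
move=> ub; rewrite limn_einf_lim; apply: lime_le; first exact: is_cvg_einfs.
apply: filterS ub => m; apply: le_trans.
by apply: ereal_inf_lbound; exists m => /=.
Qed.

Lemma big_uniq_pred1 (R : pzSemiRingType) (T : eqType) (r : seq T) (c : T) (F : T -> R) :
  uniq r -> c \in r -> \sum_(w <- r) F w * (w == c)%:R = F c.
Proof.
move=> ur cr; rewrite (bigD1_seq c)//= eqxx mulr1 big1 ?addr0// => w /negbTE ->.
by rewrite mulr0.
Qed.

(** * The Riesz integral against its Riemann sums *)

Section riesz_integral_step.
Variables (R : realType) (d : nat) (s : R) (A : 'M[R]_d) (D : set 'cV[R]_d).
Hypothesis oD : open D.
Variables (r : nat -> seq 'cV[int]_d).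
Hypotheses (ur : forall m, uniq (r m)).
Hypothesis rP : forall m w, (w \in r m) <-> @cell R d m w `<=` D.
Local Notation t := (d%:R - s).
Local Notation nu := (dual_measure A).

Lemma dual_measure_cell m w :
  nu (cell m w) = (covolume A * (m.+1%:R ^+ d)^-1)%:E.
Proof. by rewrite /dual_measure /mscale/= lebesgue_cell -EFinM. Qed.

Let coef m (w w' : 'cV[int]_d) : R :=
  (enorm (m.+1%:R^-1 *: (intv R w - intv R w')) `^ t)^-1.

(** The integrand sampled at the corners of pairs of inner cells. It converges at every point of
    [D]*[D], and Fatou's lemma asks for no majorant near the diagonal. *)
Let step m (p : 'cV[R]_d * 'cV[R]_d) : R :=
  \sum_(w <- r m) \sum_(w' <- r m) coef m w w' * \1_(cell m w `*` cell m w') p.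

Let coef_ge0 m w w' : 0 <= coef m w w'.
Proof. by rewrite invr_ge0 powR_ge0. Qed.

Let coefE m w w' :
  coef m w w' = m.+1%:R `^ t * (enorm (intv R (w - w')) `^ t)^-1.
Proof.
rewrite /coef; set v := intv R (w - w').
have -> : intv R w - intv R w' = v by apply/colP => i; rewrite !mxE rmorphB.
rewrite enormZ ger0_norm// powRM// ?sqrtr_ge0// invfM; congr (_ * _).
by rewrite -powR_inv1// -powRrM mulN1r -powRN opprK.
Qed.

Let stepE m p : cellidx m p.1 \in r m -> cellidx m p.2 \in r m ->
  step m p = coef m (cellidx m p.1) (cellidx m p.2).
Proof.
move=> h1 h2; rewrite /step.
have E w w' : \1_(cell m w `*` cell m w') p =
    (w == cellidx m p.1)%:R * (w' == cellidx m p.2)%:R :> R.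
  rewrite indicE -natrM mulnb; congr (_%:R); congr nat_of_bool.
  apply/idP/idP; rewrite in_setE.
    by move=> [/cellP -> /cellP ->]; rewrite !eqxx.
  by move=> /andP[/eqP -> /eqP ->]; split; exact/cellP.
under eq_bigr do under eq_bigr do rewrite E mulrA.
under eq_bigr do rewrite big_uniq_pred1//.
by rewrite big_uniq_pred1.
Qed.

Let cvg_step p : (D `*` D) p ->
  step m p @[m --> \oo] --> (enorm (p.1 - p.2) `^ t)^-1.
Proof.
move=> [Dx Dy].
have E : \forall m \near \oo, coef m (cellidx m p.1) (cellidx m p.2) = step m p.
  have hx := cellidx_sub_open oD Dx; have hy := cellidx_sub_open oD Dy.
  near=> m; rewrite stepE//; apply/rP.
  - by near: m.
  - by near: m.
apply: cvg_trans (near_eq_cvg E) _.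
(* On the diagonal the sampled value is constant in m and equal to the conventional value of the
   integrand; continuity of the power is only used at positive distance. *)
have [->|xy] := eqVneq p.1 p.2.
  rewrite /coef; under eq_cvg do rewrite subrr scaler0 -(subrr p.2).
  exact: cvg_cst.
apply: cvgV.
  by rewrite gt_eqF// powR_gt0// enorm_gt0 subr_eq0.
have e0 : 0 < enorm (p.1 - p.2) by rewrite enorm_gt0 subr_eq0.
have ct := is_derive_continuous_at (is_derive1_powR t e0).
apply: (@continuous_cvg _ _ _ _ _ _ (fun e : R => e `^ t)).
  exact: ct.
exact: cvg_enorm_cellidx.
Unshelve. all: by end_near. Qed.

Let mstep m : measurable_fun setT (step m).
Proof.
apply: measurable_sum => w; apply: measurable_sum => w'.
apply: measurable_funM => //; apply: measurable_indic.
by apply: measurableX; exact: measurable_cell.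
Qed.

Let integral_step m :
  (\int[nu \x nu]_(p in D `*` D) (step m p)%:E =
   (m.+1%:R `^ t * freq_energy s (r m) * (covolume A * (m.+1%:R ^+ d)^-1) ^+ 2)%:E)%E.
Proof.
have mD : measurable D by exact: (open_cV_measurable oD rP).
have mDD : measurable (D `*` D) by exact: measurableX.
have mc w w' : measurable (@cell R d m w `*` @cell R d m w').
  by apply: measurableX; exact: measurable_cell.
under eq_integral do rewrite /step -sumEFin.
rewrite ge0_integral_sum//; first last.
- move=> w p _; rewrite lee_fin sumr_ge0// => w' _.
  by rewrite mulr_ge0.
- move=> w; apply/measurable_EFinP/measurable_funTS; apply: measurable_sum => w'.
  by apply: measurable_funM => //; exact: measurable_indic.
rewrite /freq_energy mulr_sumr mulr_suml -sumEFin big_seq [RHS]big_seq.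
apply: eq_bigr => w wr.
under eq_integral do rewrite -sumEFin.
rewrite ge0_integral_sum//; first last.
- by move=> w' p _; rewrite lee_fin mulr_ge0.
- move=> w'; apply/measurable_EFinP/measurable_funTS.
  by apply: measurable_funM => //; exact: measurable_indic.
rewrite mulr_sumr mulr_suml -sumEFin big_seq [RHS]big_seq.
apply: eq_bigr => w' w'r.
rewrite (@integralZl_indic _ _ _ _ _ mDD (fun=> cell m w `*` cell m w'))//; last first.
  by move=> /lt_geF; rewrite coef_ge0.
rewrite integral_indic// setIidl; last first.
  by move=> p [/= p1 p2]; split; [apply: ((rP m w).1 wr)|apply: ((rP m w').1 w'r)].
rewrite [X in (_ * X)%E](_ : _ = nu (cell m w) * nu (cell m w'))%E; last first.
  by apply: product_measure1E; exact: measurable_cell.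
by rewrite !dual_measure_cell -!EFinM -expr2 coefE.
Qed.

Lemma riesz_integral_le_einf : (riesz_integral A D t <=
  limn_einf (fun m => (m.+1%:R `^ t * freq_energy s (r m) *
    (covolume A * (m.+1%:R ^+ d)^-1) ^+ 2)%:E))%E.
Proof.
have mD : measurable D by exact: (open_cV_measurable oD rP).
have mDD : measurable (D `*` D) by exact: measurableX.
rewrite /riesz_integral.
rewrite (eq_integral (fun p => limn_einf (fun m => (step m p)%:E))); last first.
  move=> p; rewrite inE => /cvg_step H.
  suff /cvg_limn_einf_sup[-> _] : (step m p)%:E @[m --> \oo] --> (enorm (p.1 - p.2) `^ t)^-1%:E by [].
  by apply: cvg_EFin; [exact: nearW|exact: H].
rewrite -(eq_fun integral_step).
apply: fatou => // [m|m p _].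
- exact/measurable_EFinP/measurable_funTS.
- rewrite lee_fin /step; do 2!apply: sumr_ge0 => ? _.
  by rewrite mulr_ge0.
Qed.

End riesz_integral_step.

(** * Comparison with the asymptotic expansion *)

Lemma freq_energy_near (R : realType) (d : nat) (s C : R)
    (r : nat -> seq 'cV[int]_d) (e : R) :
  (0 < d)%N -> 0 < s -> s < d%:R -> 0 < e ->
  ((fun N : nat => fine (min_riesz_energy (1%:M : 'M[R]_d) s N)) =
    (fun N : nat => riesz_mean d s * N%:R ^+ 2 + C * N%:R `^ (1 + s / d%:R))
    +o_\oo (fun N : nat => N%:R `^ (1 + s / d%:R))) ->
  (forall m, uniq (r m)) ->
  (forall N0, \forall m \near \oo, (N0 <= size (r m))%N) ->
  \forall m \near \oo, riesz_kappa d s * freq_energy s (r m) <=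
    (e - C) * (size (r m))%:R `^ (1 + s / d%:R).
Proof.
move=> d0 s0 sd e0 /eqaddoP /(_ e e0) [N0 _ HN0] ur roo.
near=> m.
have Nm : (N0 <= size (r m))%N by near: m; exact: roo.
have := HN0 _ Nm; rewrite !fctE /=.
have [B HB] := min_riesz_energy_ge d0 sd (size (r m)).
have := min_riesz_energy_le_seq d0 s0 sd (ur m).
(* The energy is bounded on both sides by reals, so [fine] can be removed; the N^2 terms then
   cancel. *)
have [x ->] : exists x : R, min_riesz_energy (1%:M : 'M[R]_d) s (size (r m)) = x%:E.
  have := min_riesz_energy_le_seq d0 s0 sd (ur m).
  case: min_riesz_energy HB => [x _ _|//|//]; by exists x.
rewrite lee_fin [X in _ <= e * X]ger0_norm ?powR_ge0// ler_norml.
move=> h1 /andP[h2 _]; move: h1 h2.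
set a := riesz_kappa d s * _; set b := riesz_mean d s * _; set c := (_ `^ _).
by move=> h1 /= h2; lra.
Unshelve. all: by end_near. Qed.

Theorem mainTheorem4 (R : realType) (d : nat) (s C : R) :
  (0 < d)%N -> 0 < s -> s < d%:R ->
  (forall A : 'M[R]_d, A \in unitmx ->
    (fun N : nat => fine (min_riesz_energy A s N)) =
    (fun N : nat =>
       2 * pi `^ (d%:R / 2) * (covolume A)^-1 / (Gamma (s / 2) * (d%:R - s))
         * N%:R ^+ 2
       + C * covolume A `^ (- (s / d%:R)) * N%:R `^ (1 + s / d%:R))
    +o_\oo (fun N : nat => N%:R `^ (1 + s / d%:R))) ->
  forall (A : 'M[R]_d) (D : set 'cV[R]_d),
    A \in unitmx ->
    open D -> bounded_set D ->
    lebesgue_cV R d (closure D `\` interior D) = 0%E ->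
    (lebesgue_cV R d D * (covolume A)%:E = 1)%E ->
    (C%:E <=
     - ((pi `^ (s - d%:R / 2) * Gamma ((d%:R - s) / 2) /
         (Gamma (s / 2) * covolume A `^ (1 - s / d%:R)))%:E *
        riesz_integral A D (d%:R - s)))%E.
Proof.
move=> d0 s0 sd asym A D A1 oD bD _ DA.
set p := 1 + s / d%:R; set K := (X in (_ <= - (X%:E * _))%E).
have [r ur rP] : exists2 r : nat -> seq 'cV[int]_d, (forall m, uniq (r m)) &
    forall m w, w \in r m <-> @cell R d m w `<=` D.
  have /choice[r Hr] : forall m, exists r : seq 'cV[int]_d, uniq r /\
      forall w, w \in r <-> @cell R d m w `<=` D.
    by move=> m; have [r ? ?] := inner_cells d0 bD m; exists r.
  by exists r => m; have [] := Hr m.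
have V0 : 0 < covolume A by rewrite normr_gt0 -unitfE -unitmxE.
have D0 : D !=set0.
  apply/set0P/eqP => D0; move: DA; rewrite D0 measure0 mul0e => /eqP.
  by rewrite eq_sym onee_eq0.
have asym1 : (fun N : nat => fine (min_riesz_energy (1%:M : 'M[R]_d) s N)) =
    (fun N : nat => riesz_mean d s * N%:R ^+ 2 + C * N%:R `^ p)
    +o_\oo (fun N : nat => N%:R `^ p).
  have := asym 1%:M (unitmx1 _ _).
  by rewrite /covolume det1 normr1 powR1 invr1 !mulr1.
have K0 : 0 <= K.
  rewrite /K; apply: divr_ge0; rewrite mulr_ge0 ?powR_ge0 ?Gamma_ge0//.
have kK : riesz_kappa d s = K * covolume A `^ (1 - s / d%:R).
  rewrite /riesz_kappa /K invfM mulrA mulrVK ?unitfE ?gt_eqF ?powR_gt0//.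
suff H e : 0 < e -> (K%:E * riesz_integral A D (d%:R - s) <= (e - C)%:E)%E.
  rewrite leeNr -EFinN; apply/lee_addgt0Pr => e /H.
  by rewrite -EFinD [(- C + e)%R]addrC.
move=> e0.
have Hm : \forall m \near \oo,
    K * (m.+1%:R `^ (d%:R - s) * freq_energy s (r m) *
      (covolume A * (m.+1%:R ^+ d)^-1) ^+ 2) <= e - C.
  have Sinf := size_inner_cells_infty d0 oD rP D0.
  have := freq_energy_near d0 s0 sd e0 asym1 ur Sinf.
  apply: filterS2 (Sinf 1) => m Nm Hk.
  (* Disjoint cells of nu-mass [u] inside [D], whose nu-mass is the covolume times its Lebesgue
     measure, that is, 1. *)
  have : (size (r m))%:R * (covolume A * (m.+1%:R ^+ d)^-1) <= 1.
    rewrite -lee_fin -[leRHS]DA muleC.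
    exact: (size_inner_cells oD ur rP (dual_measure_cell A m)).
  set n : R := m.+1%:R in Hk *; set u := covolume A * _ => Nu.
  have n0 : 0 < n by [].
  have u0 : 0 < u by rewrite mulr_gt0// invr_gt0 exprn_gt0.
  have N0 : 0 < (size (r m))%:R :> R by rewrite ltr0n.
  (* Substituting covolume = u n^d turns the right-hand side into u^(1-s/d) n^(d-s) u^(1+s/d). *)
  have scale : n `^ (d%:R - s) * u ^+ 2 = covolume A `^ (1 - s / d%:R) * u `^ p.
    have -> : covolume A = u * n `^ d%:R.
      by rewrite powR_mulrn ?ltW// /u mulrVK// unitfE expf_neq0// gt_eqF.
    rewrite powRM ?powR_ge0 ?(ltW u0)// -powRrM mulrAC -powRD ?(gt_eqF u0) ?implybT//.
    rewrite (_ : d%:R * _ = d%:R - s); last first.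
      by rewrite mulrBr mulr1 mulrCA divff ?mulr1// pnatr_eq0 -lt0n.
    rewrite (_ : _ + p = 2%:R) /p; last by ring.
    by rewrite powR_mulrn ?ltW// mulrC.
  (* In [Hk] the left-hand side is nonnegative and N > 0. The sign allows (N u)^p <= 1 to be used as
     a bound on the factor of [e - C]. *)
  have eC : 0 <= e - C.
    rewrite -(pmulr_lge0 _ (powR_gt0 p N0)); apply: le_trans Hk.
    rewrite kK; apply: mulr_ge0; first by rewrite mulr_ge0 ?powR_ge0.
    by do 2!apply: sumr_ge0 => ? _; rewrite invr_ge0 powR_ge0.
  rewrite [X in K * X]mulrAC scale [X in K * X]mulrAC !mulrA -kK.
  apply: le_trans (ler_wpM2r (powR_ge0 u p) Hk) _.
  rewrite -mulrA -powRM ?(ltW u0) ?(ltW N0)// ler_piMr//.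
  rewrite -[leRHS](congr1 (@^~ p) (powR1 R)).
  have p0 : 0 <= p by rewrite addr_ge0// divr_ge0// ltW.
  by apply: (ge0_ler_powR p0 _ _ Nu); rewrite nnegrE// mulr_ge0// ltW.
have I1 := riesz_integral_le_einf s A oD ur rP.
(* Only [Gamma_ge0] is established, so K = 0 is treated apart: the product is then 0 even for an
   infinite integral, and [Hm] reads [0 <= e - C]. *)
have [K00|Kn0] := eqVneq K 0.
  rewrite K00 mul0e lee_fin.
  have [m] := filter_ex Hm; by rewrite K00 mul0r.
have Kp : 0 < K by rewrite lt_def Kn0.
have I2 : (riesz_integral A D (d%:R - s) <= ((e - C) / K)%:E)%E.
  apply: le_trans I1 _; apply: limn_einf_le_near; apply: filterS Hm => m.
  by rewrite lee_fin ler_pdivlMr// mulrC.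
apply: le_trans (lee_wpmul2l _ I2) _; first by rewrite lee_fin.
by rewrite -EFinM lee_fin mulrC divfK.
Qed.
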